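(* For an integer $n>3$ let $f(n)$ be the number of genus one labeled circle trees on $n$ points (counted up to isomorphism of labeled circle trees). Then: (1) For every integer $n>3$, $f(n)$ is divisible by $n$ or by $\frac n2$. (2) For $n>3$, $f(n)$ is not divisible by $n$ but is divisible by $\frac n2$ if and only if $n$ is of one of the following forms: (i) $n=32v+10$ with $v\ge 0$ a negligent number; (ii) $n=64v+18$ with $v\ge 0$ a negligent number; (iii) $n=64\cdot 2^{k}\cdot v+16\cdot 2^{k}+2$ with $k\ge 1$ an integer and $v\ge 0$ a negligent number. (3) For all other $n>3$, $f(n)$ is divisible by $n$.
   Context: A labeled circle tree (l-c-tree) on $n$ points is a tree whose $n$ vertices are placed on a circle and labeled $1,\dots,n$ in counterclockwise order, with edges drawn as straight line segments inside the circle. Two l-c-trees are isomorphic if they have the same edges in terms of labels; so l-c-trees on $n$ points up to isomorphism are exactly the trees on the vertex set $\{1,\dots,n\}$. Genus. Let $T$ be an l-c-tree with $m\geq 1$ edges. Split each vertex $v$ of degree $d$ into $d$ nearby points on the circle, each being the endpoint of one of the $d$ edges at $v$, in such a way that edges sharing an endpoint $v$ do not cross (going counterclockwise through the $d$ points, the other endpoints of the edges are met in clockwise order starting from $v$). This gives $N=2m$ points on the circle, numbered $1,\dots,N$ counterclockwise, and a fixed-point-free involution $\alpha$ of $\{1,\dots,N\}$ exchanging the two endpoints of each edge (the matching of $T$). With $\sigma=(1\,2\,\cdots\,N)$ and $z(\pi)$ the number of cycles of a permutation $\pi$ (fixed points included), the genus of $T$ is $g=1+\frac12\left(N-1-z(\alpha)-z(\alpha^{-1}\sigma)\right)$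 (product from right to left). A nonnegative integer $v$ is a negligent number if $v=0$ or $v$ can be written as $v=\sum_{i=0}^{f}4^i\,2^{l_i}$ for some integer $f\ge 0$ and integers $0\le l_0\le l_1\le\cdots\le l_f$. *)

(* Defs.v *)
From mathcomp Require Import all_boot all_fingroup all_algebra.

Set Implicit Arguments.
Unset Strict Implicit.
Unset Printing Implicit Defensive.

Import GRing.Theory Num.Theory.

(* The n points are 'I_n, i.e. 0, ..., n - 1 in counterclockwise order (the
   labels 1, ..., n shifted by one).  A graph on these points is given by its
   set of edges, an edge being the set of its two endpoints; as isomorphic
   l-c-trees are those with the same edges, counting l-c-trees up to
   isomorphism is counting such sets. *)

Definition adj n (E : {set {set 'I_n}}) (v w : 'I_n) : bool :=
  (v != w) && ([set v; w] \in E).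

Definition simple_graph n (E : {set {set 'I_n}}) : bool :=
  [forall e in E, #|e| == 2].

Definition connected_graph n (E : {set {set 'I_n}}) : bool :=
  [forall v, forall w, connect (adj E) v w].

(* The length of a cycle without repeated vertex is at most n. *)
Definition acyclic_graph n (E : {set {set 'I_n}}) : bool :=
  [forall k : 'I_n.+1, forall c : k.-tuple 'I_n,
     (2 < k) ==> ~~ ucycleb (adj E) c].

Definition is_tree n (E : {set {set 'I_n}}) : bool :=
  [&& simple_graph E, connected_graph E & acyclic_graph E].

(* The points obtained by splitting the vertices, in counterclockwise order:
   the pair (v, w) is the endpoint at v of the edge {v, w}.  The points coming
   from v are ordered by their other endpoint w, met clockwise from v
   (v itself, which starts the trajectory, is never adjacent to v). *)
Definition split_points n (E : {set {set 'I_n}}) : seq ('I_n * 'I_n) :=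
  [seq d <- [seq (v, w) | v <- enum 'I_n, w <- traject (@ord_pred n) v n]
     | adj E d.1 d.2].

Definition nb_points n (E : {set {set 'I_n}}) : nat := size (split_points E).

Definition other_end n (d : 'I_n * 'I_n) : 'I_n * 'I_n := (d.2, d.1).

(* The default value i of insubd is not used, by other_end_split_points. *)
Definition matching_fun n (E : {set {set 'I_n}}) (i : 'I_(nb_points E)) :
    'I_(nb_points E) :=
  insubd i (index (other_end (tnth (in_tuple (split_points E)) i))
                  (split_points E)).

Lemma iter_ord_pred n (v : 'I_n) k :
  k <= n -> iter k (@ord_pred n) v = (v + (n - k)) %% n :> nat.
Proof.
have n0 : 0 < n by case: v => v; exact: leq_ltn_trans.
elim: k => [_|k IHk lkn]; first by rewrite subn0 /= modnDr modn_small.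
rewrite /= IHk; last exact: ltnW.
have e : n - k = (n - k.+1).+1 by rewrite subnSK.
rewrite e addnS.
set a := v + (n - k.+1).
have -> : (a.+1 %% n + n).-1 = a.+1 %% n + n.-1.
  by rewrite -subn1 -addnBA // subn1.
by rewrite modnDml addSnnS (prednK n0) modnDr.
Qed.

Lemma mem_traject_ord_pred n (v w : 'I_n) : w \in traject (@ord_pred n) v n.
Proof.
have n0 : 0 < n by case: v => v; exact: leq_ltn_trans.
apply/trajectP; exists ((v + (n - w)) %% n); first by rewrite ltn_mod.
apply/val_inj; rewrite /= iter_ord_pred; last by rewrite ltnW ?ltn_mod.
have [lwv|lvw] := leqP w v.
  have -> : v + (n - w) = v - w + n.
    by rewrite addnBA ?(ltnW (ltn_ord w)) // addnC -addnBA // addnC.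
  have lt : v - w < n by exact: leq_ltn_trans (leq_subr _ _) (ltn_ord v).
  rewrite modnDr (modn_small lt) addnBA; last exact: ltnW.
  rewrite addnC -addnBA ?leq_subr // subKn // addnC modnDr.
  by rewrite modn_small.
have lt : v + (n - w) < n.
  by rewrite addnBA ?(ltnW (ltn_ord w)) // ltn_subLR ?ltn_add2r // 
     (leq_trans (ltnW (ltn_ord w))) ?leq_addl.
rewrite (modn_small lt) addnBA; last exact: ltnW.
rewrite subnDl subKn; last exact: ltnW (ltn_ord w).
by rewrite modn_small.
Qed.

Lemma mem_split_points n (E : {set {set 'I_n}}) d :
  (d \in split_points E) = adj E d.1 d.2.
Proof.
rewrite mem_filter; case: d => v w /=; rewrite andb_idr // => _.
by apply/allpairsPdep; exists v, w; rewrite mem_enum mem_traject_ord_pred.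
Qed.

Lemma traject_ord_pred_uniq n (v : 'I_n) : uniq (traject (@ord_pred n) v n).
Proof.
apply/card_uniqP; rewrite size_traject -[RHS]card_ord.
by apply: eq_card => w; rewrite mem_traject_ord_pred.
Qed.

Lemma split_points_uniq n (E : {set {set 'I_n}}) : uniq (split_points E).
Proof.
apply/filter_uniq/allpairs_uniq_dep; first exact: enum_uniq.
- by move=> v _; exact: traject_ord_pred_uniq.
- by move=> [v w] [v' w'] _ _ [-> ->].
Qed.

Lemma other_end_split_points n (E : {set {set 'I_n}}) d :
  d \in split_points E -> other_end d \in split_points E.
Proof. by rewrite !mem_split_points /adj /= eq_sym setUC. Qed.

Lemma matching_funE n (E : {set {set 'I_n}}) (i : 'I_(nb_points E)) :
  tnth (in_tuple (split_points E)) (matching_fun i)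
  = other_end (tnth (in_tuple (split_points E)) i).
Proof.
set d := tnth _ i.
have oin : other_end d \in split_points E.
  by apply: other_end_split_points; exact: mem_tnth.
rewrite (tnth_nth d) /matching_fun insubdK ?nth_index //.
by rewrite -[_ \in _]/(_ < _) index_mem.
Qed.

Lemma matching_funK n (E : {set {set 'I_n}}) : involutive (@matching_fun n E).
Proof.
have inj := elimT (tuple_uniqP (in_tuple (split_points E))) (split_points_uniq E).
move=> i; apply: inj.
by rewrite !matching_funE; case: (tnth _ i).
Qed.

Definition matching n (E : {set {set 'I_n}}) : {perm 'I_(nb_points E)} :=
  perm (inv_inj (@matching_funK n E)).

Definition long_cycle N : {perm 'I_N} := perm (@ordS_inj N).

Definition nb_cycles N (s : {perm 'I_N}) : nat := #|porbits s|.

(* The product of permutations is from left to right in the library, so that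
   alpha^-1 sigma (sigma first) is written long_cycle * matching^-1. *)
Definition genus n (E : {set {set 'I_n}}) : rat :=
  (1 + (1 / 2%:R) *
       ((nb_points E)%:R - 1 - (nb_cycles (matching E))%:R
        - (nb_cycles (long_cycle (nb_points E) * (matching E)^-1)%g)%:R))%R.

Definition nb_genus_one_lct (n : nat) : nat :=
  #|[set E : {set {set 'I_n}} | is_tree E && (genus E == 1%R)]|.

(* Divisibility by a rational number, as n / 2 need not be an integer. *)
Definition rat_dvd (d a : rat) : Prop := exists k : int, a = (k%:~R * d)%R.

Definition negligent (v : nat) : Prop :=
  v = 0 \/
  exists (f : nat) (l : 'I_f.+1 -> nat),
    (forall i j : 'I_f.+1, i <= j -> l i <= l j) /\
    v = \sum_(i < f.+1) 4 ^ i * 2 ^ l i.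

(* Main.v *)
(** Rotations act on the genus one trees.  The stabilizer of a tree acts on its
    n - 1 edges, freely unless it contains the half turn rho, so only the trees
    invariant under rho have an orbit of length n/2 instead of n; such a tree
    contains exactly one diameter.  Hence, for n = 2m, n divides f(n) iff the
    number of rho-invariant genus one trees containing the diameter D = {0, m}
    is even.  Modulo 2 it suffices to count those that are moreover invariant
    under the reflection fixing 0.  They exist only for m = 2x + 1, and folding
    the circle along both axes identifies them with the pairs (Q, d) where Q is a
    noncrossing tree on [0, x] all of whose edges at 0 end in [0, d], and d < x:
    the edges of Q from [0, d] to ]d, x] are those that cross D before folding.

    A noncrossing tree is cut at its edge from 0 to the farthest neighbour of 0
    into three noncrossing trees.  Modulo 2, swapping the first two of them gives
    recursions for the number t of noncrossing trees and for the number of pairs: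
    the latter is odd iff x = 2w with w > 0 and t_w odd, and t_w is odd iff
    w is negligent (i.e., has no two adjacent binary digits 1).

    The genus is controlled by linear algebra over F_2: the functions that are
    constant on the faces correspond to the kernel of the crossing matrix of the
    edges, so genus one means that this alternating matrix has rank two. *)

Require Import Defs.
From mathcomp Require Import all_boot all_fingroup all_algebra.
From mathcomp Require Import all_solvable zify lra boolp.

Set Implicit Arguments.
Unset Strict Implicit.
Unset Printing Implicit Defensive.

(** * Trees and cuts *)

(** For a tree with at least one edge, the number of faces is one more than the dimension of the
    kernel of the crossing matrix, so the genus is half the rank of that matrix. In rank two, any
    two crossing edges determine all crossings, and D can be one of them: an edge that does not
    cross D meets all those that do in the same way, and two edges crossing D meet according to one
    bit attached to each. Comparing edges with their images under the symmetries fixes these bits,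
    and this is what makes the folded tree noncrossing.

    The number d is the last vertex of [0, x] in the component of 0 once D is removed; the hard
    point is that this component is an initial segment of the quarter. Such claims are proved
    without following paths, by exhibiting a boolean function that is constant along the edges but
    would take two values.

    A tree Q whose farthest neighbour of 0 is c belongs to x - c pairs (Q, d). After the
    cancellation modulo 2 only odd c remain, so these weights are odd exactly when x is even. *)

(* Trees are handled through boolean functions on the vertices: a graph is
   connected iff the functions constant along its edges are constant, and it is
   moreover acyclic iff every edge is the only one along which some function
   changes. *)
Definition edge_invariant n (E : {set {set 'I_n}}) (R : 'I_n -> bool) :=
  forall u v, [set u; v] \in E -> R u = R v.

Definition cut_of n (E : {set {set 'I_n}}) (e : {set 'I_n}) (R : 'I_n -> bool) :=
  forall u v, [set u; v] \in E -> (R u != R v) = ([set u; v] == e).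

Definition tree_cuts n (E : {set {set 'I_n}}) :=
  [/\ forall e, e \in E -> #|e| = 2,
      forall R, edge_invariant E R -> forall u v, R u = R v
    & forall e, e \in E -> exists R, cut_of E e R].

Lemma simple_edge n (E : {set {set 'I_n}}) u v :
  (forall e, e \in E -> #|e| = 2) -> [set u; v] \in E -> u != v.
Proof. by move=> sE /sE; rewrite cards2; case: (u != v). Qed.

Lemma set2_inj (T : finType) (a b c d : T) :
  [set a; b] = [set c; d] -> (a = c /\ b = d) \/ (a = d /\ b = c).
Proof.
move=> e.
have : a \in [set c; d] by rewrite -e !inE eqxx.
have : b \in [set c; d] by rewrite -e !inE eqxx orbT.
have : c \in [set a; b] by rewrite e !inE eqxx.
have : d \in [set a; b] by rewrite e !inE eqxx orbT.
rewrite !inE => /orP[]/eqP-> /orP[]/eqP-> /orP[]/eqP h1 /orP[]/eqP h2; subst; auto.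
Qed.

Lemma adj_sym n (E : {set {set 'I_n}}) : symmetric (adj E).
Proof. by move=> u v; rewrite /adj eq_sym setUC. Qed.

Lemma edge_invariant_connect n (E : {set {set 'I_n}}) R u v :
  edge_invariant E R -> connect (adj E) u v -> R u = R v.
Proof.
move=> iR /connectP[p pP ->]; elim: p u pP => //= w p IH u /andP[/andP[_ uw] /IH <-].
exact: iR.
Qed.

Lemma is_treeP n (E : {set {set 'I_n}}) : reflect (tree_cuts E) (is_tree E).
Proof.
apply: (iffP and3P) => [[/forall_inP sE cE aE]|[sE cE aE]].
  have {}sE e : e \in E -> #|e| = 2 by move=> /sE/eqP.
  split=> //.
    move=> R iR u v; apply: edge_invariant_connect iR _.
    by have /forallP/(_ u)/forallP := cE; apply.
  move=> e eE; have /eqP/cards2P[a [b [ab ee]]] := sE e eE; subst e.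
  (* The cut is the component of [a] once the edge is removed; a path from [a] to [b] avoiding the
     edge would close up to a cycle. *)
  exists (connect (adj (E :\ [set a; b])) a) => u v uvE.
  have symc := sym_connect_sym (@adj_sym _ (E :\ [set a; b])) .
  have [uv|uv] := eqVneq [set u; v] [set a; b]; last first.
    apply/negbTE; rewrite negbK; apply/eqP/same_connect_r; first by exact: symc.
    by apply: connect1; rewrite /adj !inE uvE uv (simple_edge sE uvE).
  suff nab : ~~ connect (adj (E :\ [set a; b])) a b.
    have := set2_inj uv.
    by case=> -[-> ->]; rewrite connect0 // (negPf nab).
  apply/negP => /connectP[p pP lp].
  case/shortenP: pP lp => p' pP' up' _ lp.
  (* The edge itself being removed, the path has an inner vertex, so the cycle has length at least
     three. *)
  have sp : 1 < size p'.
    case: p' pP' up' lp => [|c [|c' p']] //=; first by move=> _ _ e; rewrite e eqxx in ab.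
    by rewrite /adj !inE => /andP[/andP[_ /andP[h _]] _] _ e; rewrite e eqxx in h.
  have sz : size (a :: p') < n.+1.
    rewrite ltnS -[X in _ <= X]card_ord -cardsT.
    by rewrite -(card_uniqP up') subset_leq_card //; apply/subsetP=> ?; rewrite !inE.
  have /forallP/(_ (Ordinal sz))/forallP/(_ (in_tuple (a :: p'))) := aE.
  rewrite /= ltnS sp /= => /negP; apply.
  rewrite /ucycleb up' andbT /= rcons_path -lp.
  rewrite {2}/adj eq_sym ab setUC eE !andbT.
  suff sub : subrel (adj (E :\ [set a; b])) (adj E) by exact: (sub_path sub pP').
  by move=> c d; rewrite /adj !inE => /and3P[-> _ ->].
split.
- by apply/forall_inP => e /sE/eqP.
- apply/forallP=> u; apply/forallP=> v.
  have symc := sym_connect_sym (@adj_sym _ E).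
  rewrite -(cE (connect (adj E) u) _ u v) ?connect0 // => a b abE.
  apply: same_connect_r => //; apply: connect1.
  by rewrite /adj (simple_edge sE abE).
- apply/forallP=> k; apply/forallP=> c; apply/implyP=> k2; apply/negP.
  rewrite /ucycleb => /andP[].
  have := size_tuple c; case: (tval c) => [|a [|b [|d p]]] sc; try by rewrite -sc in k2.
  move=> /= /and3P[/andP[ab abE] /andP[bd bdE] pP] up.
  have [R cR] := aE _ abE.
  (* The cycle does not return to [b], so the part after [b] joins [b] to [a] without using
     [{a, b}], against the cut [R]. *)
  have bp : all (predC1 b) (d :: rcons p a).
    rewrite /= all_rcons /=; move: up; rewrite !inE => /and3P[/norP[h1 /norP[_ _]] /norP[h3 h4] _].
    rewrite eq_sym h3 h1 /=; apply/allP=> c' c'p /=; apply: contraNneq h4 => <-//.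
  have iR : edge_invariant (E :\ [set a; b]) R.
    move=> u v; rewrite in_setD1 => /andP[/negPf uvn uvE]; apply/eqP.
    by rewrite -[_ == _]negbK cR //= uvn.
  have /(edge_invariant_connect iR) : connect (adj (E :\ [set a; b])) b a.
    apply/connectP; exists (d :: rcons p a); last by rewrite /= last_rcons.
    have dab : [set b; d] != [set a; b].
      have [ane bne] : d != a /\ d != b.
        by move: up bp; rewrite !inE /= => /and3P[/norP[h1 /norP[h2 h3]] _ _] /andP[->]; rewrite eq_sym h2.
      by apply/eqP=> /set2_inj; case=> -[_ h2]; [rewrite h2 eqxx in bne | rewrite h2 eqxx in ane].
    rewrite /= {1}/adj bd in_setD1 dab bdE /=.
    apply: (sub_in_path _ bp pP) => u v; rewrite !inE => ub vb /andP[uv uvE].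
    rewrite /adj uv in_setD1 uvE andbT; apply: contraNneq ub => /set2_inj.
    by case=> -[h1 h2]; [rewrite h2 eqxx in vb | rewrite h1].
  by have := cR _ _ abE; rewrite eqxx => /[swap] ->; rewrite eqxx.
Qed.

(** Finite functions and a boolean form of the cut condition let [xchoose] select one cut for each
    edge. *)
Lemma cut_choice n (E : {set {set 'I_n}}) : tree_cuts E ->
  exists K : {set 'I_n} -> 'I_n -> bool, forall e, e \in E -> cut_of E e (K e).
Proof.
case=> _ _ cE.
have cE' (e : {set 'I_n}) : exists r : {ffun 'I_n -> bool}, e \in E -> cut_of E e r.
  have [eE|eE] := boolP (e \in E); last by exists [ffun=> false].
  by have [R cR] := cE e eE; exists (finfun R) => _ u v uvE; rewrite !ffunE cR.
have cEb (e : {set 'I_n}) : exists r : {ffun 'I_n -> bool}, (e \in E) ==>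
   [forall u, forall v, ([set u; v] \in E) ==> ((r u != r v) == ([set u; v] == e))].
  have [r cr] := cE' e; exists r; apply/implyP=> /cr {}cr.
  by apply/forallP=> u; apply/forallP=> v; apply/implyP=> h; apply/eqP; exact: cr.
exists (fun e => fun_of_fin (xchoose (cEb e))) => e eE u v uvE.
have /implyP/(_ eE)/forallP/(_ u)/forallP/(_ v)/implyP/(_ uvE)/eqP := xchooseP (cEb e).
by [].
Qed.

(* Up to complement, functions on the vertices correspond to the sets of edges
   along which they change. *)
Lemma card_tree_edges n (E : {set {set 'I_n.+1}}) : tree_cuts E -> #|E| = n.
Proof.
move=> tE; have [sE cE _] := tE; have [K KE] := cut_choice tE.
pose d (R : {ffun 'I_n.+1 -> bool}) : bool * {set {set 'I_n.+1}} :=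
  (R ord0, [set e in E | [exists u, exists v, (e == [set u; v]) && (R u != R v)]]).
pose X := setX [set: bool] (powerset E).
have cX : #|X| = 2 ^ #|E|.+1 by rewrite cardsX cardsT card_bool card_powerset expnS.
have cR : #|{ffun 'I_n.+1 -> bool}| = 2 ^ n.+1 by rewrite card_ffun card_bool card_ord.
have dE R e u v : e \in E -> e = [set u; v] -> (e \in (d R).2) = (R u != R v).
  move=> eE ee; rewrite inE eE /=; apply/existsP/idP.
    case=> a /existsP[b /andP[/eqP + ab]]; rewrite ee => /set2_inj.
    by case=> -[-> ->] //; rewrite eq_sym.
  by move=> uv; exists u; apply/existsP; exists v; rewrite ee eqxx.
(* Connectedness: two functions that change along the same edges and agree at [ord0] have an
   edge-invariant sum vanishing at [ord0]. *)
have le1 : 2 ^ n.+1 <= 2 ^ #|E|.+1.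
  rewrite -cX -cR -cardsT.
  have dinj : injective d.
    move=> R S dRS; apply/ffunP=> v.
    have e0 : R ord0 = S ord0 by have [] := dRS.
    have h : edge_invariant E (fun v => R v (+) S v).
      move=> a b abE; have := dE R _ a b abE erefl; rewrite dRS (dE S _ a b abE erefl).
      by case: (R a) (R b) (S a) (S b) => [] [] [] [].
    by have := cE _ h v ord0; rewrite /= e0 addbb; case: (R v) (S v) => [] [].
  rewrite -(card_imset _ dinj); apply/subset_leq_card/subsetP=> x /imsetP[R _ ->].
  by rewrite !inE /=; apply/subsetP=> e; rewrite inE => /andP[].
(* Acyclicity: the sum of the cuts [K e] over a set of edges changes along exactly these edges. *)
have le2 : 2 ^ #|E|.+1 <= 2 ^ n.+1.
  rewrite -cX -cR.
  pose g (x : bool * {set {set 'I_n.+1}}) := [ffun v => x.1 (+)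
    \big[addb/false]_(e in x.2) (K e v (+) K e ord0)].
  have ginj : {in X &, injective g}.
    move=> [b F] [c G] /setXP[_ FE] /setXP[_ GE] /ffunP gg.
    have bc : b = c.
      have := gg ord0; rewrite !ffunE /= big1 ?big1 ?addbF // => e _; exact: addbb.
    subst c; congr pair; apply/setP=> e.
    have hF (H : {set {set 'I_n.+1}}) u v : H \subset E -> e = [set u; v] -> e \in E ->
       (e \in H) = g (b, H) u (+) g (b, H) v.
      move=> HE ee eE; rewrite !ffunE /= addbACA addbb addFb -big_split /=.
      rewrite (eq_bigr (fun f => e == f)); last first.
        move=> f fH; rewrite addbACA addbb addbF ee -(KE f) -?ee //; last exact: (subsetP HE).
        by case: (K f u) (K f v) => [] [].
      have [eH|eH] := boolP (e \in H).
        rewrite (bigD1 e) //= eqxx big1 // => f /andP[_ /negPf fe].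
        by rewrite eq_sym fe.
      by rewrite big1 // => f fH; apply/negbTE; apply: contraNneq eH => ->.
    have [eE|eE] := boolP (e \in E).
      have /eqP/cards2P[u [v [_ ee]]] := sE e eE.
      by rewrite !inE in FE GE; rewrite (hF F u v) // (hF G u v) // !gg.
    rewrite !inE in FE GE.
    have nE (H : {set {set 'I_n.+1}}) : H \subset E -> (e \in H) = false.
      by move=> /subsetP HE; apply: contraNF eE => /HE.
    by rewrite !nE.
  by rewrite -(card_in_imset ginj) max_card.
by apply/eqP; rewrite -eqSS -(eqn_exp2l _ _ (isT : 1 < 2)) eqn_leq le1 le2.
Qed.

(** * Genus and crossings *)

(** Invariant functions are the functions of the cycle through a point. This turns numbers of
    cycles, hence the genus, into dimensions over F_2. *)
Lemma card_perm_invariant (T : finType) (s : {perm T}) :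
  #|[set h : {ffun T -> bool} | [forall i, h (s i) == h i]]| = 2 ^ #|porbits s|.
Proof.
pose g (B : {set {set T}}) := [ffun i => porbit s i \in B].
have ginj : {in powerset (porbits s) &, injective g}.
  move=> B C; rewrite !inE => /subsetP BP /subsetP CP /ffunP gg; apply/setP=> c.
  have sub (B' C' : {set {set T}}) : {subset B' <= porbits s} ->
     (forall i, g B' i = g C' i) -> c \in B' -> c \in C'.
    move=> BP' gg' cB; have /imsetP[i _ ci] := BP' c cB.
    by have := gg' i; rewrite !ffunE -ci cB.
  by apply/idP/idP; apply: sub.
rewrite -card_powerset -(card_in_imset ginj); apply: eq_card => h.
rewrite inE; apply/forallP/imsetP.
  move=> hs; exists [set porbit s i | i in T & h i].
    by rewrite inE; apply/subsetP=> _ /imsetP[i _ ->]; exact: imset_f.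
  have hp i j : porbit s i = porbit s j -> h i = h j.
    move=> /eqP; rewrite eq_porbit_mem => /porbitP[k ->].
    by elim: k => [|k IH]; rewrite ?expg0 ?perm1 // expgSr permM (eqP (hs _)).
  apply/ffunP=> i; rewrite ffunE; apply/idP/imsetP.
    by move=> hi; exists i => //; rewrite inE.
  by move=> [j]; rewrite inE => hj /hp ->.
by move=> [B _ ->] i; rewrite !ffunE; have := porbit_perm s 1 i; rewrite expg1 => ->.
Qed.

(** If [x] gives the jumps of a function on the gaps, this is its value on the gap before point [k],
    relative to the gap before point 0. *)
Definition psum N (x : {ffun 'I_N -> bool}) (k : nat) : bool :=
  \big[addb/false]_(j < N | j < k) x j.

Lemma psumS N (x : {ffun 'I_N -> bool}) (k : 'I_N) : psum x k.+1 = x k (+) psum x k.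
Proof.
rewrite /psum (bigD1 k) //=; congr addb; apply: eq_bigl => j.
by rewrite ltnS ltn_neqAle andbC.
Qed.

Lemma psum0 N (x : {ffun 'I_N -> bool}) : psum x 0 = false.
Proof. exact: big_pred0. Qed.

(** The terms cancel in pairs [{i, a i}]. In the face count, this says that the jumps add up to 0
    around the circle. *)
Lemma involution_sum_addb (T : finType) (a : T -> T) (x : T -> bool) :
  involutive a -> (forall i, a i != i) -> (forall i, x (a i) = x i) ->
  \big[addb/false]_i x i = false.
Proof.
move=> aK afp xa.
suff H (A : {set T}) : (forall i, i \in A -> a i \in A) ->
    \big[addb/false]_(i in A) x i = false.
  by rewrite -[RHS](H setT) //; apply: eq_bigl => i; rewrite inE.
have [k] := ubnP #|A|; elim: k A => // k IH A kA aA.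
have [->|[i iA]] := set_0Vmem A; first by rewrite big_set0.
rewrite (big_setD1 i) //= (big_setD1 (a i)) /=; last by rewrite !inE afp aA.
rewrite xa addbA addbb addFb IH //.
  have := cardsD1 (a i) (A :\ i); have := cardsD1 i A.
  by rewrite iA !inE afp aA //=; lia.
move=> j; rewrite !inE => /and3P[j1 j2 jA]; rewrite aA // andbT.
by rewrite (inj_eq (inv_inj aK)) j2 /= -{1}(aK i) (inj_eq (inv_inj aK)).
Qed.

(* The second condition says that every chord {i, a i} crosses evenly many chords
   of x, as [psum x (a i).+1 (+) psum x i] sums x strictly between i and a i. *)
Definition chord_kernel N (a : 'I_N -> 'I_N) : {set {ffun 'I_N -> bool}} :=
  [set x : {ffun 'I_N -> bool} | [forall i, (x (a i) == x i) && (psum x (a i).+1 == psum x i)]].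

(* A function h on the gaps between consecutive points that is constant on the
   faces is determined by its value on the last gap and by its jumps x, and the
   invariance says that x belongs to the kernel. *)
Lemma card_face_invariant N (a : {perm 'I_N.+1}) :
  involutive a -> (forall i, a i != i) ->
  #|[set h : {ffun 'I_N.+1 -> bool} | [forall i, h ((long_cycle N.+1 * a^-1)%g i) == h i]]|
    = 2 * #|chord_kernel a|.
Proof.
move=> aK afp.
have av : (a^-1)%g = a.
  by apply/permP => i; apply: (@perm_inj _ a); rewrite permKV aK.
rewrite av.
pose g (y : bool * {ffun 'I_N.+1 -> bool}) : {ffun 'I_N.+1 -> bool} :=
  [ffun i : 'I_N.+1 => y.1 (+) psum y.2 i.+1].
have psN x : x \in chord_kernel a -> psum x N.+1 = false.
  rewrite inE => /forallP xk.
  rewrite -[RHS](involution_sum_addb aK afp (fun i => eqP (proj1 (andP (xk i))))).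
  by apply: eq_bigl => j; rewrite ltn_ord.
have sE (i : 'I_N.+1) : long_cycle N.+1 i = ordS i by rewrite permE.
have -> : 2 * #|chord_kernel a| = #|setX [set: bool] (chord_kernel a)|.
  by rewrite cardsX cardsT card_bool.
have ginj : {in setX [set: bool] (chord_kernel a) &, injective g}.
  move=> [b x] [c y] /setXP[_ xk] /setXP[_ yk] /ffunP gg.
  have bc : b = c by have := gg ord_max; rewrite !ffunE /= !psN // !addbF.
  subst c; congr pair; apply/ffunP=> i.
  have pp (k : nat) : psum x k = psum y k \/ N.+1 < k.
    have [kN|] := leqP k N.+1; last by right.
    left; case: k kN => [|k] kN; first by rewrite !psum0.
    by have := gg (Ordinal kN); rewrite !ffunE /=; apply: addbI.
  have h1 : psum x i.+1 = psum y i.+1 by case: (pp i.+1) => //; have := ltn_ord i; lia.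
  have h0 : psum x i = psum y i by case: (pp i) => //; have := ltn_ord i; lia.
  by move: h1; rewrite !psumS h0 => /addIb.
rewrite -(card_in_imset ginj); apply: eq_card => h.
rewrite inE; apply/forallP/imsetP.
  move=> hs.
  pose x := [ffun k => h k (+) h (ord_pred k)].
  have hx (k : 'I_N.+1) : psum x k.+1 = h k (+) h ord_max.
    case: k => k kN; elim: k kN => [|k IH] kN.
      rewrite psumS psum0 addbF ffunE; congr (_ (+) h _); apply/val_inj => /=.
      by rewrite modn_small; lia.
    rewrite psumS /=; have := IH (ltnW kN) => /= ->.
    rewrite ffunE.
    have -> : ord_pred (Ordinal kN) = Ordinal (ltnW kN).
      apply/val_inj; rewrite [LHS]/= ?addSn /=.
      by rewrite modnDr modn_small //; lia.
    by rewrite addbA -(addbA (h _)) addbb addbF.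
  have hp (k : 'I_N.+1) : psum x k = h (ord_pred k) (+) h ord_max.
    have := hx k; rewrite psumS ffunE; case: (psum _ _) (h _) (h _) (h _) => [] [] [] [] //.
  (* With gap [i] lying after point [i], the permutation sends the gap before [k] to the gap after
     [a k]: both border the chord of [k] on the same side. *)
  have ha k : h (a k) = h (ord_pred k).
    have := hs (ord_pred k); rewrite permM sE (ord_predK k) => /eqP //.
  exists (h ord_max, x).
    rewrite in_setX in_setT inE; apply/forallP=> i /=.
    by rewrite hx hp ha eqxx andbT !ffunE -(ha (a i)) aK ha addbC.
  by apply/ffunP=> i; rewrite ffunE /= hx addbC -addbA addbb addbF.
case=> -[b x] /setXP[_ xk] -> i; rewrite !ffunE /= permM sE.
have := xk; rewrite inE => /forallP/(_ (ordS i))/andP[_ /eqP ->].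
have [iN|iN] := ltnP i.+1 N.+1; first by rewrite /= modn_small.
have e : i.+1 = N.+1 by have := ltn_ord i; lia.
have -> : (ordS i : nat) = 0 by rewrite /= e modnn.
by rewrite e psum0 psN.
Qed.

(* For distinct ends, ab and cd cross iff an odd number of ends of cd follow an
   end of ab. *)
Definition crossing (a b c d : nat) : bool :=
  [&& a != c, a != d, b != c, b != d & (a < c) (+) (a < d) (+) (b < c) (+) (b < d)].

Definition cross n (e f : {set 'I_n}) : bool :=
  [exists a, exists b, exists c, exists d,
     [&& e == [set a; b], f == [set c; d] & crossing a b c d]].

Lemma crossing_swapl a b c d : crossing b a c d = crossing a b c d.
Proof. rewrite /crossing. lia. Qed.

Lemma crossing_swapr a b c d : crossing a b d c = crossing a b c d.
Proof. rewrite /crossing. lia. Qed.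

Lemma crossing_sym a b c d : crossing c d a b = crossing a b c d.
Proof. rewrite /crossing. lia. Qed.

Lemma crossE n (a b c d : 'I_n) : cross [set a; b] [set c; d] = crossing a b c d.
Proof.
apply/existsP/idP => [[a' /existsP[b' /existsP[c' /existsP[d' /and3P[/eqP/set2_inj e1 /eqP/set2_inj e2]]]]]|h].
  case: e1 => -[-> ->]; case: e2 => -[-> ->] //.
  - by rewrite crossing_swapr.
  - by rewrite crossing_swapl.
  - by rewrite crossing_swapl crossing_swapr.
exists a; apply/existsP; exists b; apply/existsP; exists c; apply/existsP; exists d.
by rewrite !eqxx.
Qed.

(** * The order of the split points around the circle *)

Definition clock_dist n (v w : nat) := if w <= v then v - w else v + n - w.

(** Order of the list [split_points]. A dart [(v, w)] stands for the endpoint at [v] of the edge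
    [{v, w}]. *)
Definition dart_lt n (p q : 'I_n * 'I_n) : bool :=
  (p.1 < q.1) || ((p.1 == q.1) && (clock_dist n p.1 p.2 < clock_dist n q.1 q.2)).

Definition dart_le n (p q : 'I_n * 'I_n) : bool :=
  (p.1 < q.1) || ((p.1 == q.1) && (clock_dist n p.1 p.2 <= clock_dist n q.1 q.2)).

(** The left side counts modulo 2 the endpoints of [{c, d}] on an arc between the two endpoints of
    [{a, b}]. The clockwise order of the splitting makes it even when the edges share a vertex. The
    mixture of [dart_le] and [dart_lt] comes from the two bounds of [psum] in [chord_kernel]. *)
Lemma dart_cross n (a b c d : 'I_n) : a != b -> c != d ->
  dart_le (c, d) (b, a) (+) dart_le (d, c) (b, a) (+) dart_lt (c, d) (a, b)
    (+) dart_lt (d, c) (a, b) = crossing a b c d.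
Proof.
rewrite /dart_le /dart_lt /crossing /clock_dist -!val_eqE /=.
have := (ltn_ord a, ltn_ord b, ltn_ord c, ltn_ord d).
move: (val a) (val b) (val c) (val d) => {}a {}b {}c {}d [[[ha hb] hc] hd].
move=> ab cd.
case: (ltngtP a b) ab => // ab _; case: (ltngtP c d) cd => // cd _;
case: (ltngtP a c) => ac; case: (ltngtP a d) => ad; 
case: (ltngtP b c) => bc; case: (ltngtP b d) => bd; rewrite /=; lia.
Qed.

Lemma dart_lt_traject n (v : 'I_n) :
  pairwise (@dart_lt n) [seq (v, w) | w <- traject (@ord_pred n) v n].
Proof.
rewrite pairwise_map; apply/(pairwiseP v) => i j; rewrite !inE size_traject => iN jN ij.
rewrite /relpre /= /dart_lt /= ltnn eqxx /= !nth_traject // /clock_dist.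
rewrite !iter_ord_pred; try exact: ltnW.
have vn := ltn_ord v.
have H k : k < n -> (v + (n - k)) %% n = if k <= v then v - k else v + n - k.
  move=> kn; case: ifP => kv; last by rewrite modn_small; lia.
  have -> : v + (n - k) = (v - k) + n by lia.
  by rewrite modnDr modn_small; lia.
rewrite !H //; case: (leqP i v) => ?; case: (leqP j v) => ?; do !case: ifP; lia.
Qed.

Lemma dart_lt_split_points n (E : {set {set 'I_n}}) :
  pairwise (@dart_lt n) (split_points E).
Proof.
apply: pairwise_filter.
have : pairwise ltn (map val (enum 'I_n)).
  by rewrite -sorted_pairwise ?val_enum_ord ?iota_ltn_sorted //; exact: ltn_trans.
elim: (enum 'I_n) => //= v l IH /andP[vl /IH IHl].
rewrite pairwise_cat dart_lt_traject IHl !andbT.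
apply/allrelP => _ _ /mapP[w _ ->] /allpairsPdep[v' [w' [v'l _ ->]]].
rewrite /dart_lt /=; apply/orP; left.
by apply: (allP vl); exact: map_f.
Qed.

Definition dart n (E : {set {set 'I_n}}) (i : 'I_(nb_points E)) :=
  tnth (in_tuple (split_points E)) i.

Lemma dart_inj n (E : {set {set 'I_n}}) : injective (@dart n E).
Proof. exact: (elimT (tuple_uniqP (in_tuple (split_points E))) (split_points_uniq E)). Qed.

Lemma mem_dart n (E : {set {set 'I_n}}) (i : 'I_(nb_points E)) :
  dart i \in split_points E.
Proof. exact: mem_tnth. Qed.

Lemma dart_ltE n (E : {set {set 'I_n}}) (i j : 'I_(nb_points E)) :
  (i < j) = dart_lt (dart i) (dart j).
Proof.
have H (k l : 'I_(nb_points E)) : k < l -> dart_lt (dart k) (dart l).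
  move=> kl; have e (h : 'I_(nb_points E)) : dart h = nth (dart k) (split_points E) h by exact: tnth_nth.
  have := dart_lt_split_points E.
  move/(pairwiseP (dart k)) => /(_ k l); rewrite !inE => /(_ (ltn_ord k) (ltn_ord l) kl).
  by rewrite -!e.
apply/idP/idP; first exact: H.
case: ltngtP => // [/H|/val_inj ->].
  by rewrite /dart_lt -!val_eqE /=; lia.
by rewrite /dart_lt; lia.
Qed.

Lemma dart_leE n (E : {set {set 'I_n}}) (i j : 'I_(nb_points E)) :
  (i <= j) = dart_le (dart i) (dart j).
Proof. rewrite leqNgt dart_ltE /dart_lt /dart_le -!val_eqE /=; lia. Qed.

Lemma dart_surj n (E : {set {set 'I_n}}) d :
  adj E d.1 d.2 -> exists i : 'I_(nb_points E), dart i = d.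
Proof.
by rewrite -mem_split_points => /(tnthP (in_tuple (split_points E)))[i ->]; exists i.
Qed.

Lemma dart_adj n (E : {set {set 'I_n}}) (i : 'I_(nb_points E)) :
  adj E (dart i).1 (dart i).2.
Proof. by rewrite -mem_split_points mem_dart. Qed.

Lemma dart_matching n (E : {set {set 'I_n}}) (i : 'I_(nb_points E)) :
  dart (matching E i) = ((dart i).2, (dart i).1).
Proof. by rewrite /matching permE /dart matching_funE. Qed.

Definition edge_of n (E : {set {set 'I_n}}) (i : 'I_(nb_points E)) :=
  [set (dart i).1; (dart i).2].

Lemma edge_ofE n (E : {set {set 'I_n}}) (i : 'I_(nb_points E)) : edge_of i \in E.
Proof. by have /andP[] := dart_adj i. Qed.

Lemma edge_of_matching n (E : {set {set 'I_n}}) (i : 'I_(nb_points E)) :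
  edge_of (matching E i) = edge_of i.
Proof. by rewrite /edge_of dart_matching setUC. Qed.

Lemma edge_of_inj n (E : {set {set 'I_n}}) (i j : 'I_(nb_points E)) :
  edge_of i = edge_of j -> i = j \/ i = matching E j.
Proof.
move=> /set2_inj; case=> -[e1 e2]; [left|right]; apply: dart_inj.
  by case: (dart i) (dart j) e1 e2 => a b [c d] /= -> ->.
by rewrite dart_matching -e1 -e2; case: (dart i).
Qed.

Lemma matchingK n (E : {set {set 'I_n}}) : involutive (matching E).
Proof. by move=> i; rewrite /matching !permE matching_funK. Qed.

Lemma matching_neq n (E : {set {set 'I_n}}) (i : 'I_(nb_points E)) : matching E i != i.
Proof.
apply/eqP => /(congr1 (@dart n E)); rewrite dart_matching.
by have /andP[] := dart_adj i; case: (dart i) => a b /= + _ [e _]; rewrite e eqxx.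
Qed.

Lemma edge_of_surj n (E : {set {set 'I_n}}) e :
  (forall e, e \in E -> #|e| = 2) -> e \in E -> exists i : 'I_(nb_points E), edge_of i = e.
Proof.
move=> sE eE; have /eqP/cards2P[a [b [ab ee]]] := sE e eE.
have [i di] : exists i : 'I_(nb_points E), dart i = (a, b).
  by apply: dart_surj; rewrite /adj /= ab -ee.
by exists i; rewrite /edge_of di ee.
Qed.

(** A vector over F_2 indexed by the edges is encoded as the set [F] of the edges where it is 1. *)
Definition crossing_kernel n (E : {set {set 'I_n}}) : {set {set {set 'I_n}}} :=
  [set F in powerset E | [forall e in E, ~~ \big[addb/false]_(f in F) cross e f]].

Section Simple.
Variables (n : nat) (E : {set {set 'I_n}}).
Hypothesis sE : forall e, e \in E -> #|e| = 2.

Let N := nb_points E.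

Definition pull_edges (F : {set {set 'I_n}}) : {ffun 'I_(nb_points E) -> bool} :=
  [ffun i => edge_of i \in F].

Lemma pull_edges_inj : {in powerset E &, injective pull_edges}.
Proof.
have sub (F G : {set {set 'I_n}}) : F \subset E -> pull_edges F = pull_edges G -> F \subset G.
  move=> /subsetP FE /ffunP FG; apply/subsetP=> e eF.
  have [i ie] := edge_of_surj sE (FE e eF).
  by have := FG i; rewrite !ffunE ie eF.
by move=> F G; rewrite !inE => FE GE FG; apply/eqP; rewrite eqEsubset (sub F G) ?(sub G F).
Qed.

Lemma pull_edges_surj (x : {ffun 'I_(nb_points E) -> bool}) :
  (forall i, x (matching E i) = x i) -> exists2 F, F \in powerset E & x = pull_edges F.
Proof.
move=> xa; exists [set edge_of i | i in 'I_N & x i].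
  by rewrite inE; apply/subsetP=> _ /imsetP[i _ ->]; exact: edge_ofE.
apply/ffunP=> i; rewrite ffunE; apply/idP/imsetP.
  by move=> xi; exists i => //; rewrite inE.
by move=> [j]; rewrite inE => xj /edge_of_inj [-> //|->]; rewrite xa.
Qed.

Lemma psum_delta (j : 'I_(nb_points E)) k :
  psum (pull_edges [set edge_of j]) k = (j < k) (+) (matching E j < k).
Proof.
rewrite /psum.
rewrite (eq_bigr (fun i => (i == j) (+) (i == matching E j))); last first.
  move=> i _; rewrite ffunE inE; apply/eqP/idP.
    by case/edge_of_inj => ->; rewrite eqxx ?(negPf (matching_neq j)) // eq_sym (negPf (matching_neq j)).
  have [->//|_] := eqVneq i j.
  by rewrite addFb => /eqP ->; rewrite edge_of_matching.
rewrite big_split /=; congr addb.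
  have [jk|jk] := ltnP j k; last first.
    by rewrite big1 // => i ik; apply/negbTE; apply: contraTneq ik => ->; rewrite -leqNgt.
  by rewrite (bigD1 j) //= eqxx big1 // => i /andP[_ /negPf].
set j' := matching E j.
have [jk|jk] := ltnP j' k; last first.
  by rewrite big1 // => i ik; apply/negbTE; apply: contraTneq ik => ->; rewrite -leqNgt.
by rewrite (bigD1 j') //= eqxx big1 // => i /andP[_ /negPf].
Qed.

Lemma psum_pull (F : {set {set 'I_n}}) k :
  psum (pull_edges F) k = \big[addb/false]_(f in F) psum (pull_edges [set f]) k.
Proof.
rewrite /psum exchange_big /=; apply: eq_bigr => i _; rewrite ffunE.
rewrite (eq_bigr (fun f => edge_of i == f)); last by move=> f _; rewrite ffunE inE.
have [iF|iF] := boolP (edge_of i \in F).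
  by rewrite (bigD1 (edge_of i)) //= eqxx big1 // => f /andP[_]; rewrite eq_sym => /negPf.
by rewrite big1 // => f fF; apply/negbTE; apply: contraNneq iF => ->.
Qed.

(** For a single edge, the chord condition is the crossing of the segments before splitting;
    [psum_pull] extends this to all [F] by linearity. *)
Lemma psum_cross (k j : 'I_(nb_points E)) :
  psum (pull_edges [set edge_of j]) (matching E k).+1 (+)
  psum (pull_edges [set edge_of j]) k = cross (edge_of k) (edge_of j).
Proof.
rewrite !psum_delta !ltnS !dart_leE !dart_ltE !dart_matching /edge_of crossE.
have /andP[kk _] := dart_adj k; have /andP[jj _] := dart_adj j.
rewrite -(dart_cross kk jj).
case: (dart j) (dart k) => c d [a b] /=.
by rewrite !addbA.
Qed.

Lemma card_chord_kernel : #|chord_kernel (matching E)| = #|crossing_kernel E|.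
Proof.
have inj : {in crossing_kernel E &, injective pull_edges}.
  by move=> F G; rewrite ![_ \in crossing_kernel _]inE => /andP[FE _] /andP[GE _]; exact: pull_edges_inj.
rewrite -(card_in_imset inj); apply: eq_card => x.
have key (F : {set {set 'I_n}}) i : F \subset E -> psum (pull_edges F) (matching E i).+1 (+) psum (pull_edges F) i
   = \big[addb/false]_(f in F) cross (edge_of i) f.
  move=> /subsetP FE; rewrite !psum_pull -big_split /=; apply: eq_bigr => f fF.
  by have [j <-] := edge_of_surj sE (FE f fF); rewrite psum_cross.
apply/idP/imsetP.
  rewrite inE => /forallP xk.
  have [i|F FE xF] := @pull_edges_surj x; first by have /andP[/eqP] := xk i.
  exists F => //; rewrite inE FE /=; apply/forall_inP => e eE.
  have [i <-] := edge_of_surj sE eE.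
  rewrite -key -?powersetE // -xF; have /andP[_ /eqP ->] := xk i.
  by rewrite addbb.
move=> [F]; rewrite inE => /andP[FE /forall_inP kF] ->.
rewrite inE; apply/forallP=> i; rewrite !ffunE edge_of_matching eqxx /=.
have := kF _ (edge_ofE i); rewrite -key -?powersetE //.
by case: (psum _ _) (psum _ _) => [] [].
Qed.

Lemma nb_cycles_matching : nb_cycles (matching E) = #|E|.
Proof.
apply/eqP; rewrite -(eqn_exp2l _ _ (isT : 1 < 2)) -card_perm_invariant -card_powerset.
rewrite -(card_in_imset pull_edges_inj); apply/eqP/eq_card => x.
rewrite inE; apply/forallP/imsetP => [xa|[F _ ->] i].
  have [|F FE xF] := @pull_edges_surj x; first by move=> i; apply/eqP.
  by exists F.
by rewrite !ffunE edge_of_matching.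
Qed.

Lemma nb_pointsE : nb_points E = 2 * #|E|.
Proof.
rewrite -[LHS]card_ord -[LHS]sum1_card. rewrite (partition_big (@edge_of n E) (fun e => e \in E)); last first.
  by move=> i _; exact: edge_ofE.
rewrite (eq_bigr (fun=> 2)); first by rewrite sum_nat_const mulnC.
move=> e eE; have [i ie] := edge_of_surj sE eE.
rewrite sum1_card (eq_card (B := [set i; matching E i])).
  by rewrite cards2 eq_sym matching_neq.
move=> j; rewrite -[LHS]/(edge_of j == e) !inE -ie; apply/idP/orP.
  by move=> /eqP/edge_of_inj[] ->; rewrite eqxx; [left|right].
by case=> /eqP ->; rewrite ?edge_of_matching.
Qed.

End Simple.

Section Genus.
Import GRing.Theory Num.Theory.

(** There are [2 * #|E|] points and the matching has [#|E|] cycles, so genus one means that the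
    number [F] of faces satisfies [F.+1 = #|E|], while [2 ^ F] is twice the size of the kernel. *)
Lemma genus_kernel n (E : {set {set 'I_n}}) : (forall e, e \in E -> #|e| = 2) ->
  (genus E == 1%R) = (4 * #|crossing_kernel E| == 2 ^ #|E|).
Proof.
move=> sE.
have H (X : rat) : ((1 + (1 / 2%:R) * X == 1) = (X == 0))%R.
  by rewrite -subr_eq0 addrAC subrr add0r mulf_eq0.
have Np := nb_pointsE sE; have Cm := nb_cycles_matching sE.
have KE := card_chord_kernel sE.
rewrite /genus Cm.
set F := nb_cycles _.
have hF : 0 < #|E| -> 2 ^ F = 2 * #|chord_kernel (matching E)|.
  move=> E0; rewrite /F /nb_cycles -card_perm_invariant.
  have N0 : nb_points E = (nb_points E).-1.+1 by rewrite Np; lia.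
  have := @matching_neq _ E; have := @matchingK _ E.
  move: (matching E); rewrite N0 => a aK afp.
  exact: card_face_invariant.
rewrite Np.
(* Without edges there are no points, the face count [hF] does not apply, and both sides are
   false. *)
have [E0|E0] := posnP #|E|.
  have E00 : E = set0 by apply/eqP; rewrite -cards_eq0 E0.
  have F0 : F = 0.
    apply/eqP; rewrite cards_eq0; apply/eqP/setP => c; rewrite inE; apply/imsetP => -[i].
    by move=> _ _; case: i => i; rewrite Np E0.
  by rewrite H F0 E0 expn0 muln0 !subr0; apply/idP/idP => //; lia.
have -> : (4 * #|crossing_kernel E| == 2 ^ #|E|) = (F.+1 == #|E|).
  by rewrite -KE -[4]/(2 * 2) -mulnA -hF // -expnS eqn_exp2l.
rewrite H -(eqr_nat rat) mul2n -addnn natrD -natr1.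
move: (#|E|%:R : rat)%R (F%:R : rat)%R => x y.
by apply/eqP/eqP => ?; lra.
Qed.

End Genus.

(** * Alternating forms of rank two over F_2 *)

Section AlternatingRankTwo.
Variables (T : finType) (E : {set T}) (c : T -> T -> bool).
Hypotheses (csym : forall e f, c e f = c f e) (cirr : forall e, c e e = false).

Let s e (F : {set T}) := \big[addb/false]_(f in F) c e f.

(** Addition of the basis vector [b], subsets standing for vectors; [s e F] is the value of the form
    on [e] and [F]. *)
Let toggle (b : T) (F : {set T}) := if b \in F then F :\ b else b |: F.

Let toggleK b : involutive (toggle b).
Proof.
move=> F; rewrite /toggle; have [bF|bF] := boolP (b \in F).
  by rewrite !inE eqxx setD1K.
by rewrite !inE eqxx setU1K.
Qed.

Let s_toggle e b F : s e (toggle b F) = s e F (+) c e b.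
Proof.
rewrite /s /toggle; have [bF|bF] := boolP (b \in F).
  by rewrite [in RHS](big_setD1 b) //= addbC addbA addbb addFb.
by rewrite big_setU1 //= addbC.
Qed.

Let toggle_sub b F : b \in E -> (toggle b F \subset E) = (F \subset E).
Proof.
have H (G : {set T}) : b \in E -> G \subset E -> toggle b G \subset E.
  move=> bE GE; rewrite /toggle; case: ifP => _; last by rewrite subUset sub1set bE.
  exact: subset_trans (subsetDl _ _) GE.
by move=> bE; apply/idP/idP => /(H _ bE) //; rewrite toggleK.
Qed.

Let K := [set F in powerset E | [forall e in E, ~~ s e F]].

(** As [c a b] holds, toggling [b] exchanges the vectors of [Z] orthogonal to [a] with the
    others. *)
Let card_half (Z : {set {set T}}) a b : b \in E -> c a b ->
  (forall F, (toggle b F \in Z) = (F \in Z)) -> #|Z| = 2 * #|[set F in Z | ~~ s a F]|.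
Proof.
move=> bE ab tZ; rewrite -(cardsID [set F | s a F] Z) mul2n -addnn; congr (_ + _).
  rewrite -(card_imset _ (inv_inj (toggleK b))); apply: eq_card => F.
  rewrite [RHS]inE; apply/imsetP/andP => [[G]|[FZ sF]].
    by rewrite inE => /andP[GZ]; rewrite inE => sG ->; rewrite tZ s_toggle sG ab.
  exists (toggle b F); last by rewrite toggleK.
  by rewrite inE tZ FZ inE s_toggle ab (negPf sF).
by apply: eq_card => F; rewrite !inE andbC.
Qed.

(** Rank two means that the radical has index 4; the form is then the 2 by 2 determinant in the
    coordinates [c a _] and [c b _], where [c a b] holds. *)
Lemma card_kernel_rank_two :
  4 * #|K| = 2 ^ #|E| <->
  exists a b, [/\ a \in E, b \in E, c a b &
    forall e f, e \in E -> f \in E -> c e f = (c a e && c b f) (+) (c a f && c b e)].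
Proof.
pose Kab a b := [set F in [set F in powerset E | ~~ s a F] | ~~ s b F].
have card_Kab a b : a \in E -> b \in E -> c a b -> 4 * #|Kab a b| = 2 ^ #|E|.
  move=> aE bE ab; rewrite -card_powerset -[4]/(2 * 2) -mulnA -(@card_half _ b a) //.
  - by rewrite -(@card_half _ a b) // => F; rewrite !inE toggle_sub.
  - by rewrite csym.
  - by move=> F; rewrite !inE toggle_sub // s_toggle cirr addbF.
have sub a b : a \in E -> b \in E -> K \subset Kab a b.
  move=> aE bE; apply/subsetP=> F; rewrite !inE => /andP[-> /forall_inP kF].
  by rewrite !kF.
split.
  move=> cK.
  have [/existsP[a /existsP[b /and3P[aE bE ab]]]|no] :=
      boolP [exists a, exists b, [&& a \in E, b \in E & c a b]].
    exists a, b; split=> // e f eE fE.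
    have KE : K = Kab a b.
      apply/eqP; rewrite eqEcard sub //=.
      by rewrite -(leq_pmul2l (isT : 0 < 4)) card_Kab // cK.
    (* [X3] is [f], plus [b] if [c a f], plus [a] if [c b f]: the projection of [f] onto the
       orthogonal of [a] and [b]. Lying in [Kab a b = K], it is orthogonal to [e]. *)
    pose X1 := [set f]; pose X2 := if c a f then toggle b X1 else X1.
    pose X3 := if c b f then toggle a X2 else X2.
    have s1 g : s g X1 = c g f by rewrite /s big_set1.
    have s2 g : s g X2 = c g f (+) (c a f && c g b).
      by rewrite /X2; case: ifP; rewrite ?s_toggle s1 ?addbF.
    have s3 g : s g X3 = c g f (+) (c a f && c g b) (+) (c b f && c g a).
      by rewrite /X3; case: ifP; rewrite ?s_toggle s2 ?addbF.
    have XE : X3 \subset E.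
      by rewrite /X3 /X2; do !case: ifP; rewrite ?toggle_sub ?sub1set.
    have : X3 \in Kab a b.
      by rewrite !inE XE !s3 !cirr ab (csym b a) ab; case: (c a f) (c b f) => [] [].
    rewrite -KE !inE => /andP[_ /forall_inP/(_ e eE)]; rewrite s3 !(csym e).
    by rewrite (csym f); case: (c _ _) (c _ _) (c _ _) (c _ _) (c _ _) => [] [] [] [] [].
  suff KE : K = powerset E.
    by move: cK; rewrite KE card_powerset; have := expn_gt0 2 #|E|; move: (2 ^ _) => z /=; lia.
  apply/setP=> F; rewrite !inE andb_idr // => FE; apply/forall_inP => e eE.
  rewrite /s big1 // => f fF; apply/negbTE/negP => ef; move/negP: no; apply.
  by apply/existsP; exists e; apply/existsP; exists f; rewrite eE ef (subsetP FE).
move=> [a [b [aE bE ab H]]]; rewrite -(card_Kab a b) //; congr (4 * _).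
apply: eq_card => F; apply/idP/idP; first by move/(subsetP (sub a b aE bE)).
rewrite !inE => /andP[/andP[FE sa] sb]; rewrite FE; apply/forall_inP => e eE.
(* The hypothesis makes row [e] of the matrix a combination of rows [a] and [b]. *)
have -> : s e F = (c a e && s b F) (+) (c b e && s a F).
  rewrite /s (eq_bigr (fun f => (c a e && c b f) (+) (c b e && c a f))); last first.
    move=> f fF; rewrite H //; last exact: (subsetP FE).
    by case: (c a e) (c b e) (c a f) (c b f) => [] [] [] [].
  rewrite big_split /=; congr addb; last by case: (c b e) => //=; rewrite big1.
  by case: (c a e) => //=; rewrite big1.
by rewrite (negPf sa) (negPf sb) !andbF.
Qed.

End AlternatingRankTwo.

Lemma cross_sym n (e f : {set 'I_n}) : cross e f = cross f e.
Proof.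
have H (e' f' : {set 'I_n}) : cross e' f' -> cross f' e'.
  case/existsP => a /existsP[b /existsP[c /existsP[d /and3P[/eqP -> /eqP -> h]]]].
  by rewrite crossE crossing_sym.
by apply/idP/idP; apply: H.
Qed.

Lemma cross_irr n (e : {set 'I_n}) : cross e e = false.
Proof.
apply/negbTE/negP=> /existsP[a /existsP[b /existsP[c /existsP[d /and3P[/eqP -> /eqP /set2_inj]]]]].
by rewrite /crossing; case=> -[-> ->]; rewrite eqxx ?andbF.
Qed.

Definition rank_two n (E : {set {set 'I_n}}) :=
  exists a b, [/\ a \in E, b \in E, cross a b &
    forall e f, e \in E -> f \in E ->
      cross e f = (cross a e && cross b f) (+) (cross a f && cross b e)].

Lemma genus_oneP n (E : {set {set 'I_n}}) : (forall e, e \in E -> #|e| = 2) ->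
  (genus E == 1%R) <-> rank_two E.
Proof.
move=> sE; rewrite genus_kernel //.
have := card_kernel_rank_two E (@cross_sym n) (@cross_irr n).
by rewrite /rank_two => <-; split=> /eqP.
Qed.

(** * Rotations *)

Definition genus_one_trees n : {set {set {set 'I_n}}} :=
  [set E | is_tree E && (genus E == 1%R)].

Lemma genus_one_treesP n (E : {set {set 'I_n}}) :
  E \in genus_one_trees n <-> tree_cuts E /\ rank_two E.
Proof.
rewrite inE; split.
  by case/andP=> /is_treeP tE; have [sE _ _] := tE => /(genus_oneP sE).
by case=> tE rE; have [sE _ _] := tE; rewrite (introT (is_treeP E) tE); apply/genus_oneP.
Qed.

Definition map_edges n (p : {perm 'I_n}) (E : {set {set 'I_n}}) : {set {set 'I_n}} :=
  [set [set p x | x in e] | e : {set 'I_n} in E].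

Lemma imset2pt n (p : {perm 'I_n}) u v : [set p x | x in [set u; v]] = [set p u; p v].
Proof. by rewrite imsetU !imset_set1. Qed.

Lemma map_edgesE n (p : {perm 'I_n}) (E : {set {set 'I_n}}) (e : {set 'I_n}) :
  ([set p x | x in e] \in map_edges p E) = (e \in E).
Proof. by rewrite (mem_imset _ _ (imset_inj (@perm_inj _ p))). Qed.

Lemma mem_map_edges n (p : {perm 'I_n}) (E : {set {set 'I_n}}) u v :
  ([set p u; p v] \in map_edges p E) = ([set u; v] \in E).
Proof. by rewrite -imset2pt map_edgesE. Qed.

Lemma map_edges_act n (p : {perm 'I_n}) (E : {set {set 'I_n}}) :
  ('P^*^*)%act E p = map_edges p E.
Proof. by []. Qed.

Lemma map_edgesM n (p q : {perm 'I_n}) (E : {set {set 'I_n}}) :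
  map_edges (p * q)%g E = map_edges q (map_edges p E).
Proof. by rewrite -!map_edges_act actM. Qed.

Lemma map_edges1 n (E : {set {set 'I_n}}) : map_edges 1%g E = E.
Proof. by rewrite -map_edges_act act1. Qed.

Lemma map_edgesK n (p : {perm 'I_n}) : cancel (map_edges p) (map_edges p^-1%g).
Proof. by move=> E; rewrite -map_edgesM mulgV map_edges1. Qed.

Lemma mem_map_edgesV n (p : {perm 'I_n}) (E : {set {set 'I_n}}) u v :
  ([set u; v] \in map_edges p E) = ([set p^-1%g u; p^-1%g v] \in E).
Proof. by rewrite -[in LHS](permKV p u) -[in LHS](permKV p v) mem_map_edges. Qed.

Definition keeps_crossing n (p : {perm 'I_n}) :=
  forall a b c d, crossing (p a) (p b) (p c) (p d) = crossing a b c d.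

Lemma tree_cuts_map n (p : {perm 'I_n}) (E : {set {set 'I_n}}) :
  tree_cuts E -> tree_cuts (map_edges p E).
Proof.
case=> sE cE kE; split.
- by move=> _ /imsetP[e eE ->]; rewrite card_imset ?sE //; exact: perm_inj.
- move=> R iR u v.
  have := cE (fun x => R (p x)) _ (p^-1%g u) (p^-1%g v); rewrite !permKV; apply.
  by move=> a b abE; apply: iR; rewrite mem_map_edges.
- move=> _ /imsetP[e eE ->]; have [R cR] := kE e eE; exists (fun x => R (p^-1%g x)).
  move=> u v; rewrite mem_map_edgesV => /cR ->.
  rewrite -(inj_eq (imset_inj (@perm_inj _ p))) imset2pt !permKV.
  by [].
Qed.

Lemma rank_two_map n (p : {perm 'I_n}) (E : {set {set 'I_n}}) :
  (forall e, e \in E -> #|e| = 2) ->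
  keeps_crossing p -> rank_two E -> rank_two (map_edges p E).
Proof.
move=> sE kp [a [b [aE bE ab H]]].
have kc (e f : {set 'I_n}) : e \in E -> f \in E -> cross [set p x | x in e] [set p x | x in f] = cross e f.
  move=> /sE/eqP/cards2P[u [v [_ ->]]] /sE/eqP/cards2P[u' [v' [_ ->]]].
  by rewrite !imset2pt !crossE kp.
exists [set p x | x in a], [set p x | x in b]; rewrite !map_edgesE aE bE kc //; split=> //.
by move=> _ _ /imsetP[e eE ->] /imsetP[f fE ->]; rewrite !kc // H.
Qed.

Lemma genus_one_trees_map n (p : {perm 'I_n}) (E : {set {set 'I_n}}) :
  keeps_crossing p -> E \in genus_one_trees n -> map_edges p E \in genus_one_trees n.
Proof.
move=> kp /genus_one_treesP[tE rE]; apply/genus_one_treesP.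
by split; [exact: tree_cuts_map | case: tE => sE _ _; exact: rank_two_map].
Qed.

Lemma keeps_crossing_expg n (p : {perm 'I_n}) k :
  keeps_crossing p -> keeps_crossing (p ^+ k)%g.
Proof.
move=> kp; elim: k => [|k IH] a b c d; first by rewrite expg0 !perm1.
by rewrite expgSr !permM kp IH.
Qed.

Lemma keeps_crossing_rot N : keeps_crossing (long_cycle N.+1).
Proof.
move=> a b c d; rewrite !permE /=.
have S (i : 'I_N.+1) : i.+1 %% N.+1 = if i == N :> nat then 0 else i.+1.
  case: eqP => [->|/eqP iN]; first by rewrite modnn.
  by rewrite modn_small //; have := ltn_ord i; lia.
rewrite !S; have := (ltn_ord a, ltn_ord b, ltn_ord c, ltn_ord d).
move: (val a) (val b) (val c) (val d) => {}a {}b {}c {}d [[[ha hb] hc] hd].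
case: (altP (a =P N)) => ?; case: (altP (b =P N)) => ?; case: (altP (c =P N)) => ?;
  case: (altP (d =P N)) => ?; rewrite /crossing; lia.
Qed.

Lemma rotE N (v : 'I_N.+1) k : ((long_cycle N.+1 ^+ k)%g v : nat) = (v + k) %% N.+1.
Proof.
elim: k => [|k IH]; first by rewrite expg0 perm1 addn0 modn_small.
by rewrite expgSr permM permE /= IH -addn1 modnDml addn1 addnS.
Qed.

Lemma order_rot N : #[long_cycle N.+1]%g = N.+1.
Proof.
apply/eqP; rewrite eqn_dvd order_dvdn; apply/andP; split.
  apply/eqP/permP => v; apply/val_inj; rewrite /= rotE perm1.
  by rewrite modnDr modn_small.
have := rotE (@ord0 N) #[long_cycle N.+1]%g; rewrite expg_order perm1 /= add0n.
by rewrite /dvdn => <-.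
Qed.

Lemma dvdn_free_action (aT : finGroupType) (D : {group aT}) (T : finType)
    (to : action D T) (G : {group aT}) (S : {set T}) :
  G \subset D -> [acts G, on S | to] ->
  (forall x a, x \in S -> a \in G -> to x a = x -> a = 1%g) -> #|G| %| #|S|.
Proof.
move=> GD actsGS free; rewrite -(acts_sum_card_orbit actsGS); apply: dvdn_sum => _ /imsetP[x xS ->].
rewrite card_orbit_in // (_ : 'C_G[x | to]%g = 1%g) ?indexg1 //.
apply/trivgP/subsetP=> a /setIP[aG ax].
by rewrite inE; apply/eqP/(free x a xS aG)/(astab_act ax); rewrite inE.
Qed.

Lemma odd_card_involution (T : finType) (S : {set T}) (f : T -> T) :
  involutive f -> (forall x, x \in S -> f x \in S) ->
  odd #|S| = odd #|[set x in S | f x == x]|.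
Proof.
move=> fK; have [k] := ubnP #|S|; elim: k S => // k IH S Sk fS.
have [/existsP[x /andP[xS fx]]|no] := boolP [exists x, (x \in S) && (f x != x)].
  have fxS : f x \in S :\ x by rewrite !inE fx fS.
  rewrite (cardsD1 x) xS (cardsD1 (f x)) fxS !oddD /= negbK.
  have c1 := cardsD1 x S; have c2 := cardsD1 (f x) (S :\ x).
  rewrite IH.
  - congr odd; apply: eq_card => y; rewrite !inE.
    case: eqVneq => [->|_] /=; first by rewrite fK eq_sym (negPf fx) andbF.
    by case: eqVneq => [->|_] //=; rewrite (negPf fx) andbF.
  - by rewrite xS fxS in c1 c2; lia.
  - move=> y; rewrite !inE => /and3P[y1 y2 yS]; rewrite fS // andbT.
    by rewrite (inj_eq (inv_inj fK)) y2 -{1}(fK x) (inj_eq (inv_inj fK)).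
congr odd; apply: eq_card => y; rewrite inE andb_idr // => yS.
by apply: contraNT no => fy; apply/existsP; exists y; rewrite yS.
Qed.

Lemma rot_fix N (h : {perm 'I_N.+1}) v :
  h \in <[long_cycle N.+1]>%g -> h v = v -> h = 1%g.
Proof.
move=> /cycleP[k ->] /(congr1 val); rewrite /= rotE => e.
apply/eqP; rewrite -order_dvdn order_rot.
have : v + k == v + 0 %[mod N.+1] by rewrite e addn0 modn_small.
by rewrite eqn_modDl mod0n.
Qed.

Lemma rot_stab_trivial N (E : {set {set 'I_N.+1}}) (h : {perm 'I_N.+1}) :
  tree_cuts E ->
  (~~ odd N.+1 -> map_edges (long_cycle N.+1 ^+ N.+1./2)%g E != E) ->
  h \in <[long_cycle N.+1]>%g -> map_edges h E = E -> h = 1%g.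
Proof.
move=> tE nsym hR hE; have [sE _ _] := tE.
pose R := <[long_cycle N.+1]>%G.
pose H := 'C_R[E | 'P^*^*]%G.
have HE g : g \in H -> map_edges g E = E.
  by case/setIP => _ gE; apply: (astab_act gE); exact: set11.
have HR : H \subset R by exact: subsetIl.
have hH : h \in H.
  by apply/setIP; split=> //; apply/astab1P.
(* The order of the stabilizer divides the consecutive integers [N] and [N.+1]. *)
suff H1 : #|H| %| 1.
  by move: hH; rewrite dvdn1 -trivg_card1 in H1; rewrite (eqP H1) inE => /eqP.
have d1 : #|H| %| N.+1 by have := cardSg HR; rewrite -[#|R|]/(#[long_cycle N.+1]%g) order_rot.
suff d2 : #|H| %| N.
  by move: d1 d2; move: #|H| => z d1 d2; rewrite -(dvdn_addr _ d2) addn1.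
have cE := card_tree_edges tE.
suff : #|H| %| #|E| by rewrite cE.
apply: (@dvdn_free_action _ _ _ ('P^*)%act); first exact: subsetT.
  apply/subsetP=> g gH; rewrite !inE; apply/subsetP=> e eE; rewrite inE.
  by rewrite -(HE g gH) -[X in X \in _]/[set g x | x in e] map_edgesE.
move=> e g eE gH; have /eqP/cards2P[u [v [uv ->]]] := sE e eE.
have gR := subsetP HR g gH.
(* A rotation fixing an end of an edge is trivial. One that swaps the ends has square 1, so it is
   trivial or the half turn, which [nsym] excludes. *)
rewrite -[LHS]/[set g x | x in [set u; v]] imset2pt => /set2_inj[[/(rot_fix gR)//]|[gu gv]].
have /cycleP[gk gk_def] := gR.
have g2 : (g ^+ 2)%g = 1%g.
  by apply: (@rot_fix _ _ u); [exact: groupX | rewrite expgS expg1 permM gu gv].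
have dv : N.+1 %| 2 * gk.
  by rewrite -{1}[N.+1]order_rot order_dvdn mulnC expgM -gk_def g2.
have [dk|ndk] := boolP (N.+1 %| gk).
  by apply/eqP; rewrite gk_def -order_dvdn order_rot.
have ev : ~~ odd N.+1.
  by apply: contraNN ndk => od; rewrite Gauss_dvdr // coprimen2 in dv.
have gh : g = (long_cycle N.+1 ^+ N.+1./2)%g.
  rewrite gk_def; apply/eqP; rewrite eq_expg_mod_order order_rot.
  have : N.+1./2 %| gk.
    have e2 : N.+1 = 2 * N.+1./2 by have := odd_double_half N.+1; rewrite (negPf ev); lia.
    by move: dv; rewrite {1}e2 dvdn_pmul2l.
  move=> /dvdnP[j gj].
  have oj : odd j.
    apply: contraNT ndk => ej; rewrite gj; have := odd_double_half j; rewrite (negPf ej) => <-.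
    have := odd_double_half N.+1; rewrite (negPf ev) => eN.
    by rewrite -muln2 -mulnA mul2n -{1}eN; apply: dvdn_mull.
  have := odd_double_half j; have := odd_double_half N.+1; rewrite (negPf ev) oj => eN ej.
  rewrite gj -ej mulnDl mul1n -muln2 -mulnA mul2n.
  by rewrite add0n in eN; rewrite eN -modnDmr modnMl addn0.
by have := nsym ev; rewrite -gh (HE g gH) eqxx.
Qed.

(** Both [R] and its composite with [p] change along exactly this edge, so their sum is
    edge-invariant, hence constant. *)
Lemma cut_automorphism n (E : {set {set 'I_n}}) (p : {perm 'I_n}) u v R :
  tree_cuts E -> map_edges p E = E -> [set p u; p v] = [set u; v] ->
  cut_of E [set u; v] R -> forall x y, R x (+) R (p x) = R y (+) R (p y).
Proof.
case=> _ cE _ pE puv cR; apply: (cE (fun x => R x (+) R (p x))) => x y xyE.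
have := cR _ _ xyE; have := cR (p x) (p y).
rewrite -{1}pE mem_map_edges xyE => /(_ isT).
rewrite -!imset2pt in puv *; rewrite -{1}puv (inj_eq (imset_inj (@perm_inj _ p))).
move=> <-.
by case: (R x) (R y) (R (p x)) (R (p y)) => [] [] [] [].
Qed.

(** * Half turns and diameters *)

Section HalfTurn.
Variables (N m : nat).
Hypothesis Nm : N.+1 = 2 * m.

Definition half_turn : {perm 'I_N.+1} := (long_cycle N.+1 ^+ m)%g.

Lemma half_turnE (v : 'I_N.+1) : (half_turn v : nat) = if v < m then v + m else v - m.
Proof.
rewrite rotE; have vN := ltn_ord v; case: (ltnP v m) => vm; first by rewrite modn_small; lia.
have -> : v + m = v - m + N.+1 by lia.
by rewrite modnDr modn_small; lia.
Qed.

Lemma half_turnK : involutive half_turn.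
Proof.
by move=> v; apply/val_inj; rewrite /= !half_turnE; have vN := ltn_ord v; case: (ltnP v m) => vm; case: ltnP; lia.
Qed.

Lemma half_turn_neq v : half_turn v != v.
Proof.
by rewrite -val_eqE /= half_turnE; have vN := ltn_ord v; case: (ltnP v m) => vm; lia.
Qed.

(** The constant of [cut_automorphism] is 1 here, as the half turn takes [u] to the other end of the
    edge being cut. *)
Lemma diameter_cut (E : {set {set 'I_N.+1}}) u R :
  tree_cuts E -> map_edges half_turn E = E -> [set u; half_turn u] \in E ->
  cut_of E [set u; half_turn u] R -> forall v, R (half_turn v) = ~~ R v.
Proof.
move=> tE hE uE cR v.
have h : [set half_turn u; half_turn (half_turn u)] = [set u; half_turn u].
  by rewrite half_turnK setUC.
have := cut_automorphism tE hE h cR v u; have := cR _ _ uE; rewrite eqxx.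
by case: (R u) (R v) (R (half_turn u)) (R (half_turn v)) => [] [] [] [].
Qed.

(** The cut along one diameter is negated by the half turn, so it changes along every diameter, but
    it changes along a single edge. *)
Lemma diameter_unique (E : {set {set 'I_N.+1}}) u w :
  tree_cuts E -> map_edges half_turn E = E -> [set u; half_turn u] \in E ->
  [set w; half_turn w] \in E -> [set w; half_turn w] = [set u; half_turn u].
Proof.
move=> tE hE uE wE; have [_ _ kE] := tE; have [R cR] := kE _ uE.
apply/eqP; rewrite -cR // (diameter_cut tE hE uE cR).
by case: (R w).
Qed.

(** The half turn permutes the [N] edges, an odd number, so it preserves one of them; having no
    fixed point, it swaps its ends. *)
Lemma diameter_exists (E : {set {set 'I_N.+1}}) :
  tree_cuts E -> map_edges half_turn E = E -> exists u, [set u; half_turn u] \in E.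
Proof.
move=> tE hE; have [sE _ _] := tE.
pose f (e : {set 'I_N.+1}) := [set half_turn x | x in e].
have fK : involutive f.
  move=> e; rewrite /f -imset_comp -[RHS]imset_id; apply: eq_imset => x /=.
  by rewrite half_turnK.
have fE e : e \in E -> f e \in E by rewrite -{2}hE map_edgesE.
have := odd_card_involution fK fE; rewrite (card_tree_edges tE).
have -> : odd N by lia.
move=> /esym od.
have /set0Pn[e] : [set e in E | f e == e] != set0.
  by apply: contraTneq od => ->; rewrite cards0.
rewrite inE => /andP[eE]; have /eqP/cards2P[u [v [_ ee]]] := sE e eE.
rewrite /f ee imset2pt => /eqP/set2_inj[[h _]|[h _]].
  by have := half_turn_neq u; rewrite h eqxx.
by exists u; rewrite h -ee.
Qed.

Definition sym_trees := [set E in genus_one_trees N.+1 | map_edges half_turn E == E].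

Definition diam : {set 'I_N.+1} := [set ord0; half_turn ord0].

Definition central_trees := [set E in sym_trees | diam \in E].

Lemma in_sym_trees E : (E \in sym_trees) =
  (E \in genus_one_trees N.+1) && (map_edges half_turn E == E).
Proof. by rewrite in_set. Qed.

Lemma in_central_trees E : (E \in central_trees) =
  [&& E \in genus_one_trees N.+1, map_edges half_turn E == E & diam \in E].
Proof. by rewrite in_set in_sym_trees andbA. Qed.

(** Each symmetric tree contains exactly one of the [m] diameters. Rotations commute with the half
    turn, so they carry the trees containing one diameter to those containing another. *)
Lemma card_sym_trees : #|sym_trees| = m * #|central_trees|.
Proof.
pose D i : {set 'I_N.+1} := [set (long_cycle N.+1 ^+ i)%g x | x in diam].
have DE i : D i = [set inZp i; half_turn (inZp i)].
  rewrite /D imset2pt.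
  have -> : (long_cycle N.+1 ^+ i)%g ord0 = inZp i by apply/val_inj; rewrite /= rotE add0n.
  by congr [set _; _]; apply/val_inj; rewrite /= !rotE /= modnDml modnDml add0n addnC.
have cD i : #|[set E in sym_trees | D i \in E]| = #|central_trees|.
  pose p := (long_cycle N.+1 ^+ i)%g.
  rewrite -(card_imset central_trees (can_inj (map_edgesK p))); apply: eq_card => E.
  have kp : keeps_crossing p by apply: keeps_crossing_expg; exact: keeps_crossing_rot.
  have kpV : keeps_crossing p^-1%g by move=> a b c d; rewrite -{2}(permKV p a) -{2}(permKV p b) -{2}(permKV p c) -{2}(permKV p d) kp.
  have comm : commute p half_turn by apply: commuteX2.
  rewrite in_set in_sym_trees; apply/idP/imsetP.
    case/andP=> /andP[gE /eqP hE] iE; exists (map_edges p^-1%g E); last first.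
      by rewrite -map_edgesM mulVg map_edges1.
    rewrite in_central_trees genus_one_trees_map //=.
    rewrite -map_edgesM -(commuteV (commute_sym comm)) map_edgesM hE eqxx /=.
    by rewrite -(map_edgesE p) -map_edgesM mulVg map_edges1.
  case=> F; rewrite in_central_trees => /and3P[gF /eqP hF iF] ->.
  rewrite genus_one_trees_map //=.
  by rewrite -map_edgesM comm map_edgesM hF eqxx /= map_edgesE.
transitivity (\sum_(i < m) #|[set E in sym_trees | D i \in E]|); last first.
  by rewrite (eq_bigr (fun=> #|central_trees|)) // sum_nat_const card_ord.
have cE i : #|[set E in sym_trees | D i \in E]| = \sum_(E in sym_trees) (D i \in E).
  rewrite -sum1_card [LHS]big_mkcond [RHS]big_mkcond; apply: eq_bigr => E _.
  by rewrite in_set; case: (E \in sym_trees); case: (D i \in E).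
under [RHS]eq_bigr => i _ do rewrite cE.
rewrite exchange_big -sum1_card; apply: eq_bigr => E; rewrite in_sym_trees => /andP[/genus_one_treesP[tE _] /eqP hE].
have vz (i : nat) : i < m -> (inZp i : 'I_N.+1) = i :> nat by move=> im; rewrite /= modn_small; lia.
have [i0 i0E] : exists i0 : 'I_m, D i0 \in E.
  have [u uE] := diameter_exists tE hE; have uN := ltn_ord u.
  have [um|um] := ltnP u m.
    by exists (Ordinal um); rewrite DE valZpK.
  have um' : u - m < m by lia.
  exists (Ordinal um'); rewrite DE (_ : inZp _ = half_turn u) ?half_turnK 1?setUC //.
  by apply/val_inj; rewrite -[LHS]/(nat_of_ord _) vz //= half_turnE ltnNge um.
rewrite (bigD1 i0) //= i0E big1 // => i ii0; apply/eqP; rewrite eqb0; apply/negP.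
rewrite !DE in i0E *; move=> iE.
have /set2_inj[[/(congr1 (@nat_of_ord _)) e _]|[/(congr1 (@nat_of_ord _)) e _]] := diameter_unique tE hE i0E iE.
  by move: ii0; rewrite -val_eqE /=; rewrite !vz // in e; rewrite e eqxx.
move: e; rewrite [RHS]half_turnE !vz // ltn_ord => e.
by have := ltn_ord i; rewrite e; lia.
Qed.
End HalfTurn.

Lemma dvdn_card_asymmetric N m : N.+1 = 2 * m ->
  N.+1 %| #|genus_one_trees N.+1 :\: sym_trees N m|.
Proof.
move=> Nm; rewrite -{1}[N.+1]order_rot.
apply: (@dvdn_free_action _ [set: {perm 'I_N.+1}]%G _ ('P^*^*)%act <[long_cycle N.+1]>%G); first exact: subsetT.
  have comm g : g \in <[long_cycle N.+1]>%g -> commute g (half_turn N m).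
    by move=> /cycleP[k ->]; exact: commuteX2.
  apply/actsP => g gR E; rewrite map_edges_act !in_setD !in_sym_trees.
  have kg : keeps_crossing g.
    by have /cycleP[k ->] := gR; apply: keeps_crossing_expg; exact: keeps_crossing_rot.
  have kgV : keeps_crossing g^-1%g.
    by have /cycleP[k ->] := groupVr gR; apply: keeps_crossing_expg; exact: keeps_crossing_rot.
  rewrite -map_edgesM (comm g gR) map_edgesM (can_eq (map_edgesK g)).
  have -> // : (map_edges g E \in genus_one_trees N.+1) = (E \in genus_one_trees N.+1).
  apply/idP/idP; last exact: genus_one_trees_map.
  by move/(genus_one_trees_map kgV); rewrite map_edgesK.
move=> E h; rewrite in_setD in_sym_trees => /andP[h1 gE] hR hE.
have /genus_one_treesP[tE _] := gE.
apply: (rot_stab_trivial tE _ hR hE) => _.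
rewrite (_ : N.+1./2 = m); first by move: h1; rewrite gE.
by rewrite Nm mul2n doubleK.
Qed.

Lemma dvdn_card_odd N : odd N.+1 -> N.+1 %| #|genus_one_trees N.+1|.
Proof.
move=> oN; rewrite -{1}[N.+1]order_rot.
apply: (@dvdn_free_action _ [set: {perm 'I_N.+1}]%G _ ('P^*^*)%act <[long_cycle N.+1]>%G); first exact: subsetT.
  apply/actsP => g gR E; rewrite map_edges_act.
  have kg : keeps_crossing g.
    by have /cycleP[k ->] := gR; apply: keeps_crossing_expg; exact: keeps_crossing_rot.
  have kgV : keeps_crossing g^-1%g.
    by have /cycleP[k ->] := groupVr gR; apply: keeps_crossing_expg; exact: keeps_crossing_rot.
  apply/idP/idP; last exact: genus_one_trees_map.
  by move/(genus_one_trees_map kgV); rewrite map_edgesK.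
move=> E h /genus_one_treesP[tE _] hR hE.
by apply: (rot_stab_trivial tE _ hR hE); rewrite oN.
Qed.

Lemma card_genus_one_trees_even N m : N.+1 = 2 * m ->
  exists a, #|genus_one_trees N.+1| = N.+1 * a + m * #|central_trees N m|.
Proof.
move=> Nm; have /dvdnP[a ha] := dvdn_card_asymmetric Nm; exists a.
rewrite -card_sym_trees // mulnC -ha -(cardsID (sym_trees N m)) addnC; congr (_ + _).
by apply: eq_card => E; rewrite in_setI in_sym_trees andbA andbb.
Qed.

(** * Trees with dihedral symmetry *)

(* [e] is the adjacency relation of a tree on n = 4x + 2 points invariant under
   [antipode] and [mirror], P the function that changes along the diameter {0, m}
   only, and {b1, b2} an edge crossing it, which is used as a pivot of the
   crossing matrix together with the diameter. *)
Section Fold.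

Variable x : nat.
Let m := 2 * x + 1.
Let n := 4 * x + 2.

Definition antipode v := if v < 2 * x + 1 then v + (2 * x + 1) else v - (2 * x + 1).
Definition mirror v := if v == 0 then 0 else 4 * x + 2 - v.

Variables (e : nat -> nat -> bool) (P : nat -> bool) (b1 b2 : nat).
Hypotheses
  (e_lt : forall p q, e p q -> p < n /\ q < n)
  (e_sym : forall p q, e p q -> e q p)
  (e_half : forall p q, e p q -> e (antipode p) (antipode q))
  (e_mirror : forall p q, e p q -> e (mirror p) (mirror q))
  (e_b : e b1 b2) (b_cross : crossing 0 m b1 b2)
  (e_cross : forall p q r s, e p q -> e r s ->
    crossing p q r s = (crossing 0 m p q && crossing b1 b2 r s)
                       (+) (crossing 0 m r s && crossing b1 b2 p q))
  (e_mirrorF : forall v, e v (mirror v) -> false)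
  (P0 : P 0 = false)
  (P_half : forall v, v < n -> P (antipode v) = ~~ P v)
  (P_mirror : forall v, v < n -> P (mirror v) = P v)
  (P_cut : forall p q, e p q -> P p != P q -> (p = 0 /\ q = m) \/ (p = m /\ q = 0))
  (e_conn : forall R : nat -> bool, (forall p q, e p q -> R p = R q) ->
     forall p, p < n -> R p = R 0).

Local Ltac nlia := repeat match goal with
  | H : context [crossing] |- _ => clear H
  | H : context [e] |- _ => clear H
  | H : context [P] |- _ => clear H
  end; lia.

(* An edge crossing the diameter crosses its image under [mirror], but not its
   image under [antipode], so it crosses its image under their product. *)
Lemma crosser_sides p q : e p q -> 0 < p < m -> m < q -> p + q < n -> p <= x /\ q <= m + x.
Proof.
move=> pq pm mq pqn; have [pn qn] := e_lt pq.
have hq : e (antipode p) (antipode q) := e_half pq.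
have tq : e (mirror p) (mirror q) := e_mirror pq.
have htq : e (antipode (mirror p)) (antipode (mirror q)) := e_half tq.
have hp_ : antipode p = p + m by rewrite /antipode; case: ltnP; nlia.
have hq_ : antipode q = q - m by rewrite /antipode; case: ltnP; nlia.
have tp_ : mirror p = n - p by rewrite /mirror; case: eqP; nlia.
have tq_ : mirror q = n - q by rewrite /mirror; case: eqP; nlia.
have htp_ : antipode (mirror p) = m - p by rewrite tp_ /antipode; case: ltnP; nlia.
have htq_ : antipode (mirror q) = n - q + m by rewrite tq_ /antipode; case: ltnP; nlia.
rewrite htp_ htq_ tp_ tq_ hp_ hq_ in htq tq hq.
have c1 : crossing 0 m p q = true by rewrite /crossing; nlia.
have c2 : crossing 0 m (p + m) (q - m) = true by rewrite /crossing; nlia.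
have c3 : crossing 0 m (n - p) (n - q) = true by rewrite /crossing; nlia.
have c4 : crossing 0 m (m - p) (n - q + m) = true by rewrite /crossing; nlia.
have d1 : crossing p q (n - p) (n - q) = true by rewrite /crossing; nlia.
have d2 : crossing (n - p) (n - q) (m - p) (n - q + m) = false by rewrite /crossing; nlia.
have f1 := e_cross pq tq; have f2 := e_cross tq htq; have f3 := e_cross pq htq.
rewrite c1 c3 c4 d1 d2 /= in f1 f2 f3.
have : crossing p q (m - p) (n - q + m).
  by rewrite f3; move: f1 f2; do 3 case: (crossing _ _ _ _).
rewrite /crossing; nlia.
Qed.

(* Otherwise {p, q} and {m - p, m - q} would cross. *)
Lemma no_diagonal p q : e p q -> p <= x -> x < q <= m -> p = 0 /\ q = m.
Proof.
move=> pq px qm.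
have htq := e_half (e_mirror pq).
have htp_ : antipode (mirror p) = m - p.
  by rewrite /mirror /antipode; case: (p =P 0) => p0; case: ltnP; nlia.
have htq_ : antipode (mirror q) = m - q.
  by rewrite /mirror /antipode; case: (q =P 0) => q0; case: ltnP; nlia.
rewrite htp_ htq_ in htq.
have [pq0|pq0] := eqVneq (m - p) q.
  have [//|] : (p = 0 /\ q = m) \/ (p = m /\ q = 0); last by nlia.
  have [pn _] := e_lt pq.
  have tpn : mirror p < n by rewrite /mirror; case: eqP; nlia.
  by apply: P_cut => //; rewrite -pq0 -htp_ P_half // P_mirror //; case: (P p).
have c1 : crossing 0 m p q = false by rewrite /crossing; nlia.
have c2 : crossing 0 m (m - p) (m - q) = false by rewrite /crossing; nlia.
have := e_cross pq htq; rewrite c1 c2 /= => c3; exfalso; move: c3; rewrite /crossing; nlia.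
Qed.

(** The reflection exchanges [p + q < n] and [p + q > n]; if [p + q = n], the edge would join a
    point to its mirror image. *)
Lemma crosser_sides' p q : e p q -> 0 < p < m -> m < q ->
  (p <= x /\ q <= m + x) \/ (x < p /\ m + x < q).
Proof.
move=> pq pm mq; have [pn qn] := e_lt pq.
have tp_ : mirror p = n - p by rewrite /mirror; case: eqP; nlia.
have tq_ : mirror q = n - q by rewrite /mirror; case: eqP; nlia.
have [lt|gt|eq] := ltngtP (p + q) n.
- by left; exact: (crosser_sides pq).
- have tq := e_sym (e_mirror pq); rewrite tp_ tq_ in tq.
  have [|||h1 h2] := crosser_sides tq; nlia.
- by have := @e_mirrorF p; rewrite tp_ (_ : n - p = q) ?pq => [/(_ isT)|]; nlia.
Qed.

(* quarter s t maps the quarter [0, x] of the circle onto one of its four images *)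
Definition quarter (s t : bool) v :=
  (if s then antipode else id) ((if t then mirror else id) v).

Lemma e_quarter s t p q : e p q -> e (quarter s t p) (quarter s t q).
Proof. by move=> pq; rewrite /quarter; case: s t => [] []; auto. Qed.

Lemma quarter_cover v : v < n -> exists s t i, i <= x /\ v = quarter s t i.
Proof.
move=> vn; rewrite /quarter.
have [v1|v1] := leqP v x; first by exists false, false, v.
have [v2|v2] := leqP v m.
  exists true, true, (m - v); split; first by nlia.
  by rewrite /mirror /antipode; case: eqP => ?; case: ltnP; nlia.
have [v3|v3] := leqP v (m + x).
  exists true, false, (v - m); split; first by nlia.
  by rewrite /antipode; case: ltnP; nlia.
exists false, true, (n - v); split; first by nlia.
by rewrite /mirror; case: eqP => ?; nlia.
Qed.

Lemma antipodeK v : v < n -> antipode (antipode v) = v.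
Proof. by move=> vn; rewrite /antipode; case: (ltnP v (2 * x + 1)) => ?; case: ltnP; nlia. Qed.

Lemma mirrorK v : v < n -> mirror (mirror v) = v.
Proof. by move=> vn; rewrite /mirror; case: (v =P 0) => ?; case: eqP; nlia. Qed.

Lemma antipode_mirror v : v < n -> antipode (mirror v) = mirror (antipode v).
Proof.
move=> vn; rewrite /mirror /antipode; case: (v =P 0) => ?; case: (ltnP v (2 * x + 1)) => ?;
  case: ltnP => ?; case: eqP; nlia.
Qed.

Lemma antipode_lt v : v < n -> antipode v < n.
Proof. by move=> vn; rewrite /antipode; case: (ltnP v (2 * x + 1)); nlia. Qed.

Lemma mirror_lt v : v < n -> mirror v < n.
Proof. by move=> vn; rewrite /mirror; case: eqP; nlia. Qed.

Lemma quarterM s t s' t' v : v < n ->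
  quarter s t (quarter s' t' v) = quarter (s (+) s') (t (+) t') v.
Proof.
move=> vn; have := (antipodeK vn, mirrorK vn, antipode_mirror vn, antipode_lt vn, mirror_lt vn).
move=> [[[[hh mm] hm] hl] ml]; have hh' := antipodeK ml; have mm' := mirrorK hl.
by rewrite /quarter; case: s t s' t' => [] [] [] [] //=; rewrite -?hm ?hh ?mm ?hh' ?mm' // hm mm'.
Qed.

Lemma quarter_lt s t v : v < n -> quarter s t v < n.
Proof. by rewrite /quarter => vn; case: s t => [] [] /=; auto using antipode_lt, mirror_lt. Qed.

(* The two kinds of edges of the folded tree on [0, x]; the slanted ones cross the
   diameter before folding. *)
Definition plain i j := e i j.
Definition slant i j := e i (m + j).

(** [slant 0 0] is the diameter itself; any other slanted edge with an end over 0 would give an edge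
    from [1, x] to [m], against [no_diagonal]. *)
Lemma slant_pos i j : i <= x -> j <= x -> slant i j -> ~ (i = 0 /\ j = 0) -> 0 < i /\ 0 < j.
Proof.
rewrite /slant => ix jx ij nij.
have [i0|i0] := posnP i.
  have h0 : antipode i = m by rewrite /antipode; case: ltnP; nlia.
  have h1 : antipode (m + j) = j by rewrite /antipode; case: ltnP; nlia.
  have h := e_half ij; rewrite h0 h1 in h.
  by have := no_diagonal (e_sym h); nlia.
have [j0|j0] := posnP j; last by [].
by move: ij; rewrite j0 addn0 => h; have := no_diagonal h; nlia.
Qed.

Lemma slant_sym i j : i <= x -> j <= x -> slant i j -> slant j i.
Proof.
rewrite /slant => ix jx ij.
have h0 : antipode i = m + i by rewrite /antipode; case: ltnP; nlia.
have h1 : antipode (m + j) = j by rewrite /antipode; case: ltnP; nlia.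
by have := e_half ij; rewrite h0 h1; exact: e_sym.
Qed.

Lemma quarter_diam s t :
  quarter s t 0 = (if s then m else 0) /\ quarter s t m = (if s then 0 else m).
Proof.
have h0 : antipode 0 = m by rewrite /antipode; case: (ltnP 0 (2 * x + 1)); nlia.
have hm : antipode m = 0 by rewrite /antipode; case: (ltnP m (2 * x + 1)); nlia.
have tm : mirror m = m by rewrite /mirror; case: (m =P 0); nlia.
by rewrite /quarter; case: s t => [] [] /=; rewrite ?tm ?h0 ?hm.
Qed.

(** Once [u] is moved into [0, x], the other end lies in one of four quarters: the same one gives a
    plain edge, the antipodal one a slanted edge; [no_diagonal] excludes the third, and
    [crosser_sides'] leaves in the mirror quarter only edges with an end at 0, which belongs to both
    quarters. *)
Lemma edge_quarter u w : e u w -> ~ ((u = 0 /\ w = m) \/ (u = m /\ w = 0)) ->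
  exists s t i j, [/\ i <= x, j <= x, u = quarter s t i &
    (w = quarter s t j /\ plain i j) \/
    [/\ w = quarter s t (m + j), slant i j, 0 < i & 0 < j]].
Proof.
move=> uw nd; have [un wn] := e_lt uw.
have [s [t [i [ix ui]]]] := quarter_cover un.
have := e_quarter s t uw; rewrite {1}ui quarterM ?addbb; last by nlia.
have qw : w = quarter s t (quarter s t w) by rewrite quarterM // !addbb.
have qn := quarter_lt s t wn.
have [s' [t' [j [jx wj]]]] := quarter_cover qn.
have i_n : i < n by nlia.
rewrite -[quarter false false i]/i wj.
have qwj : w = quarter s t (quarter s' t' j) by rewrite -wj.
move: (i) (j) ix jx i_n ui qwj => {wj qw qn}i' j' ix jx i_n ui qwj.
case: s' t' qwj => [] []; rewrite {2}/quarter /= => qwj ij.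
- have jj : antipode (mirror j') = m - j'.
    by rewrite /mirror /antipode; case: (j' =P 0) => ?; case: ltnP; nlia.
  rewrite jj in ij; have [||i0 j0] := no_diagonal ij; try nlia.
  case: nd; have [q0 qm] := quarter_diam s t; rewrite ui qwj jj i0 j0 q0 qm; case: (s); auto.
- have jj : antipode j' = m + j' by rewrite /antipode; case: ltnP; nlia.
  rewrite jj in ij qwj; exists s, t, i', j'; split=> //; right.
  suff [i0 j0] : 0 < i' /\ 0 < j' by [].
  apply: slant_pos => // -[i0 j0].
  case: nd; have [q0 qm] := quarter_diam s t; rewrite ui qwj i0 j0 addn0 q0 qm; case: (s); auto.
- have [j0|j0] := posnP j'.
    by exists s, t, i', j'; split=> //; left; rewrite j0 in qwj ij *.
  have jj : mirror j' = n - j' by rewrite /mirror; case: eqP; nlia.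
  have [i0|i0] := posnP i'.
    exists s, (~~ t), i', j'; split=> //.
      by rewrite ui i0 /quarter; case: (t).
    left; split.
      rewrite qwj -[mirror j']/(quarter false true j') quarterM; last by nlia.
      by rewrite addbF addbT.
    have := e_mirror ij; rewrite mirrorK; last by nlia.
    by rewrite i0 /mirror.
  exfalso; rewrite jj in ij; have h1 : 0 < i' < m by nlia.
  have h2 : m < n - j' by nlia.
  by have := crosser_sides' ij h1 h2; nlia.
- by exists s, t, i', j'; split=> //; left.
Qed.

Lemma plain_P i j : i <= x -> j <= x -> plain i j -> P i = P j.
Proof.
move=> ix jx ij; apply/eqP; rewrite -[_ == _]negbK; apply/negP => /(P_cut ij); nlia.
Qed.

(** The end [m + j] is the antipode of [j], and the half turn negates [P]. *)
Lemma slant_P i j : i <= x -> j <= x -> 0 < i -> slant i j -> P j = ~~ P i.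
Proof.
move=> ix jx i0 ij.
have hj : antipode j = m + j by rewrite /antipode; case: ltnP; nlia.
have : P i = P (m + j).
  apply/eqP; rewrite -[_ == _]negbK; apply/negP => /(P_cut ij); nlia.
by rewrite -hj P_half; [move=> ->; rewrite negbK | nlia].
Qed.

(** Neither edge crosses the diameter, so both terms of [e_cross] vanish. *)
Lemma plain_plain i j k l : i <= x -> j <= x -> k <= x -> l <= x ->
  plain i j -> plain k l -> crossing i j k l = false.
Proof.
move=> ix jx kx lx ij kl; rewrite (e_cross ij kl).
have -> : crossing 0 m i j = false by rewrite /crossing; nlia.
by have -> : crossing 0 m k l = false by rewrite /crossing; nlia.
Qed.

(** By [e_cross], a plain edge meets all edges crossing the diameter alike. It cannot meet the image
    of the slanted edge under the product of the symmetries, whose ends lie outside [0, x]. *)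
Lemma plain_slant p q i j : p <= x -> q <= x -> i <= x -> j <= x -> 0 < i -> 0 < j ->
  plain p q -> slant i j -> ~~ (p < i < q).
Proof.
move=> px qx ix jx i0 j0 pq ij; apply/negP => piq.
have htij := e_half (e_mirror ij).
have ti_ : antipode (mirror i) = m - i.
  by rewrite /mirror /antipode; case: (i =P 0) => ?; case: ltnP; nlia.
have tj_ : antipode (mirror (m + j)) = n - j.
  by rewrite /mirror /antipode; case: (m + j =P 0) => ?; case: ltnP; nlia.
rewrite ti_ tj_ in htij.
have c0 : crossing 0 m p q = false by rewrite /crossing; nlia.
have c1 : crossing 0 m i (m + j) = true by rewrite /crossing; nlia.
have c2 : crossing 0 m (m - i) (n - j) = true by rewrite /crossing; nlia.
have d1 : crossing p q i (m + j) = true by rewrite /crossing; nlia.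
have d2 : crossing p q (m - i) (n - j) = false by rewrite /crossing; nlia.
by have := e_cross pq ij; have := e_cross pq htij; rewrite c0 c1 c2 d1 d2 /= => <-.
Qed.

(** Among three edges crossing the diameter, [e_cross] makes an even number of pairs cross. The
    mirror image of the second edge crosses both edges, so these do not cross each other. *)
Lemma slant_slant i j k l : i <= x -> j <= x -> k <= x -> l <= x ->
  0 < i -> 0 < j -> 0 < k -> 0 < l -> slant i j -> slant k l -> i < k -> l <= j.
Proof.
move=> ix jx kx lx i0 j0 k0 l0 ij kl ik.
have tkl := e_mirror kl.
have tk_ : mirror k = n - k by rewrite /mirror; case: eqP; nlia.
have tl_ : mirror (m + l) = m - l by rewrite /mirror; case: eqP; nlia.
rewrite tk_ tl_ in tkl.
have c1 : crossing 0 m i (m + j) = true by rewrite /crossing; nlia.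
have c2 : crossing 0 m k (m + l) = true by rewrite /crossing; nlia.
have c3 : crossing 0 m (n - k) (m - l) = true by rewrite /crossing; nlia.
have d1 : crossing i (m + j) (n - k) (m - l) = true by rewrite /crossing; nlia.
have d2 : crossing k (m + l) (n - k) (m - l) = true by rewrite /crossing; nlia.
have f1 := e_cross ij kl; have f2 := e_cross ij tkl; have f3 := e_cross kl tkl.
rewrite c1 c2 c3 d1 d2 /= in f1 f2 f3.
have : crossing i (m + j) k (m + l) = false.
  by rewrite f1; move: f2 f3; do 3 case: (crossing _ _ _ _).
rewrite /crossing; nlia.
Qed.

Definition fold v := if v <= x then v else if v <= m then m - v
  else if v <= m + x then v - m else n - v.

Lemma fold_quarter s t i : i <= x -> fold (quarter s t i) = i.
Proof.
move=> ix.
have foldE v : [\/ v = i, v = m - i, v = m + i | v = n - i /\ 0 < i] -> fold v = i.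
  rewrite /fold => h; case: (leqP v x) => h1; first by case: h; nlia.
  case: (leqP v m) => h2; first by case: h; nlia.
  by case: (leqP v (m + x)) => h3; case: h; nlia.
have hi : antipode i = m + i by rewrite /antipode; case: (ltnP i (2 * x + 1)); nlia.
apply: foldE; rewrite /quarter; case: s t => [] [] /=.
- rewrite /mirror; case: (i =P 0) => [i0|i0]; first by rewrite -[in antipode 0]i0 hi; constructor 3.
  by rewrite /antipode; case: (ltnP (4 * x + 2 - i) (2 * x + 1)) => ?; constructor 2; nlia.
- by rewrite hi; constructor 3.
- by rewrite /mirror; case: (i =P 0) => [i0|i0]; [constructor 1 | constructor 4]; nlia.
- by constructor 1.
Qed.

Lemma quarter_side (s t : bool) v : v <= x ->
  if s == t then quarter s t v <= m else (quarter s t v == 0) || (m <= quarter s t v).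
Proof.
move=> vx; have hi : antipode v = m + v by rewrite /antipode; case: (ltnP v (2 * x + 1)); nlia.
rewrite /quarter; case: s t => [] [] /=; try nlia.
- rewrite /mirror; case: (v =P 0) => [v0|v0]; first by rewrite -[in antipode 0]v0 hi; nlia.
  by rewrite /antipode; case: (ltnP (4 * x + 2 - v) (2 * x + 1)) => ?; nlia.
- by rewrite /mirror; case: (v =P 0) => [v0|v0]; nlia.
Qed.

(** Folding collapses the diameter to 0 and sends every other edge to a plain or slanted one, so [R]
    composed with [fold] is constant along the edges of the tree. *)
Lemma fold_conn (R : nat -> bool) :
  (forall i j, i <= x -> j <= x -> plain i j -> R i = R j) ->
  (forall i j, i <= x -> j <= x -> 0 < i -> 0 < j -> slant i j -> R i = R j) ->
  forall i, i <= x -> R i = R 0.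
Proof.
move=> Rp Rs i ix.
have iR p q : e p q -> R (fold p) = R (fold q).
  move=> pq; have f0 : fold 0 = 0 by [].
  have fm : fold m = 0 by have [<- _] := quarter_diam true false; rewrite fold_quarter.
  have [pqd|pqd] := boolP (((p == 0) && (q == m)) || ((p == m) && (q == 0))).
    by move: pqd => /orP[]/andP[/eqP-> /eqP->]; rewrite f0 fm.
  have [|s [t [k [l [kx lx -> qE]]]]] := edge_quarter pq; first by nlia.
  case: qE => [[-> kl]|[-> kl k0 l0]]; first by rewrite !fold_quarter //; exact: Rp.
  have -> : m + l = quarter true false l by rewrite /quarter /antipode /=; case: ltnP; nlia.
  by rewrite quarterM; [rewrite !fold_quarter //; exact: Rs | nlia].
have := e_conn iR (p := i); rewrite /fold ix; apply; nlia.
Qed.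

(** The pivot [{b1, b2}] folds to a slanted edge, since a plain one stays on one side of the
    diameter; exchanging [i] and [j] adjusts [P i]. *)
Lemma slant_exists : exists i j, [/\ i <= x, j <= x, 0 < i, 0 < j & slant i j /\ P i = false].
Proof.
have [|s [t [i [j [ix jx b1E bE]]]]] := edge_quarter e_b.
  by move: b_cross; rewrite /crossing; nlia.
case: bE => [[b2E _]|[_ ij i0 j0]].
  exfalso; move: b_cross; rewrite b1E b2E.
  have := quarter_side s t ix; have := quarter_side s t jx; rewrite /crossing; case: (s == t); nlia.
have [Pi|Pi] := boolP (P i); last by exists i, j; split=> //; split=> //; apply/negbTE.
exists j, i; split=> //; split; first exact: slant_sym.
by rewrite (slant_P ix jx i0 ij) Pi.
Qed.

(** As a function of [v], the condition holds at 0 and is constant along folded edges by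
    [plain_slant] and [slant_slant]. *)
Lemma slant_separates i l v : i <= x -> l <= x -> 0 < i -> 0 < l -> slant i l -> P i = false ->
  v <= x -> if P v then i < v else v < l.
Proof.
move=> ix lx i0 l0 il Pi vx.
have Pl : P l = true by rewrite (slant_P ix lx i0 il) Pi.
pose R v := if P v then i < v else v < l.
suff : R v = R 0 by rewrite /R P0 l0.
apply: fold_conn vx => {v}.
  move=> u v ux vx uv; rewrite /R -(plain_P ux vx uv).
  have li := slant_sym ix lx il.
  have := plain_slant ux vx ix lx i0 l0 uv il.
  have := plain_slant vx ux ix lx i0 l0 (e_sym uv) il.
  have := plain_slant ux vx lx ix l0 i0 uv li.
  have := plain_slant vx ux lx ix l0 i0 (e_sym uv) li.
  have Pv := plain_P ux vx uv.
  case: ifP => Pu.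
    have : u != i by apply: contraTneq Pu => ->; rewrite Pi.
    have : v != i by apply: contraTneq Pu => vi; rewrite Pv vi Pi.
    nlia.
  have : u != l by apply: contraFneq Pu => ->; rewrite Pl.
  have : v != l by apply: contraFneq Pu => vl; rewrite Pv vl Pl.
  nlia.
have main k l2 : k <= x -> l2 <= x -> 0 < k -> 0 < l2 -> slant k l2 -> P k = false -> R k = R l2.
  move=> kx l2x k0 l20 kl Pk.
  have Pl2 : P l2 = true by rewrite (slant_P kx l2x k0 kl) Pk.
  rewrite /R Pk Pl2.
  have lk := slant_sym kx l2x kl.
  have h1 := slant_slant ix lx l2x kx i0 l0 l20 k0 il lk.
  have h2 := slant_slant l2x kx ix lx l20 k0 i0 l0 lk il.
  have : k != l by apply: contraFneq Pk => ->; rewrite Pl.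
  have : l2 != i by apply: contraTneq Pl2 => ->; rewrite Pi.
  nlia.
move=> k l2 kx l2x k0 l20 kl; have [Pk|Pk] := boolP (P k); last by apply: main => //; apply/negbTE.
by apply/esym/main => //; [exact: slant_sym | rewrite (slant_P kx l2x k0 kl) Pk].
Qed.

Lemma P_upward u v : u < v <= x -> (forall w, w < u -> P w = false) -> P u -> P v.
Proof.
move=> /andP[uv vx] umin Pu; apply/negPn/negP => Pv.
have ux : u <= x by nlia.
have [i0 [l0 [ix lx ipos lpos [il Pi]]]] := slant_exists.
have sep k l w : k <= x -> l <= x -> 0 < k -> 0 < l -> slant k l -> w <= x ->
    if P k then (if P w then l < w else w < k) else (if P w then k < w else w < l).
  move=> kx lx' k0 l0' kl wx; case: ifP => Pk; last exact: slant_separates.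
  by apply: slant_separates => //; [exact: slant_sym | rewrite (slant_P kx lx' k0 kl) Pk].
(* If a plain edge with [P] false at its ends passes over [u], the vertices of [P] below it form a
   set closed under folded edges that contains [u] but not 0. *)
have [/existsP[p /existsP[q /and4P[pq pu uq Pp]]]|no] := boolP
    [exists p : 'I_x.+1, exists q : 'I_x.+1, [&& plain p q, p < u, u < q & ~~ P p]].
  have px : p <= x by rewrite -ltnS.
  have qx : q <= x by rewrite -ltnS.
  have Pq : P q = false by rewrite -(plain_P px qx pq); apply/negbTE.
  suff : (P u && (p < u < q)) = (P 0 && (p < 0 < q)) by rewrite Pu P0 pu uq.
  apply: (@fold_conn (fun w => P w && (p < w < q))) => //.
    move=> w z wx zx wz; rewrite -(plain_P wx zx wz); case: (boolP (P w)) => //= Pw.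
    have := plain_plain wx zx px qx wz pq.
    have : w != p by apply: contraTneq Pw => ->.
    have : w != q by apply: contraTneq Pw => ->; rewrite Pq.
    rewrite (plain_P wx zx wz) in Pw.
    have : z != p by apply: contraTneq Pw => ->.
    have : z != q by apply: contraTneq Pw => ->; rewrite Pq.
    rewrite /crossing; nlia.
  move=> k l kx lx' k0 l0' kl.
  have := plain_slant px qx kx lx' k0 l0' pq kl.
  have := plain_slant px qx lx' kx l0' k0 pq (slant_sym kx lx' kl).
  by move=> /negPf -> /negPf ->; rewrite !andbF.
(* Otherwise the vertices beyond [u] where [P] is false form a closed set that contains [v] but not
   0: by [sep], no slanted edge ends there. *)
suff : (~~ P v && (u < v)) = (~~ P 0 && (u < 0)) by rewrite Pv uv andbF.
apply: (@fold_conn (fun w => ~~ P w && (u < w))) => //.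
  have main p q : p <= x -> q <= x -> plain p q -> ~~ P p -> u < q -> u < p.
    move=> px qx pq Pp uq; rewrite ltnNge; apply/negP => pu.
    have pu' : p != u by apply: contraNneq Pp => ->.
    move/negP: no; apply; apply/existsP.
    have px' : p < x.+1 by []. have qx' : q < x.+1 by [].
    exists (Ordinal px'); apply/existsP; exists (Ordinal qx') => /=.
    rewrite pq uq Pp /=; nlia.
  move=> p q px qx pq; rewrite -(plain_P px qx pq); case: (boolP (P p)) => //= Pp.
  apply/idP/idP => h; apply: main h => //; [exact: e_sym | by rewrite -(plain_P px qx pq)].
move=> k l kx lx' k0 l0' kl; have := sep k l u kx lx' k0 l0' kl ux.
rewrite (slant_P kx lx' k0 kl) Pu; case: (P k) => /= h; nlia.
Qed.

Lemma P_threshold : exists2 d, d < x & forall i, i <= x -> P i = (d < i).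
Proof.
have [i [l [ix lx i0 l0 [il Pi]]]] := slant_exists.
have Pl : P l by rewrite (slant_P ix lx i0 il) Pi.
have ex : exists u, P u by exists l.
case: (ex_minnP ex) => u Pu umin.
have u0 : 0 < u by case: u Pu {umin} => //; rewrite P0.
have ul := umin l Pl.
exists u.-1; first by nlia.
move=> v vx; rewrite prednK //.
apply/idP/idP => [/umin//|]; rewrite leq_eqVlt => /orP[/eqP <- //|uv].
apply: (@P_upward u) => //; first by rewrite uv.
by move=> w wu; apply/negbTE; apply: contraTN wu => /umin; rewrite -leqNgt.
Qed.

(* When P i = (d < i) on [0, x], the component of 0 after removing the diameter
   contains both [quarter (d < i) false i] and [quarter (d < j) false j]. *)
Definition link d i j := e (quarter (d < i) false i) (quarter (d < j) false j).

Lemma quarter_true i : i <= x -> quarter true false i = m + i.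
Proof. by move=> ix; rewrite /quarter /antipode /=; case: ltnP; nlia. Qed.

Lemma antipode_slant i : i <= x -> antipode (m + i) = i.
Proof. by move=> ix; rewrite /antipode; case: ltnP; nlia. Qed.

Lemma link_plain d i j : i <= x -> j <= x -> (d < i) = (d < j) -> link d i j = plain i j.
Proof.
move=> ix jx; rewrite /link /plain => <-; case: (d < i); last by [].
rewrite !quarter_true //; apply/idP/idP => [/e_half|ij]; first by rewrite !antipode_slant.
by rewrite -!quarter_true //; exact: e_quarter.
Qed.

Lemma link_sym d i j : link d i j -> link d j i.
Proof. exact: e_sym. Qed.

Lemma link_slant d i j : i <= x -> j <= x -> i <= d -> d < j -> link d i j = slant i j.
Proof.
by move=> ix jx id dj; rewrite /link dj quarter_true // ltnNge id.
Qed.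

Lemma link_slant_pos d i j : i <= x -> j <= x -> i <= d -> d < j -> link d i j ->
  [/\ slant i j, 0 < i & 0 < j].
Proof.
move=> ix jx id dj; rewrite link_slant // => ij.
have nij : ~ (i = 0 /\ j = 0) by nlia.
by have [i0 j0] := slant_pos ix jx ij nij.
Qed.

Lemma linkP d i j : i <= x -> j <= x -> link d i j ->
  (d < i) = (d < j) /\ plain i j \/ (d < i) <> (d < j) /\ [/\ slant i j, 0 < i & 0 < j].
Proof.
move=> ix jx ij.
have [di|di] := leqP i d; have [dj|dj] := leqP j d.
- by left; rewrite -(@link_plain d) //; nlia.
- by right; split; [| apply: (@link_slant_pos d)].
- right; split=> //; have [|||||ji j0 i0] := @link_slant_pos d j i => //; first exact: link_sym.
  by split=> //; exact: slant_sym.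
- by left; rewrite -(@link_plain d) //; nlia.
Qed.

Lemma fold_structure : exists2 d, d < x & [/\
  forall i, i <= x -> P i = (d < i),
  forall u w, e u w -> ~ ((u = 0 /\ w = m) \/ (u = m /\ w = 0)) ->
    exists s t i j, [/\ i <= x, j <= x, link d i j,
      u = quarter (s (+) (d < i)) t i & w = quarter (s (+) (d < j)) t j],
  forall i j k l, i <= x -> j <= x -> k <= x -> l <= x -> link d i j -> link d k l ->
    ~~ [&& i < k, k < j & j < l],
  forall R : nat -> bool, (forall i j, i <= x -> j <= x -> link d i j -> R i = R j) ->
    forall i, i <= x -> R i = R 0
  & forall j, j <= x -> link d 0 j -> j <= d].
Proof.
have [d dx Pd] := P_threshold; exists d => //; split=> //.
- move=> u w uw nd; have [s [t [i [j [ix jx uE wE]]]]] := edge_quarter uw nd.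
  case: wE => [[wE ij]|[wE ij i0 j0]].
    have dij : (d < i) = (d < j) by rewrite -!Pd // (plain_P ix jx ij).
    exists (s (+) (d < i)), t, i, j; split=> //; first by rewrite link_plain.
      by rewrite -addbA addbb addbF.
    by rewrite dij -addbA addbb addbF.
  have dij : (d < j) = ~~ (d < i) by rewrite -!Pd // (slant_P ix jx i0 ij).
  exists (s (+) (d < i)), t, i, j; split=> //.
  + have [di|di] := leqP i d.
      by rewrite link_slant // dij -leqNgt.
    apply: link_sym; rewrite link_slant //; first exact: slant_sym.
    by rewrite leqNgt dij di.
  + by rewrite -addbA addbb addbF.
  + rewrite wE dij -(quarter_true jx) quarterM; last by nlia.
    by case: (s) (t) (d < i) => [] [] [].
- move=> i j k l ix jx kx lx ij kl; apply/negP => /and3P[ik kj jl].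
  have [[_ {}ij]|[dij [{}ij i0 j0]]] := linkP ix jx ij;
  have [[_ {}kl]|[dkl [{}kl k0 l0]]] := linkP kx lx kl.
  + have := plain_plain ix jx kx lx ij kl; rewrite /crossing; nlia.
  + by have := plain_slant ix jx kx lx k0 l0 ij kl; nlia.
  + by have := plain_slant kx lx jx ix j0 i0 kl (slant_sym ix jx ij); nlia.
  + by have := slant_slant ix jx kx lx i0 j0 k0 l0 ij kl ik; nlia.
- move=> R iR i ix; apply: fold_conn ix => {i} i j ix jx.
    by move=> ij; apply: iR => //; rewrite link_plain // -!Pd // (plain_P ix jx ij).
  move=> i0 j0 ij; have dij : (d < j) = ~~ (d < i) by rewrite -!Pd // (slant_P ix jx i0 ij).
  have [di|di] := leqP i d.
    by apply: iR => //; rewrite link_slant // dij -leqNgt.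
  apply/esym/iR => //; rewrite link_slant //; first exact: slant_sym.
  by rewrite leqNgt dij di.
- move=> j jx lj; rewrite leqNgt; apply/negP => dj.
  by have [] := link_slant_pos (leq0n x) jx (leq0n d) dj lj.
Qed.

End Fold.

Lemma quarterE x s t k : k <= x -> quarter x s t k =
  if t then (if s then 2 * x + 1 - k else if k == 0 then 0 else 4 * x + 2 - k)
  else (if s then 2 * x + 1 + k else k).
Proof.
move=> kx; have hk : antipode x k = 2 * x + 1 + k.
  by rewrite /antipode; case: (ltnP k (2 * x + 1)); lia.
case: s t => [] [] //=; rewrite /quarter /= ?hk // /mirror.
case: (k =P 0) => [k0|k0]; first by rewrite -[in antipode x 0]k0 hk; lia.
by rewrite /antipode; case: (ltnP (4 * x + 2 - k) (2 * x + 1)); lia.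
Qed.

Lemma quarter_inj x s t s' t' k k' : k <= x -> k' <= x ->
  quarter x s t k = quarter x s' t' k' -> [/\ k = k', s = s' & t = t' \/ k = 0].
Proof.
move=> kx kx'; rewrite !quarterE //.
case: s t s' t' => [] [] [] [] /=; try (case: (k =P 0) => ?); try (case: (k' =P 0) => ?);
  move=> h; (split; [lia | try lia; by [] | try (by left); right; lia]).
Qed.

Lemma crossing_diam_quarter x s t d i j : i < j -> j <= x -> (i = 0 -> j <= d) ->
  crossing 0 (2 * x + 1) (quarter x (s (+) (d < i)) t i) (quarter x (s (+) (d < j)) t j)
    = (i <= d < j).
Proof.
move=> ij jx i0; have ix : i <= x by lia.
rewrite !quarterE //.
have [di|di] := leqP i d; have [dj|dj] := leqP j d; rewrite ?addbF ?addbT /=;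
  case: s; case: t => /=; try (case: (i =P 0) => ?); try (case: (j =P 0) => ?);
  rewrite /crossing; lia.
Qed.

Lemma crossing_antipode x a b c d : a < 4 * x + 2 -> b < 4 * x + 2 ->
  c < 4 * x + 2 -> d < 4 * x + 2 ->
  crossing (antipode x a) (antipode x b) (antipode x c) (antipode x d) = crossing a b c d.
Proof.
rewrite /antipode => an bn cn dn.
case: (ltnP a (2 * x + 1)) => ?; case: (ltnP b (2 * x + 1)) => ?;
case: (ltnP c (2 * x + 1)) => ?; case: (ltnP d (2 * x + 1)) => ?; rewrite /crossing; lia.
Qed.

Lemma crossing_mirror x a b c d : a < 4 * x + 2 -> b < 4 * x + 2 ->
  c < 4 * x + 2 -> d < 4 * x + 2 ->
  crossing (mirror x a) (mirror x b) (mirror x c) (mirror x d) = crossing a b c d.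
Proof.
rewrite /mirror => an bn cn dn.
case: (a =P 0) => ?; case: (b =P 0) => ?; case: (c =P 0) => ?; case: (d =P 0) => ?;
  rewrite /crossing; lia.
Qed.

Lemma crossing_quarter_map x s t a b c d : a < 4 * x + 2 -> b < 4 * x + 2 ->
  c < 4 * x + 2 -> d < 4 * x + 2 ->
  crossing (quarter x s t a) (quarter x s t b) (quarter x s t c) (quarter x s t d)
    = crossing a b c d.
Proof.
move=> an bn cn dn; rewrite /quarter.
by case: s; case: t => /=; rewrite ?crossing_antipode ?crossing_mirror ?mirror_lt.
Qed.

(** A symmetry brings the first edge to [s = t = false], after which only inequalities remain. The
    value is a determinant in the coordinates [i <= d < j] and [(i <= d < j) && t], whence rank two
    for unfolded trees. *)
Lemma crossing_quarter x d s t i j s' t' k l : i < j -> j <= x -> k < l -> l <= x ->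
  (i = 0 -> j <= d) -> (k = 0 -> l <= d) ->
  ~~ [&& i < k, k < j & j < l] -> ~~ [&& k < i, i < l & l < j] ->
  crossing (quarter x (s (+) (d < i)) t i) (quarter x (s (+) (d < j)) t j)
           (quarter x (s' (+) (d < k)) t' k) (quarter x (s' (+) (d < l)) t' l)
    = [&& i <= d < j, k <= d < l & t (+) t'].
Proof.
move=> ij jx kl lx i0 k0 nc nc'; have ix : i <= x by lia. have kx : k <= x by lia.
have qn (v : nat) (a b : bool) : v <= x -> quarter x a b v < 4 * x + 2.
  by move=> vx; apply: quarter_lt; lia.
have xn (v : nat) : v <= x -> v < 4 * x + 2 by lia.
suff H s1 t1 : crossing (quarter x (d < i) false i) (quarter x (d < j) false j)
    (quarter x (s1 (+) (d < k)) t1 k) (quarter x (s1 (+) (d < l)) t1 l)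
    = [&& i <= d < j, k <= d < l & t1].
  have -> : t (+) t' = t' (+) t by case: t t' => [] [].
  rewrite -(H (s' (+) s)).
  have qE s1 t1 v : v <= x ->
      quarter x (s1 (+) (d < v)) t1 v = quarter x s t (quarter x (s (+) s1 (+) (d < v)) (t1 (+) t) v).
    move=> vx; rewrite quarterM; last by lia.
    by case: s t s1 t1 (d < v) => [] [] [] [] [].
  rewrite (qE s t i) // (qE s t j) // (qE s' t' k) // (qE s' t' l) //.
  rewrite !addbb !addFb (addbC s s').
  by rewrite crossing_quarter_map //; apply: qn => //; lia.
rewrite !quarterE //.
have [di|di] := leqP i d; have [dj|dj] := leqP j d; have [dk|dk] := leqP k d; have [dl|dl] := leqP l d;
  try (exfalso; lia); rewrite ?addbF ?addbT /=;
  case: s1; case: t1 => /=;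
  try (case: (k =P 0) => ?); try (case: (l =P 0) => ?);
  try (exfalso; lia);
  rewrite /crossing; lia.
Qed.

(** * The reflection fixing 0 *)

Section Reflection.
Variable N : nat.

Definition reflection_fun (v : 'I_N.+1) : 'I_N.+1 := inZp (N.+1 - v).

Lemma reflection_funE (v : 'I_N.+1) :
  (reflection_fun v : nat) = if v == 0 :> nat then 0 else N.+1 - v.
Proof.
rewrite /=; have vN := ltn_ord v; case: (nat_of_ord v =P 0) => [->|v0]; first by rewrite subn0 modnn.
by rewrite modn_small; lia.
Qed.

Lemma reflection_funK : involutive reflection_fun.
Proof.
move=> v; apply/val_inj; rewrite -[LHS]/(nat_of_ord _) !reflection_funE.
by have vN := ltn_ord v; case: (nat_of_ord v =P 0) => v0 //=; case: eqP; lia.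
Qed.

Definition reflection : {perm 'I_N.+1} := perm (inv_inj reflection_funK).

Lemma reflectionE (v : 'I_N.+1) :
  (reflection v : nat) = if v == 0 :> nat then 0 else N.+1 - v.
Proof. by rewrite permE reflection_funE. Qed.

Lemma reflectionK : involutive reflection.
Proof. by move=> v; rewrite !permE reflection_funK. Qed.

Lemma reflection0 : reflection ord0 = ord0.
Proof. by apply/val_inj; rewrite -[LHS]/(nat_of_ord _) reflectionE. Qed.

Lemma keeps_crossing_reflection : keeps_crossing reflection.
Proof.
move=> a b c d; rewrite !reflectionE.
have := (ltn_ord a, ltn_ord b, ltn_ord c, ltn_ord d).
move: (val a) (val b) (val c) (val d) => {}a {}b {}c {}d [[[ha hb] hc] hd].
case: (a =P 0) => ?; case: (b =P 0) => ?; case: (c =P 0) => ?; case: (d =P 0) => ?;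
  rewrite /crossing; lia.
Qed.

Lemma map_reflectionK : involutive (map_edges reflection).
Proof.
move=> E; rewrite -map_edgesM (_ : (reflection * reflection)%g = 1%g) ?map_edges1 //.
by apply/permP => v; rewrite permM reflectionK perm1.
Qed.

Variable m : nat.
Hypothesis Nm : N.+1 = 2 * m.

Lemma reflection_half_turn : (reflection * half_turn N m = half_turn N m * reflection)%g.
Proof.
apply/permP => v; rewrite !permM; apply/val_inj; rewrite -[LHS]/(nat_of_ord _) -[RHS]/(nat_of_ord _).
rewrite !(half_turnE Nm) !reflectionE !(half_turnE Nm); have vN := ltn_ord v.
case: (nat_of_ord v =P 0) => v0; case: (ltnP v m) => vm; case: ltnP => ?; case: eqP => ?; lia.
Qed.

Lemma reflection_diam : [set reflection ord0; reflection (half_turn N m ord0)] = diam N m.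
Proof.
rewrite reflection0 /diam; congr [set _; _].
by have := congr1 (fun p : {perm 'I_N.+1} => p ord0) reflection_half_turn; rewrite !permM reflection0.
Qed.

Definition dihedral_trees := [set E in central_trees N m | map_edges reflection E == E].

Lemma odd_central_trees : odd #|central_trees N m| = odd #|dihedral_trees|.
Proof.
apply: odd_card_involution; first exact: map_reflectionK.
move=> E; rewrite !in_central_trees => /and3P[gE /eqP hE dE].
rewrite genus_one_trees_map //=; last exact: keeps_crossing_reflection.
rewrite -map_edgesM reflection_half_turn map_edgesM hE eqxx /=.
by rewrite -[X in X \in _]reflection_diam mem_map_edges; exact: dE.
Qed.

(** The constant of [cut_automorphism] vanishes because the reflection fixes [ord0]. *)
Lemma reflection_cut (E : {set {set 'I_N.+1}}) (u v : 'I_N.+1) S :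
  tree_cuts E -> map_edges reflection E = E ->
  [set reflection u; reflection v] = [set u; v] -> cut_of E [set u; v] S ->
  forall w, S (reflection w) = S w.
Proof.
move=> tE rE ruv cS w; have := cut_automorphism tE rE ruv cS w ord0.
by rewrite reflection0 addbb; case: (S w) (S (reflection w)) => [] [].
Qed.

(** For even [m], the reflection followed by the half turn fixes the vertex [m./2], although the cut
    along the diameter is preserved by the former and negated by the latter. *)
Lemma dihedral_trees_even_half : ~~ odd m -> dihedral_trees = set0.
Proof.
move=> em; apply/setP=> E; rewrite in_set0 in_set in_central_trees; apply/negP.
case/andP=> /and3P[/genus_one_treesP[tE _] /eqP hE dE] /eqP rE.
have [_ _ kE] := tE; have [R cR] := kE _ dE.
have Rh := diameter_cut Nm tE hE dE cR.
have Rr := reflection_cut tE rE reflection_diam cR.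
pose v : 'I_N.+1 := inZp m./2.
have m2 := odd_double_half m; rewrite (negPf em) in m2.
have vE : (v : nat) = m./2 by rewrite /= modn_small; lia.
have : half_turn N m (reflection v) = v.
  apply/val_inj; rewrite -[LHS]/(nat_of_ord _) -[RHS]/(nat_of_ord _) (half_turnE Nm) reflectionE vE.
  by case: (m./2 =P 0) => ?; [lia | case: ltnP; lia].
by move=> h; have := Rh (reflection v); rewrite h Rr; case: (R v).
Qed.

End Reflection.

(** [cross e f] is the determinant of the vectors [(cross a0 e, cross b0 e)] and
    [(cross a0 f, cross b0 f)]; the Pluecker relation lets any pair of determinant 1 replace [a0],
    [b0]. *)
Lemma rank_two_pivot n (E : {set {set 'I_n}}) a b : rank_two E ->
  a \in E -> b \in E -> cross a b -> forall e f, e \in E -> f \in E ->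
  cross e f = (cross a e && cross b f) (+) (cross a f && cross b e).
Proof.
move=> [a0 [b0 [a0E b0E _ H]]] aE bE ab e f eE fE; move: ab.
rewrite (H a b aE bE) (H e f eE fE) (H a e aE eE) (H b f bE fE) (H a f aE fE) (H b e bE eE).
move: (cross a0 a) (cross a0 b) (cross a0 e) (cross a0 f) (cross b0 a) (cross b0 b) (cross b0 e) (cross b0 f).
by do 8 case.
Qed.

(** Noncrossing trees on [a, b], edges being increasing pairs. The ambient type is independent of
    the interval so that subtrees need no relabelling; the last two conditions are those of
    [tree_cuts]. *)
Definition nctree M (a b : nat) (Q : {set 'I_M * 'I_M}) : Prop :=
  [/\ forall q : 'I_M * 'I_M, q \in Q -> [&& a <= q.1, q.1 < q.2 & q.2 <= b],
      forall q r : 'I_M * 'I_M, q \in Q -> r \in Q -> ~~ [&& q.1 < r.1, r.1 < q.2 & q.2 < r.2],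
      forall R : 'I_M -> bool, (forall q : 'I_M * 'I_M, q \in Q -> R q.1 = R q.2) ->
        forall i j : 'I_M, a <= i <= b -> a <= j <= b -> R i = R j
    & forall q : 'I_M * 'I_M, q \in Q -> exists R : 'I_M -> bool,
        forall r : 'I_M * 'I_M, r \in Q -> (R r.1 != R r.2) = (r == q)].

Lemma crossing_opposite_sides m p q u v : p <= m -> q <= m ->
  (u == 0) || (m <= u) -> (v == 0) || (m <= v) -> crossing p q u v = false.
Proof. rewrite /crossing; lia. Qed.

Lemma crossing_same_side m p q r s :
  crossing 0 m p q = false -> crossing 0 m r s = false -> crossing p q r s ->
  [&& p <= m, q <= m, r <= m & s <= m] ||
  [&& (p == 0) || (m <= p), (q == 0) || (m <= q), (r == 0) || (m <= r) & (s == 0) || (m <= s)].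
Proof. rewrite /crossing; lia. Qed.

Lemma antipode_side x v : v <= 2 * x + 1 ->
  (antipode x v == 0) || (2 * x + 1 <= antipode x v).
Proof. by move=> vm; rewrite /antipode; case: (ltnP v (2 * x + 1)); lia. Qed.

Lemma antipode_side' x v : v < 4 * x + 2 -> (v == 0) || (2 * x + 1 <= v) ->
  antipode x v <= 2 * x + 1.
Proof. by move=> vn; rewrite /antipode; case: (ltnP v (2 * x + 1)); lia. Qed.

(** Two crossing edges that avoid the diameter lie on the same side of it, and the half turn
    exchanges the sides. *)
Lemma antipode_no_crossing x p q r s : p < 4 * x + 2 -> q < 4 * x + 2 ->
  r < 4 * x + 2 -> s < 4 * x + 2 ->
  crossing 0 (2 * x + 1) p q = false -> crossing 0 (2 * x + 1) r s = false ->
  crossing p q r s ->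
  crossing p q (antipode x p) (antipode x q) = false /\
  crossing p q (antipode x r) (antipode x s) = false.
Proof.
move=> pn qn rn sn c1 c2 c3.
have /orP[/and4P[h1 h2 h3 h4]|/and4P[h1 h2 h3 h4]] := crossing_same_side c1 c2 c3.
  by split; apply: (crossing_opposite_sides h1 h2); exact: antipode_side.
by split; rewrite crossing_sym; apply: (@crossing_opposite_sides (2 * x + 1)) => //; exact: antipode_side'.
Qed.

Section Vertices.
Variable x : nat.
Local Notation N := (4 * x + 1).
Local Notation m := (2 * x + 1).
Local Notation V := 'I_(4 * x + 1).+1.

Lemma N_even : N.+1 = 2 * m. Proof. lia. Qed.

Lemma zero_lt_n : 0 < 4 * x + 2. Proof. lia. Qed.

Lemma half_lt_n : m < 4 * x + 2. Proof. lia. Qed.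

Definition vtx (v : nat) : V := inZp v.

Lemma vtxE v : v < 4 * x + 2 -> vtx v = v :> nat.
Proof. by move=> vn; rewrite /= modn_small //; lia. Qed.

Lemma vtxK (v : V) : vtx v = v.
Proof. exact: valZpK. Qed.

Lemma vtx_inj u v : u < 4 * x + 2 -> v < 4 * x + 2 -> vtx u = vtx v -> u = v.
Proof. by move=> un vn /(congr1 (@nat_of_ord _)); rewrite !vtxE. Qed.

Lemma half_turn_vtx v : v < 4 * x + 2 -> half_turn N m (vtx v) = vtx (antipode x v).
Proof.
move=> vn; apply/val_inj; rewrite -[LHS]/(nat_of_ord _) -[RHS]/(nat_of_ord _).
by rewrite (half_turnE N_even) !vtxE //; exact: antipode_lt.
Qed.

Lemma reflection_vtx v : v < 4 * x + 2 -> reflection N (vtx v) = vtx (mirror x v).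
Proof.
move=> vn; apply/val_inj; rewrite -[LHS]/(nat_of_ord _) -[RHS]/(nat_of_ord _).
by rewrite reflectionE !vtxE // ?mirror_lt // /mirror; case: eqP; lia.
Qed.

Lemma diamE : diam N m = [set vtx 0; vtx m].
Proof.
have v0 : vtx 0 = ord0 by apply/val_inj; rewrite /= mod0n.
rewrite /diam -v0 half_turn_vtx; last by lia.
by have -> : antipode x 0 = m by rewrite /antipode; case: (ltnP 0 m); lia.
Qed.

Theorem dihedral_structure E : E \in dihedral_trees N m -> exists2 d, d < x &
  exists e : nat -> nat -> bool, [/\
  forall u w, e u w = [&& u < 4 * x + 2, w < 4 * x + 2 & [set vtx u; vtx w] \in E],
  forall u w, e u w -> [set vtx u; vtx w] != diam N m ->
    exists s t i j, [/\ i <= x, j <= x, link x e d i j,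
      u = quarter x (s (+) (d < i)) t i & w = quarter x (s (+) (d < j)) t j],
  forall i j k l, i <= x -> j <= x -> k <= x -> l <= x -> link x e d i j -> link x e d k l ->
    ~~ [&& i < k, k < j & j < l],
  forall R : nat -> bool, (forall i j, i <= x -> j <= x -> link x e d i j -> R i = R j) ->
    forall i, i <= x -> R i = R 0
  & forall j, j <= x -> link x e d 0 j -> j <= d].
Proof.
rewrite in_set in_central_trees => /andP[/and3P[/genus_one_treesP[tE rE] /eqP hE dE] /eqP fE].
have [sE cE kE] := tE.
pose e u w := [&& u < 4 * x + 2, w < 4 * x + 2 & [set vtx u; vtx w] \in E].
have eP u w : e u w -> [/\ u < 4 * x + 2, w < 4 * x + 2 & [set vtx u; vtx w] \in E] by case/and3P.
have eI (u w : V) : [set u; w] \in E -> e u w.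
  by move=> uw; rewrite /e !vtxK uw andbT; have un := ltn_ord u; have wn := ltn_ord w; clear -un wn; lia.
have e_anti p q : e p q -> e (antipode x p) (antipode x q).
  move=> /eP[pn qn pq]; rewrite /e !antipode_lt //= -!half_turn_vtx // -hE mem_map_edges.
  exact: pq.
have e_mir p q : e p q -> e (mirror x p) (mirror x q).
  move=> /eP[pn qn pq]; rewrite /e !mirror_lt //= -!reflection_vtx // -fE mem_map_edges.
  exact: pq.
have crossP p q r s : e p q -> e r s ->
    cross [set vtx p; vtx q] [set vtx r; vtx s] = crossing p q r s.
  by move=> /eP[pn qn _] /eP[rn sn _]; rewrite crossE !vtxE.
have e_sym p q : e p q -> e q p.
  by rewrite /e setUC => /and3P[-> -> ->].
have e0m : e 0 m by rewrite /e -diamE zero_lt_n half_lt_n.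
have dE' := dE; rewrite diamE in dE'.
(* If no edge crossed the diameter, the antipodal images of two crossing edges would cross each
   other, but the first of these edges would cross neither image, against the formula pivoted at the
   two edges. *)
have [b1 [b2 [eb cb]]] : exists b1 b2, e b1 b2 /\ crossing 0 m b1 b2.
  have [/existsP[p /existsP[q /andP[pq c]]]|no] := boolP
     [exists p : V, exists q : V, e p q && crossing 0 m p q]; first by exists p, q.
  have noc p q : e p q -> crossing 0 m p q = false.
    move=> pq; apply: contraNF no => c; have [pn qn _] := eP _ _ pq.
    by apply/existsP; exists (vtx p); apply/existsP; exists (vtx q); rewrite !vtxE // pq c.
  have [a [b [aE bE ab H]]] := rE.
  have /eqP/cards2P[p' [q' [_ ea]]] := sE a aE; have /eqP/cards2P[r' [s' [_ eb]]] := sE b bE.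
  have := ab; rewrite ea eb in aE bE *; rewrite crossE.
  move: (eI _ _ aE) (eI _ _ bE); move: (val p') (val q') (val r') (val s') => p q r s epq ers cpq.
  have [pn qn pqE] := eP _ _ epq; have [rn sn rsE] := eP _ _ ers.
  have [z1 z2] := antipode_no_crossing pn qn rn sn (noc _ _ epq) (noc _ _ ers) cpq.
  have [_ _ hpqE] := eP _ _ (e_anti _ _ epq); have [_ _ hrsE] := eP _ _ (e_anti _ _ ers).
  have c' : cross [set vtx p; vtx q] [set vtx r; vtx s] by rewrite crossP.
  have := rank_two_pivot rE pqE rsE c' hpqE hrsE; rewrite !crossP //; try exact: e_anti.
  by rewrite z1 z2 /= crossing_antipode // cpq.
have [b1n b2n bE] := eP _ _ eb.
have cb' : cross [set vtx 0; vtx m] [set vtx b1; vtx b2] by rewrite crossP.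
have pivot p q r s : e p q -> e r s -> crossing p q r s =
    (crossing 0 m p q && crossing b1 b2 r s) (+) (crossing 0 m r s && crossing b1 b2 p q).
  move=> pq rs; have [_ _ pqE] := eP _ _ pq; have [_ _ rsE] := eP _ _ rs.
  by have := rank_two_pivot rE dE' bE cb' pqE rsE; rewrite !crossP.
have [R cR] := kE _ dE.
have Rh := diameter_cut N_even tE hE dE cR.
have Rr := reflection_cut tE fE (reflection_diam N_even) cR.
pose P v := R (vtx v) (+) R (vtx 0).
have e_lt p q : e p q -> p < 4 * x + 2 /\ q < 4 * x + 2 by case/eP.
(* By [reflection_cut], the cut along such an edge would take the same value at its two ends. *)
have e_noF v : e v (mirror x v) -> false.
  move=> /eP[vn _]; rewrite -reflection_vtx // => vE; have [S cS] := kE _ vE.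
  have h : [set reflection N (vtx v); reflection N (reflection N (vtx v))] = [set vtx v; reflection N (vtx v)].
    by rewrite reflectionK setUC.
  by have := cS _ _ vE; rewrite (reflection_cut tE fE h cS) !eqxx.
have P0 : P 0 = false by rewrite /P addbb.
have Ph v : v < 4 * x + 2 -> P (antipode x v) = ~~ P v.
  by move=> vn; rewrite /P -half_turn_vtx // Rh addNb.
have Pm v : v < 4 * x + 2 -> P (mirror x v) = P v.
  by move=> vn; rewrite /P -reflection_vtx // Rr.
have Pcut p q : e p q -> P p != P q -> (p = 0 /\ q = m) \/ (p = m /\ q = 0).
  move=> pq Ppq; have [pn qn pqE] := eP _ _ pq.
  have : R (vtx p) != R (vtx q).
    by move: Ppq; rewrite /P; case: (R (vtx p)) (R (vtx q)) (R (vtx 0)) => [] [] [].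
  have n0 := zero_lt_n; have nm := half_lt_n.
  rewrite cR // diamE => /eqP/set2_inj.
  case=> -[h1 h2].
    by left; rewrite (vtx_inj pn n0 h1) (vtx_inj qn nm h2).
  by right; rewrite (vtx_inj pn nm h1) (vtx_inj qn n0 h2).
have conn (S : nat -> bool) : (forall p q, e p q -> S p = S q) ->
    forall p, p < 4 * x + 2 -> S p = S 0.
  move=> iS p pn; have := cE (fun v => S v) _ (vtx p) (vtx 0).
  rewrite !vtxE //; last exact: zero_lt_n.
  by apply=> u v /eI; exact: iS.
have [d dx [h1 h2 h3 h4 h5]] := fold_structure e_lt e_sym e_anti e_mir eb cb pivot e_noF P0 Ph Pm Pcut conn.
exists d => //; exists e; split=> //.
move=> u w uw; have [un wn _] := eP _ _ uw; rewrite diamE => nd; apply: h2 => //.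
by case=> -[uE wE]; rewrite uE wE ?eqxx // setUC eqxx in nd.
Qed.
End Vertices.

(** * Unfolding a noncrossing tree into a dihedral one *)

Section Unfold.
Variable x : nat.
Local Notation N := (4 * x + 1).
Local Notation m := (2 * x + 1).
Local Notation V := 'I_(4 * x + 1).+1.

Lemma le_lt_n k : k <= x -> k < 4 * x + 2. Proof. lia. Qed.

(* For fixed s and t, the sheet over [0, x] is a tree isomorphic to the folded one;
   s tells the two components left by the diameter apart, and the sheets with the
   same s share the vertex over 0. *)
Definition sheet d (s t : bool) (k : 'I_x.+1) : V := vtx x (quarter x (s (+) (d < k)) t k).

Lemma sheetE d s t k : sheet d s t k = quarter x (s (+) (d < k)) t k :> nat.
Proof. by rewrite vtxE // quarter_lt // le_lt_n // -ltnS. Qed.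

Lemma sheet_inj d s t s' t' k k' : sheet d s t k = sheet d s' t' k' ->
  [/\ k = k', s = s' & t = t' \/ k = ord0].
Proof.
move=> /(congr1 (@nat_of_ord _)); rewrite !sheetE => /quarter_inj[]; try by rewrite -ltnS.
move=> /val_inj <- /addIb -> h; split=> //; case: h => [|h]; [by left | right].
exact/val_inj.
Qed.

Lemma sheet_cover d v : exists s t k, v = sheet d s t k.
Proof.
have vn : v < 4 * x + 2 by have := ltn_ord v; lia.
have [s [t [i [ix vi]]]] := quarter_cover vn.
have ix' : i < x.+1 by [].
exists (s (+) (d < i)), t, (Ordinal ix'); rewrite /sheet /= -addbA addbb addbF -vi.
by rewrite vtxK.
Qed.

Lemma half_turn_sheet d s t k : half_turn N m (sheet d s t k) = sheet d (~~ s) t k.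
Proof.
have kx : k < 4 * x + 2 by rewrite le_lt_n // -ltnS.
rewrite half_turn_vtx; last by exact: quarter_lt.
by rewrite -[antipode x _]/(quarter x true false _) quarterM // addTb -addNb.
Qed.

Lemma reflection_sheet d s t k : reflection N (sheet d s t k) = sheet d s (~~ t) k.
Proof.
have kx : k < 4 * x + 2 by rewrite le_lt_n // -ltnS.
rewrite reflection_vtx; last by exact: quarter_lt.
by rewrite -[mirror x _]/(quarter x false true _) quarterM // addTb addFb.
Qed.

Lemma sheet0 d s t : sheet d s t ord0 = vtx x (if s then m else 0).
Proof. by rewrite /sheet /= addbF; have [-> _] := quarter_diam x s t. Qed.

Lemma diam_sheet d : diam N m = [set sheet d false false ord0; sheet d true false ord0].
Proof. by rewrite diamE !sheet0. Qed.

Definition sheet_of d (v : V) := [exists t, exists k, v == sheet d true t k].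

Lemma sheet_ofE d s t k : sheet_of d (sheet d s t k) = s.
Proof.
apply/existsP/idP => [[t' /existsP[k' /eqP/sheet_inj[_ -> _]]]//|sT].
by exists t; apply/existsP; exists k; rewrite sT.
Qed.

Implicit Type Q : {set 'I_x.+1 * 'I_x.+1}.

Definition lift_edge d (s t : bool) (q : 'I_x.+1 * 'I_x.+1) : {set V} :=
  [set sheet d s t q.1; sheet d s t q.2].

Definition unfold_tree Q d : {set {set V}} :=
  diam N m |: [set lift_edge d st.1 st.2 q | q in Q, st in [set: bool * bool]].

Definition unfoldable Q d :=
  [/\ nctree 0 x Q, d < x & forall q, q \in Q -> q.1 = 0 :> nat -> q.2 <= d].

Lemma mem_unfold Q d (e : {set V}) :
  e \in unfold_tree Q d -> e = diam N m \/ exists s t q, q \in Q /\ e = lift_edge d s t q.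
Proof.
rewrite !inE => /orP[/eqP|/imset2P[q [s t] qQ _ ->]]; first by left.
by right; exists s, t, q.
Qed.

Lemma lift_edge_unfold Q d s t q : q \in Q -> lift_edge d s t q \in unfold_tree Q d.
Proof.
move=> qQ; rewrite !inE; apply/orP; right.
by apply/imset2P; exists q (s, t); rewrite // inE.
Qed.

Lemma diam_unfold Q d : diam N m \in unfold_tree Q d.
Proof. by rewrite !inE eqxx. Qed.

Lemma lift_edge_inj d s t s' t' (q r : 'I_x.+1 * 'I_x.+1) : q.1 < q.2 -> r.1 < r.2 ->
  lift_edge d s t q = lift_edge d s' t' r -> [/\ q = r, s = s' & t = t'].
Proof.
case: q r => [i j] [k l] /= ij kl /set2_inj[[/sheet_inj[ik ss h] /sheet_inj[jl _ h']]|].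
  move: ik jl h' => /= -> jl h'; split; [by rewrite jl | exact: ss | case: h' => // j0].
  by rewrite j0 in ij.
move=> [/sheet_inj[/= il _ _] /sheet_inj[/= jk _ _]].
by move: ij kl; rewrite il jk; lia.
Qed.

Lemma lift_edge_diam d s t q : lift_edge d s t q != diam N m.
Proof.
apply/eqP; rewrite (diam_sheet d) => /set2_inj[] [/sheet_inj[_ h _] /sheet_inj[_ h' _]];
by rewrite h in h'.
Qed.

Lemma sheet_of_cut Q d : cut_of (unfold_tree Q d) (diam N m) (sheet_of d).
Proof.
move=> u v /mem_unfold[uv|[s [t [q [qQ uv]]]]]; rewrite uv.
  rewrite eqxx; move: uv; rewrite (diam_sheet d) => /set2_inj[] [-> ->];
  by rewrite !sheet_ofE.
rewrite (negPf (lift_edge_diam d s t q)).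
by move: uv => /set2_inj[] [-> ->]; rewrite !sheet_ofE eqxx.
Qed.

Section Unfoldable.
Variables (Q : {set 'I_x.+1 * 'I_x.+1}) (d : nat).
Hypothesis QdU : unfoldable Q d.

Let ltQ q : q \in Q -> q.1 < q.2.
Proof. by case: QdU => -[h _ _ _] _ _ /h/and3P[]. Qed.

Lemma tree_unfold : tree_cuts (unfold_tree Q d).
Proof.
have [[_ _ cQ kQ] _ _] := QdU.
split.
- move=> e /mem_unfold[->|[s [t [q [qQ ->]]]]].
    rewrite (diam_sheet d) cards2; case: eqP => // /sheet_inj[]//.
  rewrite cards2; case: eqP => // /sheet_inj[h _ _].
  by have := ltQ qQ; rewrite h ltnn.
- move=> R iR.
  have R0 : R (sheet d false false ord0) = R (sheet d true false ord0).
    by apply: iR; rewrite -diam_sheet diam_unfold.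
  have Rs s t k : R (sheet d s t k) = R (sheet d s t ord0).
    apply: (cQ (fun k => R (sheet d s t k))) => //; last by rewrite leq0n -ltnS ltn_ord.
    by move=> q qQ; apply: iR; exact: lift_edge_unfold.
  have Rc v : R v = R (sheet d false false ord0).
    have [s [t [k ->]]] := sheet_cover d v; rewrite Rs.
    have -> : sheet d s t ord0 = sheet d s false ord0 by rewrite !sheet0.
    by case: s.
  by move=> u v; rewrite !Rc.
- move=> e /mem_unfold[->|[s [t [q [qQ ->]]]]]; first by exists (sheet_of d); exact: sheet_of_cut.
  (* The cut is normalized to vanish at 0, the only place where the sheet of [q] meets the rest of
     the tree, and is extended by [false] outside this sheet. *)
  have [R0 cR0] := kQ q qQ; pose R k := R0 k (+) R0 ord0.
  have cR r : r \in Q -> (R r.1 != R r.2) = (r == q).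
    by move=> /cR0 <-; rewrite /R; case: (R0 _) (R0 r.1) (R0 r.2) => [] [] [].
  have RZ : R ord0 = false by rewrite /R addbb.
  exists (fun v => [exists k, (v == sheet d s t k) && R k]).
  have GE s' t' k : [exists k', (sheet d s' t' k == sheet d s t k') && R k'] =
      [&& s' == s, t' == t & R k].
    apply/existsP/and3P => [[k' /andP[/eqP/sheet_inj[-> -> [->|->]]]]|[/eqP-> /eqP-> Rk]].
    - by rewrite !eqxx.
    - by rewrite RZ.
    - by exists k; rewrite eqxx.
  have G v w s' t' r : r \in Q -> [set v; w] = lift_edge d s' t' r ->
    ([exists k, (v == sheet d s t k) && R k] != [exists k, (w == sheet d s t k) && R k])
    = [&& s' == s, t' == t & r == q].
    move=> rQ /set2_inj[] [-> ->]; rewrite !GE -cR //.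
      by case: (s' == s) (t' == t) => [] [].
    by rewrite eq_sym; case: (s' == s) (t' == t) => [] [].
  move=> u v /mem_unfold[uv|[s' [t' [r [rQ uv]]]]].
    rewrite uv [diam _ _ == _]eq_sym (negPf (lift_edge_diam _ _ _ _)).
    by move: uv; rewrite (diam_sheet d) => /set2_inj[] [-> ->]; rewrite !GE RZ !andbF.
  rewrite (G _ _ _ _ _ rQ uv) uv; apply/and3P/eqP => [[/eqP-> /eqP-> /eqP->]//|].
  by move=> /(lift_edge_inj (ltQ rQ) (ltQ qQ))[-> -> ->]; rewrite !eqxx.
Qed.
End Unfoldable.
End Unfold.

Lemma map_edges_stable n (p : {perm 'I_n}) (E : {set {set 'I_n}}) :
  (forall e, e \in E -> [set p y | y in e] \in E) -> map_edges p E = E.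
Proof.
move=> pE; apply/eqP; rewrite eqEcard card_imset; last exact: imset_inj (@perm_inj _ p).
by rewrite leqnn andbT; apply/subsetP=> _ /imsetP[e eE ->]; exact: pE.
Qed.

Lemma cut_unique n (E : {set {set 'I_n}}) e R R' : tree_cuts E ->
  cut_of E e R -> cut_of E e R' -> forall u v, R u (+) R' u = R v (+) R' v.
Proof.
case=> _ cE _ cR cR'; apply: (cE (fun u => R u (+) R' u)) => u v uvE.
have := cR _ _ uvE; rewrite -(cR' _ _ uvE).
by case: (R u) (R v) (R' u) (R' v) => [] [] [] [].
Qed.

Section Bijection.
Variable x : nat.
Local Notation N := (4 * x + 1).
Local Notation m := (2 * x + 1).
Local Notation V := 'I_(4 * x + 1).+1.

Implicit Types Q : {set 'I_x.+1 * 'I_x.+1}.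

Lemma cross_diam_lift d s t (q : 'I_x.+1 * 'I_x.+1) :
  q.1 < q.2 -> (q.1 = 0 :> nat -> q.2 <= d) ->
  cross (diam N m) (lift_edge d s t q) = (q.1 <= d < q.2).
Proof.
move=> q12 q0; rewrite diamE crossE !sheetE !vtxE ?crossing_diam_quarter //.
- by rewrite -ltnS.
- exact: half_lt_n.
- exact: zero_lt_n.
Qed.

Lemma cross_lift d s t s' t' (q r : 'I_x.+1 * 'I_x.+1) : q.1 < q.2 -> r.1 < r.2 ->
  (q.1 = 0 :> nat -> q.2 <= d) -> (r.1 = 0 :> nat -> r.2 <= d) ->
  ~~ [&& q.1 < r.1, r.1 < q.2 & q.2 < r.2] -> ~~ [&& r.1 < q.1, q.1 < r.2 & r.2 < q.2] ->
  cross (lift_edge d s t q) (lift_edge d s' t' r) = [&& q.1 <= d < q.2, r.1 <= d < r.2 & t (+) t'].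
Proof.
move=> q12 r12 q0 r0 qr rq; rewrite crossE !sheetE crossing_quarter //; by rewrite -ltnS.
Qed.

Lemma unfold_dihedral Q d : unfoldable Q d -> unfold_tree Q d \in dihedral_trees N m.
Proof.
move=> QdU; have [[rQ ncQ cQ kQ] dx Q0] := QdU.
have ltQ q : q \in Q -> q.1 < q.2 by move=> /rQ/and3P[].
rewrite in_set in_central_trees diam_unfold andbT -andbA; apply/and3P; split.
- apply/genus_one_treesP; split; first exact: tree_unfold.
  (* Some edge passes over the threshold, otherwise [d < k] would separate 0 from [x]; its lift [b]
     is the second pivot. *)
  have [q qQ qd] : exists2 q, q \in Q & q.1 <= d < q.2.
    have [/existsP[q /andP[qQ qd]]|no] := boolP [exists q, (q \in Q) && (q.1 <= d < q.2)]; first by exists q.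
    exfalso; have := cQ (fun k : 'I_x.+1 => d < k) _ ord0 ord_max; rewrite /= leqnn dx => h.
    suff : false = true by []; apply: h => // q qQ; have := ltQ q qQ.
    have : ~~ (q.1 <= d < q.2) by apply: contraNN no => h; apply/existsP; exists q; rewrite qQ.
    by move=> /=; clear; lia.
  pose b := lift_edge d false false q.
  exists (diam N m), b; split.
  + exact: diam_unfold.
  + exact: lift_edge_unfold.
  + by rewrite cross_diam_lift ?ltQ //; exact: Q0.
  have cD s t r : r \in Q -> cross (diam N m) (lift_edge d s t r) = (r.1 <= d < r.2).
    by move=> rQ'; rewrite cross_diam_lift ?ltQ //; exact: Q0.
  have cL s t s' t' r r' : r \in Q -> r' \in Q ->
      cross (lift_edge d s t r) (lift_edge d s' t' r')
      = [&& r.1 <= d < r.2, r'.1 <= d < r'.2 & t (+) t'].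
    move=> rQ' rQ''; apply: cross_lift; [exact: ltQ | exact: ltQ | exact: Q0 | exact: Q0 | exact: ncQ | exact: ncQ].
  move=> e f /mem_unfold[->|[s [t [r [rQ' ->]]]]] /mem_unfold[->|[s' [t' [r' [rQ'' ->]]]]].
  + by rewrite !cross_irr.
  + by rewrite cross_irr (cross_sym b (diam N m)) !cD // qd andbT.
  + by rewrite cross_irr (cross_sym _ (diam N m)) (cross_sym b (diam N m)) !cD // qd !andbT addbF.
  + rewrite !cD // !cL // qd !andTb !addFb.
    by case: (r.1 <= d < r.2) (r'.1 <= d < r'.2) t t' => [] [] [] [].
- apply/eqP/map_edges_stable => e /mem_unfold[->|[s [t [q [qQ ->]]]]].
    by rewrite (@diam_sheet x d) imset2pt !half_turn_sheet setUC -(@diam_sheet x d) diam_unfold.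
  by rewrite imset2pt !half_turn_sheet; exact: lift_edge_unfold.
- apply/eqP/map_edges_stable => e /mem_unfold[->|[s [t [q [qQ ->]]]]].
    by rewrite -[X in X \in _]/[set reflection N y | y in diam N m] imset2pt (reflection_diam (N_even x)) diam_unfold.
  by rewrite imset2pt !reflection_sheet; exact: lift_edge_unfold.
Qed.

Lemma unfold_tree_inj Q d Q' d' : unfoldable Q d -> unfoldable Q' d' ->
  unfold_tree Q d = unfold_tree Q' d' -> Q = Q' /\ d = d'.
Proof.
move=> U U' eU.
have noLt (Q1 Q2 : {set 'I_x.+1 * 'I_x.+1}) d1 d2 : unfoldable Q1 d1 -> unfoldable Q2 d2 ->
    unfold_tree Q1 d1 = unfold_tree Q2 d2 -> ~~ (d1 < d2).
  move=> U1 U2 e12; apply/negP => d12.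
  have d2x : d2 < x.+1 by case: U2; lia.
  (* The vertex [d2] is on the side of 0 for the threshold [d2] but not for [d1], whereas the tree
     determines the two sides of the diameter. *)
  pose k := Ordinal d2x.
  have e1 : sheet d1 true false k = sheet d2 false false k by rewrite /sheet /= d12 ltnn.
  have c2 := @sheet_of_cut x Q2 d2; rewrite -e12 in c2.
  have := cut_unique (tree_unfold U1) (@sheet_of_cut x Q1 d1) c2 (sheet d1 true false k) (vtx x 0).
  rewrite sheet_ofE {1}e1 sheet_ofE.
  by have := @sheet_ofE x d1 false false ord0; have := @sheet_ofE x d2 false false ord0; rewrite !sheet0 => -> ->.
have dd : d = d' by have := noLt _ _ _ _ U U' eU; have := noLt _ _ _ _ U' U (esym eU); lia.
subst d'; split=> //.
have sub (Q1 Q2 : {set 'I_x.+1 * 'I_x.+1}) : unfoldable Q1 d -> unfoldable Q2 d ->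
    unfold_tree Q1 d = unfold_tree Q2 d -> Q1 \subset Q2.
  move=> [[r1 _ _ _] _ _] [[r2 _ _ _] _ _] e12; apply/subsetP=> q qQ.
  have := lift_edge_unfold d false false qQ; rewrite e12 => /mem_unfold[/eqP|[s [t [r [rQ]]]]].
    by rewrite (negPf (lift_edge_diam _ _ _ _)).
  have /and3P[_ q12 _] := r1 q qQ; have /and3P[_ r12 _] := r2 r rQ.
  by move=> /(lift_edge_inj q12 r12)[->].
by apply/eqP; rewrite eqEsubset (sub Q Q') // (sub Q' Q).
Qed.

Lemma unfold_tree_surj E : E \in dihedral_trees N m ->
  exists Q d, unfoldable Q d /\ E = unfold_tree Q d.
Proof.
move=> dE; have [d dx [e [eE h2 h3 h4 h5]]] := dihedral_structure dE.
move: dE; rewrite in_set in_central_trees => /andP[/and3P[/genus_one_treesP[tE _] /eqP hE DE] /eqP fE].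
have [sE _ kE] := tE.
have linkE (i j : 'I_x.+1) : link x e d i j = (lift_edge d false false (i, j) \in E).
  by rewrite /link eE !quarter_lt ?le_lt_n // -ltnS.
have link_sym i j : link x e d i j -> link x e d j i.
  by rewrite /link !eE setUC => /and3P[-> -> ->].
pose Q := [set q : 'I_x.+1 * 'I_x.+1 | (q.1 < q.2) && link x e d q.1 q.2].
have QE q : q \in Q -> q.1 < q.2 /\ lift_edge d false false q \in E.
  by case: q => i j; rewrite inE /= linkE => /andP.
have leq_x (i : 'I_x.+1) : i <= x by rewrite -ltnS.
exists Q, d; split.
  split=> //; last first.
    by case=> i j; rewrite inE /= => /andP[_ ij] i0; rewrite i0 in ij; exact: h5.
  split.
  - by move=> q /QE[-> _]; rewrite leq0n leq_x.
  - by case=> i j [k l]; rewrite !inE /= => /andP[_ ij] /andP[_ kl]; exact: h3.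
  - move=> R iR i j _ _.
    have RE (k : 'I_x.+1) : R k = R (inord 0).
      rewrite -{1}(inord_val k); apply: (h4 (fun k => R (inord k))) => // a b ax bx ab.
      have ax' : a < x.+1 by []. have bx' : b < x.+1 by [].
      rewrite -(@inordK x a) // -(@inordK x b) // in ab *; rewrite !inord_val.
      have [lt|gt|/val_inj -> //] := ltngtP (inord a : 'I_x.+1) (inord b : 'I_x.+1).
        by apply: (iR (inord a, inord b)); rewrite inE /= lt.
      by apply/esym/(iR (inord b, inord a)); rewrite inE /= gt; exact: link_sym.
    by rewrite !RE.
  - move=> q qQ; have [q12 qE] := QE q qQ; have [G cG] := kE _ qE.
    exists (fun k => G (sheet d false false k)) => r rQ; have [r12 rE] := QE r rQ.
    by rewrite (cG _ _ rE); apply/eqP/eqP => [/(lift_edge_inj r12 q12)[]|->].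
have lift_in s t q : lift_edge d false false q \in E -> lift_edge d s t q \in E.
  move=> qE.
  have H s' t' : lift_edge d s' t' q \in E -> lift_edge d (~~ s') t' q \in E.
    by rewrite /lift_edge -!half_turn_sheet -{2}hE mem_map_edges.
  have F s' t' : lift_edge d s' t' q \in E -> lift_edge d s' (~~ t') q \in E.
    by rewrite /lift_edge -!reflection_sheet -{2}fE mem_map_edges.
  case: s t => [] []; [exact: (H false true (F false false qE)) | exact: (H false false qE)
    | exact: (F false false qE) | exact: qE].
apply/eqP; rewrite eqEsubset; apply/andP; split; apply/subsetP => f; last first.
  by move=> /mem_unfold[->//|[s [t [q [/QE[_ qE] ->]]]]]; exact: lift_in.
move=> fE'; have [->|nd] := eqVneq f (diam N m); first exact: diam_unfold.
have /eqP/cards2P[u [w [uw fuw]]] := sE f fE'.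
have euw : e u w.
  by rewrite eE !vtxK -fuw fE' andbT; have un := ltn_ord u; have wn := ltn_ord w; clear -un wn; lia.
have [|s [t [i [j [ix jx ij uE wE]]]]] := h2 _ _ euw; first by rewrite !vtxK -fuw.
have ix' : i < x.+1 by []. have jx' : j < x.+1 by [].
have us : u = sheet d s t (Ordinal ix') by rewrite /sheet /= -uE vtxK.
have ws : w = sheet d s t (Ordinal jx') by rewrite /sheet /= -wE vtxK.
have [lt|gt|ij'] := ltngtP i j.
- by rewrite fuw us ws; apply: (lift_edge_unfold _ _ _ (q := (Ordinal ix', Ordinal jx'))); rewrite inE /= lt.
- rewrite fuw us ws setUC; apply: (lift_edge_unfold _ _ _ (q := (Ordinal jx', Ordinal ix'))).
  by rewrite inE /= gt; exact: link_sym.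
- by move: uw; rewrite us ws (_ : Ordinal ix' = Ordinal jx') ?eqxx //; exact/val_inj.
Qed.

Lemma card_dihedral_trees : #|dihedral_trees N m| =
  #|[set y : {set 'I_x.+1 * 'I_x.+1} * 'I_x | `[< unfoldable y.1 y.2 >]]|.
Proof.
pose g (y : {set 'I_x.+1 * 'I_x.+1} * 'I_x) := unfold_tree y.1 y.2.
rewrite -(card_in_imset (f := g)); last first.
  move=> [Q d] [Q' d']; rewrite !inE => /asboolP U /asboolP U' /(unfold_tree_inj U U')[/= -> dd].
  by congr pair; exact/val_inj.
apply: eq_card => E; apply/idP/imsetP => [/unfold_tree_surj[Q [d [U ->]]]|[[Q d]]].
  have dx : d < x by case: U.
  by exists (Q, Ordinal dx); rewrite // inE; apply/asboolP.
by rewrite inE => /asboolP U ->; exact: unfold_dihedral.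
Qed.

End Bijection.

(** * Counting noncrossing trees *)

Section Decomposition.
Variable M : nat.
Implicit Types Q : {set 'I_M * 'I_M}.

(** Meant for trees [Q1] on [A, d], [Q2] on [d + 1, c] and [Q3] on [c, b]. *)
Definition graft (A c : 'I_M) Q1 Q2 Q3 := (A, c) |: (Q1 :|: Q2 :|: Q3).

Lemma mem_graft A c Q1 Q2 Q3 (q : 'I_M * 'I_M) : q \in graft A c Q1 Q2 Q3 ->
  [\/ q = (A, c), q \in Q1, q \in Q2 | q \in Q3].
Proof.
by rewrite !inE => /orP[/eqP|/orP[/orP[]|]] h; [constructor 1|constructor 2|constructor 3|constructor 4].
Qed.

Lemma graft_edge A c Q1 Q2 Q3 : (A, c) \in graft A c Q1 Q2 Q3.
Proof. by rewrite !inE eqxx. Qed.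

Lemma graft1 A c Q1 Q2 Q3 (q : 'I_M * 'I_M) : q \in Q1 -> q \in graft A c Q1 Q2 Q3.
Proof. by rewrite !inE => ->; rewrite !orbT. Qed.

Lemma graft2 A c Q1 Q2 Q3 (q : 'I_M * 'I_M) : q \in Q2 -> q \in graft A c Q1 Q2 Q3.
Proof. by rewrite !inE => ->; rewrite !orbT. Qed.

Lemma graft3 A c Q1 Q2 Q3 (q : 'I_M * 'I_M) : q \in Q3 -> q \in graft A c Q1 Q2 Q3.
Proof. by rewrite !inE => ->; rewrite !orbT. Qed.

Lemma pair_neq (q r : 'I_M * 'I_M) : ((q.1 : nat) != r.1) || ((q.2 : nat) != r.2) -> (q == r) = false.
Proof. by case: q r => [i j] [k l] /=; rewrite xpair_eqE -!val_eqE /=; lia. Qed.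

Lemma graft_nctree (A c d : 'I_M) b Q1 Q2 Q3 : d < c <= b -> A <= d -> b < M ->
  nctree A d Q1 -> nctree d.+1 c Q2 -> nctree c b Q3 -> nctree A b (graft A c Q1 Q2 Q3).
Proof.
move=> /andP[dc cb] Ad bM [r1 n1 c1 k1] [r2 n2 c2 k2] [r3 n3 c3 k3].
split.
- by move=> q /mem_graft[->|/r1|/r2|/r3]; rewrite /=; lia.
- move=> q r /mem_graft[->|qQ|qQ|qQ] /mem_graft[->|rQ|rQ|rQ] /=.
  + lia.
  + by have := r1 r rQ; lia.
  + by have := r2 r rQ; lia.
  + by have := r3 r rQ; lia.
  + by have := r1 q qQ; lia.
  + exact: n1.
  + by have := r1 q qQ; have := r2 r rQ; lia.
  + by have := r1 q qQ; have := r3 r rQ; lia.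
  + by have := r2 q qQ; lia.
  + by have := r2 q qQ; have := r1 r rQ; lia.
  + exact: n2.
  + by have := r2 q qQ; have := r3 r rQ; lia.
  + by have := r3 q qQ; lia.
  + by have := r3 q qQ; have := r1 r rQ; lia.
  + by have := r3 q qQ; have := r2 r rQ; lia.
  + exact: n3.
- move=> R iR.
  have e0 : R A = R c := iR _ (graft_edge A c Q1 Q2 Q3).
  have e1 := c1 R (fun q qQ => iR q (graft1 A c Q2 Q3 qQ)).
  have e2 := c2 R (fun q qQ => iR q (graft2 A c Q1 Q3 qQ)).
  have e3 := c3 R (fun q qQ => iR q (graft3 A c Q1 Q2 qQ)).
  have RA (i : 'I_M) : A <= i <= b -> R i = R c.
    move=> ib; have [id|id] := leqP i d; first by rewrite -e0; apply: e1; lia.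
    by have [ic|ic] := leqP i c; [apply: e2 | apply: e3]; lia.
  by move=> i j iab jab; rewrite !RA.
- move=> q /mem_graft[->|qQ|qQ|qQ].
  (* Without [(A, c)] the components are [A, d] and [d + 1, b]. *)
  + exists (fun j : 'I_M => d < j) => r /mem_graft[->|rQ|rQ|rQ] /=.
    * by rewrite eqxx; lia.
    * by rewrite pair_neq /=; have := r1 r rQ; lia.
    * by rewrite pair_neq /=; have := r2 r rQ; lia.
    * by rewrite pair_neq /=; have := r3 r rQ; lia.
  + have [R cR] := k1 q qQ; have q12 := r1 q qQ.
    (* A cut of one part is extended to the others by its value at the vertex of attachment, [A]
       here and [c] in the next two cases. *)
    exists (fun j : 'I_M => if j <= d then R j else R A) => r /mem_graft[->|rQ|rQ|rQ] /=.
    * by rewrite if_same ifF ?eqxx ?pair_neq //=; lia.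
    * by rewrite -cR // !ifT //; have := r1 r rQ; lia.
    * by rewrite !ifF ?eqxx ?pair_neq //; have := r2 r rQ; lia.
    * by rewrite !ifF ?eqxx ?pair_neq //; have := r3 r rQ; lia.
  + have [R cR] := k2 q qQ; have q12 := r2 q qQ.
    exists (fun j : 'I_M => if d < j <= c then R j else R c) => r /mem_graft[->|rQ|rQ|rQ] /=.
    * by rewrite ifF ?if_same ?eqxx ?pair_neq //=; lia.
    * by rewrite !ifF ?eqxx ?pair_neq //; have := r1 r rQ; lia.
    * by rewrite -cR // !ifT //; have := r2 r rQ; lia.
    * have r12 := r3 r rQ; rewrite (@ifF _ (d < r.2 <= c)); last by lia.
      rewrite pair_neq; last by lia.
      case: ifP => h; last by rewrite eqxx.
      have -> : r.1 = c by apply: ord_inj; lia.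
      by rewrite eqxx.
  + have [R cR] := k3 q qQ; have q12 := r3 q qQ.
    exists (fun j : 'I_M => if c <= j then R j else R c) => r /mem_graft[->|rQ|rQ|rQ] /=.
    * by rewrite if_same ifF ?eqxx ?pair_neq //=; lia.
    * by rewrite !ifF ?eqxx ?pair_neq //; have := r1 r rQ; lia.
    * have r12 := r2 r rQ; rewrite (@ifF _ (c <= r.1)); last by lia.
      rewrite pair_neq; last by lia.
      case: ifP => h; last by rewrite eqxx.
      have -> : r.2 = c by apply: ord_inj; lia.
      by rewrite eqxx.
    * by rewrite -cR // !ifT //; have := r3 r rQ; lia.
Qed.

(** The edges of [Q1] at [A] end before [c], so [c] is the farthest neighbour of [A]. This recovers
    [c] from the graft and later counts the admissible thresholds. *)
Lemma graft_far (A c d : 'I_M) b Q1 Q2 Q3 e : d < c <= b -> A <= d ->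
  nctree A d Q1 -> nctree d.+1 c Q2 -> nctree c b Q3 ->
  [forall q in graft A c Q1 Q2 Q3, (q.1 == A) ==> (q.2 <= e)] = (c <= e).
Proof.
move=> dcb Ad [r1 _ _ _] [r2 _ _ _] [r3 _ _ _]; apply/forall_inP/idP.
  by move=> /(_ _ (graft_edge A c Q1 Q2 Q3)); rewrite /= eqxx.
move=> ce q /mem_graft[->|qQ|qQ|qQ]; apply/implyP => /=; rewrite -?val_eqE /=.
- by [].
- by have := r1 q qQ; lia.
- by have := r2 q qQ; lia.
- by have := r3 q qQ; lia.
Qed.

Section Parts.
Variables (A c d : 'I_M) (b : nat) (Q1 Q2 Q3 : {set 'I_M * 'I_M}).
Hypotheses (dcb : d < c <= b) (Ad : A <= d).
Hypotheses (t1 : nctree A d Q1) (t2 : nctree d.+1 c Q2) (t3 : nctree c b Q3).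

Lemma graft_part1 : Q1 = [set q in graft A c Q1 Q2 Q3 | q.2 <= d].
Proof.
have [[r1 _ _ _] [r2 _ _ _] [r3 _ _ _]] := And3 t1 t2 t3.
apply/setP=> -[i j]; rewrite [RHS]inE /=; apply/idP/andP.
  by move=> qQ; rewrite graft1 //; have /= := r1 _ qQ; lia.
move=> [/mem_graft[[-> ->]|//|qQ|qQ]] /=; first by lia.
  by have /= := r2 _ qQ; lia.
by have /= := r3 _ qQ; lia.
Qed.

Lemma graft_part2 : Q2 = [set q in graft A c Q1 Q2 Q3 | (d < q.1) && (q.2 <= c)].
Proof.
have [[r1 _ _ _] [r2 _ _ _] [r3 _ _ _]] := And3 t1 t2 t3.
apply/setP=> -[i j]; rewrite [RHS]inE /=; apply/idP/andP.
  by move=> qQ; rewrite graft2 //; have /= := r2 _ qQ; lia.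
move=> [/mem_graft[[-> ->]|qQ|//|qQ]] /=; first by lia.
  by have /= := r1 _ qQ; lia.
by have /= := r3 _ qQ; lia.
Qed.

Lemma graft_part3 : Q3 = [set q in graft A c Q1 Q2 Q3 | c <= q.1].
Proof.
have [[r1 _ _ _] [r2 _ _ _] [r3 _ _ _]] := And3 t1 t2 t3.
apply/setP=> -[i j]; rewrite [RHS]inE /=; apply/idP/andP.
  by move=> qQ; rewrite graft3 //; have /= := r3 _ qQ; lia.
move=> [/mem_graft[[-> ->]|qQ|qQ|//]] /=; first by lia.
  by have /= := r1 _ qQ; lia.
by have /= := r2 _ qQ; lia.
Qed.

End Parts.

Lemma graft_inj (A c d c' d' : 'I_M) b Q1 Q2 Q3 Q1' Q2' Q3' :
  d < c <= b -> A <= d -> nctree A d Q1 -> nctree d.+1 c Q2 -> nctree c b Q3 ->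
  d' < c' <= b -> A <= d' -> nctree A d' Q1' -> nctree d'.+1 c' Q2' -> nctree c' b Q3' ->
  graft A c Q1 Q2 Q3 = graft A c' Q1' Q2' Q3' ->
  [/\ c = c', d = d', Q1 = Q1', Q2 = Q2' & Q3 = Q3'].
Proof.
move=> dcb Ad t1 t2 t3 dcb' Ad' t1' t2' t3' eJ.
have cc : c = c'.
  have h e := graft_far e dcb Ad t1 t2 t3.
  have h' e := graft_far e dcb' Ad' t1' t2' t3'.
  rewrite eJ in h.
  by apply/val_inj/anti_leq; rewrite /= -h h' leqnn -h' h leqnn.
subst c'.
(* If [d1 < d2], an edge of the tree on [A, d2] would pass over [d1]; in the other decomposition
   only [(A, c)] does, and it ends beyond [d2]. *)
have noLt (d1 d2 : 'I_M) P1 P2 P3 P1' P2' P3' : d1 < c <= b -> A <= d1 ->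
    nctree A d1 P1 -> nctree d1.+1 c P2 -> nctree c b P3 -> d2 < c <= b -> A <= d2 ->
    nctree A d2 P1' -> graft A c P1 P2 P3 = graft A c P1' P2' P3' -> ~~ (d1 < d2).
  move=> d1c Ad1 [r1 _ _ _] [r2 _ _ _] [r3 _ _ _] d2c Ad2 [r1' _ c1' _] eJ'; apply/negP => d12.
  have := c1' (fun j : 'I_M => d1 < j) _ A d2; rewrite leqnn Ad2 leqnn d12 (ltnNge d1) Ad1 => h.
  suff : false = true by []; apply: h => // q qQ.
  have q12 := r1' q qQ.
  have := graft1 A c P2' P3' qQ; rewrite -eJ' => /mem_graft[qe|qP|qP|qP].
  - by move: q12; rewrite qe /=; lia.
  - by have := r1 q qP; lia.
  - by have := r2 q qP; lia.
  - by have := r3 q qP; lia.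
have dd : d = d'.
  apply/val_inj => /=; have := noLt _ _ _ _ _ _ _ _ dcb Ad t1 t2 t3 dcb' Ad' t1' eJ.
  by have := noLt _ _ _ _ _ _ _ _ dcb' Ad' t1' t2' t3' dcb Ad t1 (esym eJ); lia.
subst d'; split=> //.
- by rewrite (graft_part1 dcb Ad t1 t2 t3) (graft_part1 dcb' Ad t1' t2' t3') eJ.
- by rewrite (graft_part2 dcb Ad t1 t2 t3) (graft_part2 dcb' Ad t1' t2' t3') eJ.
- by rewrite (graft_part3 dcb Ad t1 t2 t3) (graft_part3 dcb' Ad t1' t2' t3') eJ.
Qed.

Local Ltac olia := repeat match goal with
  | H : context [in_mem] |- _ => clear H
  | H : @eq bool _ _ |- _ => clear H
  | H : forall _, _ |- _ => clear H
  | H : is_true ?b |- _ =>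
      lazymatch b with context [leq] => fail | context [eq_op] => fail | _ => clear H end
  end; lia.

(* c is the farthest neighbour of A, and d the last vertex that is not connected
   to c within [A, c] without the edge (A, c). *)
Lemma nctree_split (A : 'I_M) b Q : A < b < M -> nctree A b Q -> exists c d : 'I_M, exists Q1 Q2 Q3,
  [/\ A <= d < c, c <= b, [/\ nctree A d Q1, nctree d.+1 c Q2 & nctree c b Q3]
    & Q = graft A c Q1 Q2 Q3].
Proof.
move=> /andP[Ab bM] [rQ nQ cQ kQ].
have [q0 q0Q q0A] : exists2 q : 'I_M * 'I_M, q \in Q & q.1 = A.
  have [/existsP[q /andP[qQ /eqP qA]]|no] := boolP [exists q : 'I_M * 'I_M, (q \in Q) && (q.1 == A)].
    by exists q.
  have := cQ (fun j => j == A) _ A (Ordinal bM); rewrite eqxx leqnn (ltnW Ab) leqnn => h.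
  suff : true = (Ordinal bM == A) by rewrite -val_eqE /=; olia.
  apply: h => // q qQ; have q12 := rQ q qQ.
  have -> : (q.1 == A) = false.
    by apply: contraNF no => qA; apply/existsP; exists q; rewrite qQ.
  by apply/esym; rewrite -val_eqE /=; olia.
pose far (c : 'I_M) := (A, c) \in Q.
have far0 : far q0.2 by rewrite /far -q0A -surjective_pairing.
case: (@arg_maxnP _ q0.2 far val far0) => c cF cmax.
have Acb : A < c <= b by have := rQ _ cF; rewrite /=; olia.
(* [S] tells the component of [c] from that of [A] once the edge [(A, c)] is removed. *)
have [R0 cR0] := kQ _ cF; pose S j := R0 j (+) R0 A.
have cS q : q \in Q -> (S q.1 != S q.2) = (q == (A, c)).
  by move=> /cR0 <-; rewrite /S; case: (R0 _) (R0 q.1) (R0 q.2) => [] [] [].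
have SA : S A = false by rewrite /S addbb.
have Sc : S c = true by have := cS _ cF; rewrite /= eqxx SA; case: (S c).
pose low (j : 'I_M) := (A <= j < c) && ~~ S j.
have lowA : low A by rewrite /low leqnn SA; olia.
case: (@arg_maxnP _ A low val lowA) => d /andP[dAc Sd] dmax.
have side (q : 'I_M * 'I_M) : q \in Q -> q != (A, c) -> S q.1 = S q.2.
  by move=> /cS h /negPf qn; apply/eqP; rewrite -[_ == _]negbK h qn.
(* Suppose [S i]. An edge of the side of [A] passing over [i] below [c] would cut [i] off from [A]
   (function [U]); without such an edge, [d] is cut off from [A] (function [T]). *)
have Slow (i : 'I_M) : A <= i <= d -> S i = false.
  move=> id; apply/negbTE/negP => Si.
  have iA : i != A by apply: contraTneq Si => ->; rewrite SA.
  have id' : i != d by apply: contraTneq Si => ->.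
  have lid : (A < i < d)%N by move: iA id'; rewrite -!val_eqE /=; olia.
  have neS (j : 'I_M) : S j = false -> (j : nat) != i.
    by move=> Sj; apply: contraTneq Si => /ord_inj <-; rewrite Sj.
  have [/existsP[[q1 q2] /and5P[/= qQ qi iq qc qS]]|no] := boolP [exists q : 'I_M * 'I_M,
      [&& q \in Q, q.1 < i, i < q.2, q.2 < c & ~~ S q.1]].
    have /= q12 := rQ _ qQ.
    have qn : (q1, q2) != (A, c) by apply/eqP => -[_ qe]; move: qc; rewrite qe ltnn.
    have Sq2 : S q2 = false by rewrite -(side _ qQ qn); exact/negbTE.
    pose U (j : 'I_M) := S j && (q1 < j < q2).
    have : U A = U i.
      apply: cQ; try olia; move=> r rQ'; have r12 := rQ r rQ'.
      have [re|rn] := eqVneq r (A, c); first by rewrite re /U /= SA; olia.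
      rewrite /U -(side r rQ' rn); case Sr: (S r.1) => //=.
      have Sr2 : S r.2 by rewrite -(side r rQ' rn) Sr.
      have neq (j k : 'I_M) : S j -> S k = false -> (j : nat) != k.
        by move=> Sj Sk; apply: contraTneq Sj => /ord_inj ->; rewrite Sk.
      have := (nQ _ r qQ rQ'); have := (nQ r _ rQ' qQ).
      have := neq _ _ Sr (negbTE qS); have := neq _ _ Sr2 (negbTE qS).
      have := neq _ _ Sr Sq2; have := neq _ _ Sr2 Sq2.
      clear -r12 q12 => /=; olia.
    by rewrite /U SA Si qi iq.
  pose T (j : 'I_M) := ~~ S j && (i < j < c).
  have : T A = T d.
    apply: cQ; try olia; move=> r rQ'; have r12 := rQ r rQ'.
    have [re|rn] := eqVneq r (A, c); first by rewrite re /T /= Sc; olia.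
    rewrite /T -side //; case Sr: (S r.1) => //=.
    have Sr2 : S r.2 = false by rewrite -side ?Sr.
    have r1i := neS _ Sr; have r2i := neS _ Sr2.
    have r2c : (r.2 : nat) != c by apply: contraTneq Sc => /ord_inj <-; rewrite Sr2.
    have : ~~ [&& r.1 < i, i < r.2 & r.2 < c].
      apply: contraNN no => h; apply/existsP; exists r; rewrite rQ' Sr /=; olia.
    have := nQ _ _ cF rQ'; rewrite /=.
    clear -r12 r1i r2i r2c lid Acb dAc; olia.
  by rewrite /T SA Sd; olia.
have Shigh (i : 'I_M) : d < i <= c -> S i.
  move=> dic; apply/negPn/negP => Si.
  have ic : (i : nat) != c by apply: contraNneq Si => /ord_inj ->; rewrite Sc.
  have : low i by rewrite /low Si andbT; olia.
  by move/dmax => /=; olia.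
(* An edge that starts before [c] and ends after it must start at [A], as it does not cross
   [(A, c)]; the maximality of [c] excludes this. *)
have class (q : 'I_M * 'I_M) : q \in Q -> [\/ q = (A, c), q.2 <= d, (d < q.1) && (q.2 <= c) | c <= q.1].
  move=> qQ; have q12 := rQ q qQ.
  have [->|qn] := eqVneq q (A, c); first by constructor 1.
  have [qc|qc] := leqP c q.1; first by constructor 4.
  have [q2c|q2c] := leqP q.2 c; last first.
    have := nQ _ _ cF qQ; rewrite /= qc q2c !andbT -leqNgt => qA.
    have qA' : q.1 = A by apply: ord_inj; olia.
    have : far q.2 by rewrite /far -qA' -surjective_pairing.
    by move/cmax => /=; olia.
  have [qd|qd] := leqP q.2 d; first by constructor 2.
  have S2 : S q.2 by apply: Shigh; olia.
  constructor 3; rewrite andbT ltnNge; apply/negP => q1d.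
  have : S q.1 = false by apply: Slow; olia.
  by rewrite side // S2.
pose Q1 := [set q : 'I_M * 'I_M in Q | q.2 <= d].
pose Q2 := [set q : 'I_M * 'I_M in Q | (d < q.1) && (q.2 <= c)].
pose Q3 := [set q : 'I_M * 'I_M in Q | c <= q.1].
have sub (P : pred ('I_M * 'I_M)) a' b' : 
    (forall q : 'I_M * 'I_M, q \in Q -> P q -> a' <= q.1 /\ q.2 <= b') ->
    (forall R : 'I_M -> bool, (forall q : 'I_M * 'I_M, q \in Q -> P q -> R q.1 = R q.2) ->
      forall i j : 'I_M, a' <= i <= b' -> a' <= j <= b' -> R i = R j) ->
    nctree a' b' [set q : 'I_M * 'I_M in Q | P q].
  move=> rP cP; split.
  - by move=> q; rewrite inE => /andP[qQ /(rP q qQ)[h1 h2]]; have := rQ q qQ; olia.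
  - by move=> q r; rewrite !inE => /andP[qQ _] /andP[rQ' _]; exact: nQ.
  - by move=> R iR; apply: cP => q qQ Pq; apply: iR; rewrite inE qQ.
  - move=> q; rewrite inE => /andP[qQ _]; have [R cR] := kQ q qQ; exists R => r.
    by rewrite inE => /andP[rQ' _]; exact: cR.
exists c, d, Q1, Q2, Q3; split; [by [] | by case/andP: Acb | split |].
- apply: sub => [q qQ /= h|R iR i j iad jad]; first by have q12 := rQ q qQ; olia.
  pose R' (j : 'I_M) := if j <= d then R j else R A.
  suff : R' i = R' j by rewrite /R' !ifT //; olia.
  apply: cQ; try olia; move=> q qQ; rewrite /R'; have q12 := rQ q qQ.
  have [->|h|h|h] := class q qQ => /=.
  + by rewrite if_same ifF //; olia.
  + by rewrite !ifT //; [exact: iR | olia].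
  + by rewrite !ifF //; olia.
  + by rewrite !ifF //; olia.
- apply: sub => [q qQ /= h|R iR i j iad jad]; first by have q12 := rQ q qQ; olia.
  pose R' (j : 'I_M) := if d < j <= c then R j else R c.
  suff : R' i = R' j by rewrite /R' !ifT //; olia.
  apply: cQ; try olia; move=> q qQ; rewrite /R'; have q12 := rQ q qQ.
  have [->|h|h|h] := class q qQ => /=.
  + by rewrite if_same ifF //; olia.
  + by rewrite !ifF //; olia.
  + by rewrite !ifT //; [exact: iR | olia | olia].
  + rewrite (@ifF _ (d < q.2 <= c)); last by olia.
    by case: ifP => // ?; congr R; apply: ord_inj; olia.
- apply: sub => [q qQ /= h|R iR i j iad jad]; first by have q12 := rQ q qQ; olia.
  pose R' (j : 'I_M) := if c <= j then R j else R c.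
  suff : R' i = R' j by rewrite /R' !ifT //; olia.
  apply: cQ; try olia; move=> q qQ; rewrite /R'; have q12 := rQ q qQ.
  have [->|h|h|h] := class q qQ => /=.
  + by rewrite if_same ifF //; olia.
  + by rewrite !ifF //; olia.
  + rewrite (@ifF _ (c <= q.1)); last by olia.
    by case: ifP => // ?; congr R; apply: ord_inj; olia.
  + by rewrite !ifT //; [exact: iR | olia].
- apply/setP=> q; apply/idP/idP => [qQ|/mem_graft[->//|||]]; try by rewrite inE => /andP[].
  have [->|h|h|h] := class q qQ.
  + exact: graft_edge.
  + by apply: graft1; rewrite inE qQ.
  + by apply: graft2; rewrite inE qQ.
  + by apply: graft3; rewrite inE qQ.
Qed.
End Decomposition.

Definition nctrees M a b : {set {set 'I_M * 'I_M}} := [set Q | `[< nctree a b Q >]].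

Lemma nctreesP M a b (Q : {set 'I_M * 'I_M}) : reflect (nctree a b Q) (Q \in nctrees M a b).
Proof. by rewrite inE; exact: asboolP. Qed.

Lemma card_nctrees_point M a : #|nctrees M a a| = 1.
Proof.
suff -> : nctrees M a a = [set set0] by rewrite cards1.
apply/setP=> Q; rewrite in_set1; apply/nctreesP/eqP => [[rQ _ _ _]|->].
  by apply/setP=> q; rewrite in_set0; apply/negP => /rQ; lia.
split; try by move=> q; rewrite in_set0.
by move=> R _ i j ia ja; congr R; apply: ord_inj; lia.
Qed.

(** The weight [F] is 1 for counting trees, and the number of thresholds compatible with [Q] for
    counting pairs. *)
Lemma sum_nctrees M (A : 'I_M) b (F : {set 'I_M * 'I_M} -> nat) : A < b < M ->
  \sum_(Q in nctrees M A b) F Q =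
  \sum_(cd : 'I_M * 'I_M | (A <= cd.2 < cd.1) && (cd.1 <= b))
    \sum_(z in setX (setX (nctrees M A cd.2) (nctrees M cd.2.+1 cd.1)) (nctrees M cd.1 b))
      F (graft A cd.1 z.1.1 z.1.2 z.2).
Proof.
move=> AbM; have /andP[_ bM] := AbM.
rewrite pair_big_dep /=.
pose g (y : ('I_M * 'I_M) * ({set 'I_M * 'I_M} * {set 'I_M * 'I_M} * {set 'I_M * 'I_M})) :=
  graft A y.1.1 y.2.1.1 y.2.1.2 y.2.2.
pose S := [set y : ('I_M * 'I_M) * ({set 'I_M * 'I_M} * {set 'I_M * 'I_M} * {set 'I_M * 'I_M}) |
  (A <= y.1.2 < y.1.1) && (y.1.1 <= b) &&
  (y.2 \in setX (setX (nctrees M A y.1.2) (nctrees M y.1.2.+1 y.1.1)) (nctrees M y.1.1 b))].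
have SP y : y \in S -> [/\ y.1.2 < y.1.1 <= b, A <= y.1.2, nctree A y.1.2 y.2.1.1,
    nctree y.1.2.+1 y.1.1 y.2.1.2 & nctree y.1.1 b y.2.2].
  rewrite !inE => /andP[/andP[/andP[h1 h2] h3] /andP[/andP[/asboolP t1 /asboolP t2] /asboolP t3]].
  by rewrite h1 h2 h3.
have gS : nctrees M A b = g @: S.
  apply/setP=> Q; apply/nctreesP/imsetP.
    move=> /(nctree_split AbM)[c [d [Q1 [Q2 [Q3 [h1 h2 [t1 t2 t3] ->]]]]]].
    exists ((c, d), (Q1, Q2, Q3)) => //; rewrite !inE /= h1 h2 /=.
    by apply/andP; split; [apply/andP; split|]; apply/asboolP.
  by case=> y /SP[h1 h2 t1 t2 t3] ->; exact: (graft_nctree h1 h2 bM t1 t2 t3).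
have ginj : {in S &, injective g}.
  move=> [[c d] [[Q1 Q2] Q3]] [[c' d'] [[Q1' Q2'] Q3']] /SP[/= h1 h2 t1 t2 t3] /SP[/= h1' h2' t1' t2' t3'].
  by move=> /(graft_inj h1 h2 t1 t2 t3 h1' h2' t1' t2' t3')[-> -> -> -> ->].
rewrite gS big_imset //=; apply: eq_bigl => y.
by rewrite inE.
Qed.

Lemma sum_ord_interval M u v (H : nat -> nat) : v <= M ->
  \sum_(c < M | u <= c < v) H c = \sum_(i < v - u) H (u + i).
Proof.
move=> vM; rewrite -(big_mkord (fun c => u <= c < v) H).
have -> : \sum_(0 <= c < M | u <= c < v) H c = \sum_(u <= c < v) H c.
  rewrite (big_nat_widen u v M) // (big_nat_widenl u 0) //.
  by apply: eq_bigl => c; rewrite andbC.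
rewrite -{1}(add0n u) big_addn big_mkord.
by apply: eq_bigr => i _; rewrite addnC.
Qed.

Lemma sum_cd_interval M (A : 'I_M) k (G : nat -> nat -> nat) : A + k.+1 < M ->
  \sum_(cd : 'I_M * 'I_M | (A <= cd.2 < cd.1) && (cd.1 <= A + k.+1)) G cd.1 cd.2 =
  \sum_(j < k.+1) \sum_(i < j.+1) G (A + j.+1) (A + i).
Proof.
move=> kM.
rewrite (eq_bigl (fun cd : 'I_M * 'I_M => (A.+1 <= cd.1 < (A + k.+1).+1) && (A <= cd.2 < cd.1))); last first.
  by move=> [c d] /=; lia.
rewrite -(pair_big_dep (fun c : 'I_M => A.+1 <= c < (A + k.+1).+1)
  (fun c d : 'I_M => A <= d < c) (fun c d : 'I_M => G c d)) /=.
rewrite (eq_bigr (fun c : 'I_M => \sum_(i < c - A) G c (A + i))); last first.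
  by move=> c _; rewrite (sum_ord_interval A (G c)) // ltnW.
rewrite (sum_ord_interval A.+1 (fun c => \sum_(i < c - A) G c (A + i))) //.
have -> : (A + k.+1).+1 - A.+1 = k.+1 by lia.
apply: eq_bigr => j _; have -> : A.+1 + j = A + j.+1 by lia.
by have -> : A + j.+1 - A = j.+1 by lia.
Qed.

Lemma card_nctrees_rec M (A : 'I_M) k : A + k.+1 < M ->
  #|nctrees M A (A + k.+1)| = \sum_(j < k.+1) \sum_(i < j.+1)
    #|nctrees M A (A + i)| * #|nctrees M (A + i).+1 (A + j.+1)| * #|nctrees M (A + j.+1) (A + k.+1)|.
Proof.
move=> kM; rewrite -sum1_card sum_nctrees; last by lia.
rewrite -(sum_cd_interval (fun c d => #|nctrees M A d| * #|nctrees M d.+1 c| * #|nctrees M c (A + k.+1)|)) //.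
by apply: eq_bigr => cd _; rewrite sum1_card !cardsX.
Qed.

(** The number of noncrossing trees with [k] edges: 1, 1, 3, 12, 55, ... *)
Definition nct k := #|nctrees k.+1 0 k|.

(** By induction on the length: the recursion involves shorter intervals only, and its form does not
    depend on the position. *)
Lemma card_nctrees k M a : a + k < M -> #|nctrees M a (a + k)| = nct k.
Proof.
elim/ltn_ind: k M a => -[|k] IH M a akM; first by rewrite addn0 /nct !card_nctrees_point.
have aM : a < M by lia.
have E M' (A : 'I_M') : A + k.+1 < M' -> #|nctrees M' A (A + k.+1)| =
    \sum_(j < k.+1) \sum_(i < j.+1) nct i * nct (j - i) * nct (k - j).
  move=> h; rewrite card_nctrees_rec //; apply: eq_bigr => -[j jk] _; apply: eq_bigr => -[i /= ij] _ /=.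
  congr (_ * _ * _).
  - by apply: IH; lia.
  - have -> : A + j.+1 = (A + i).+1 + (j - i) by lia.
    by apply: IH; lia.
  - have -> : A + k.+1 = A + j.+1 + (k - j) by lia.
    by apply: IH; lia.
by rewrite (E M (Ordinal aM)) // /nct -(E k.+2 ord0) ?add0n.
Qed.

Lemma nct0 : nct 0 = 1.
Proof. exact: card_nctrees_point. Qed.

Lemma nctS k : nct k.+1 = \sum_(j < k.+1) \sum_(i < j.+1) nct i * nct (j - i) * nct (k - j).
Proof.
rewrite {1}/nct; have := @card_nctrees_rec k.+2 ord0 k; rewrite /= !add0n => -> //.
apply: eq_bigr => -[j jk] _; apply: eq_bigr => -[i /= ij] _ /=; rewrite !add0n.
congr (_ * _ * _).
- by rewrite -(@card_nctrees i k.+2 0) // add0n; lia.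
- have e : i.+1 + (j - i) = j.+1 by lia.
  by have := @card_nctrees (j - i) k.+2 i.+1; rewrite e; apply; lia.
- have e : j.+1 + (k - j) = k.+1 by lia.
  by have := @card_nctrees (k - j) k.+2 j.+1; rewrite e; apply; lia.
Qed.

(** If [j + 1] is the farthest neighbour of 0, the admissible thresholds are those in [j + 1, k],
    whence the factor [k - j]. *)
Lemma card_unfoldable k :
  #|[set y : {set 'I_k.+2 * 'I_k.+2} * 'I_k.+1 | `[< unfoldable y.1 y.2 >]]| =
  \sum_(j < k.+1) \sum_(i < j.+1) nct i * nct (j - i) * nct (k - j) * (k - j).
Proof.
pose far (Q : {set 'I_k.+2 * 'I_k.+2}) (d : nat) := [forall q in Q, (q.1 == ord0) ==> (q.2 <= d)].
rewrite -sum1_card.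
rewrite (eq_bigl (fun y : {set 'I_k.+2 * 'I_k.+2} * 'I_k.+1 =>
   (y.1 \in nctrees k.+2 (@ord0 k.+1) k.+1) && far y.1 y.2)); last first.
  move=> [Q d]; rewrite inE /=; apply/asboolP/andP.
    move=> [tQ _ Qd]; split; first exact/nctreesP.
    by apply/forall_inP => q qQ; apply/implyP => /eqP q0; apply: Qd; rewrite // q0.
  move=> [/nctreesP tQ /forall_inP Qd]; split=> //.
  by move=> q qQ q0; apply: (implyP (Qd q qQ)); apply/eqP/ord_inj.
rewrite -(pair_big_dep (fun Q : {set 'I_k.+2 * 'I_k.+2} => Q \in nctrees k.+2 (@ord0 k.+1) k.+1)
  (fun (Q : {set 'I_k.+2 * 'I_k.+2}) (d : 'I_k.+1) => far Q d) (fun _ _ => 1)) /=.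
rewrite (@sum_nctrees k.+2 ord0); last by rewrite ltnSn.
have step (cd : 'I_k.+2 * 'I_k.+2) : (0 <= cd.2 < cd.1) && (cd.1 <= k.+1) ->
  \sum_(z in setX (setX (nctrees k.+2 0 cd.2) (nctrees k.+2 cd.2.+1 cd.1)) (nctrees k.+2 cd.1 k.+1))
    \sum_(d < k.+1 | far (graft ord0 cd.1 z.1.1 z.1.2 z.2) d) 1 =
  nct cd.2 * nct (cd.1 - cd.2.+1) * nct (k.+1 - cd.1) * (k.+1 - cd.1).
  case: cd => c d /= /andP[dc cx].
  rewrite (eq_bigr (fun=> k.+1 - c)); last first.
    move=> [[Q1 Q2] Q3] /=; rewrite !inE /= => /andP[/andP[/asboolP t1 /asboolP t2] /asboolP t3].
    rewrite (eq_bigl (fun e : 'I_k.+1 => c <= e < k.+1)); last first.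
      move=> e; rewrite ltn_ord andbT /far (@graft_far _ ord0 c d k.+1) // dc; exact: cx.
    by rewrite (sum_ord_interval c (fun=> 1)) // sum_nat_const card_ord muln1.
  rewrite sum_nat_const !cardsX; congr (_ * _ * _ * _).
  - by have := @card_nctrees d k.+2 0; rewrite add0n; apply; exact: ltn_ord.
  - have e : d.+1 + (c - d.+1) = c by lia.
    by have := @card_nctrees (c - d.+1) k.+2 d.+1; rewrite e; apply; exact: ltn_ord.
  - have e : c + (k.+1 - c) = k.+1 by lia.
    by have := @card_nctrees (k.+1 - c) k.+2 c; rewrite e; apply.
apply: (etrans (eq_bigr _ step)).
have := @sum_cd_interval k.+2 ord0 k (fun c d => nct d * nct (c - d.+1) * nct (k.+1 - c) * (k.+1 - c)).
by rewrite /= !add0n => -> //.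
Qed.

(** * Parity of the counts *)

Lemma odd_sum n (F : 'I_n -> nat) :
  odd (\sum_(i < n) F i) = \big[addb/false]_(i < n) odd (F i).
Proof. by apply: big_morph; [exact: oddD|]. Qed.

(* The terms i and k - i cancel. *)
Lemma big_addb_swap (f : nat -> bool) k :
  \big[addb/false]_(i < k.+1) (f i && f (k - i)) = ~~ odd k && f k./2.
Proof.
have [n] := ubnP k; elim: n k f => // n IH [|[|k]] f kn.
- by rewrite big_ord_recl big_ord0 /= addbF andbb.
- by rewrite !big_ord_recl big_ord0 /= addbF [f 1 && _]andbC addbb.
rewrite big_ord_recl big_ord_recr /= subn0 /bump /= !add1n subnn.
rewrite [f k.+2 && _]andbC [X in _ (+) X]addbC addbA addbb addFb.
have := IH k (fun i => f i.+1); rewrite /= negbK => <-; last by lia.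
apply: eq_bigr => -[i ik] _ /=; rewrite /bump /= add1n.
by rewrite (_ : k.+2 - i.+1 = (k - i).+1) //; lia.
Qed.

Lemma big_addb_even (F : nat -> nat -> bool) w :
  \big[addb/false]_(j < w.+1) (~~ odd j && F j./2 j) = \big[addb/false]_(i < w./2.+1) F i i.*2.
Proof.
elim: w => [|w IH]; first by rewrite !big_ord_recl !big_ord0.
rewrite big_ord_recr IH /= negbK uphalf_half; case: (boolP (odd w)) => ow /=; last by rewrite addbF.
rewrite add1n [RHS]big_ord_recr /=; congr (_ (+) F _ _).
by have := odd_double_half w; rewrite ow -muln2; lia.
Qed.

Definition nct_odd k := odd (nct k).

(** Exchanging the first two factors leaves the terms [j = 2 * i], and a square has the parity of
    its root. For the generating series modulo 2 this reads [T(z) = 1 + z T(z^2) T(z)]. *)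
Lemma nct_oddS k :
  nct_odd k.+1 = \big[addb/false]_(i < k./2.+1) (nct_odd i && nct_odd (k - i.*2)).
Proof.
rewrite -(big_addb_even (fun i j => nct_odd i && nct_odd (k - j))).
rewrite /nct_odd nctS odd_sum; apply: eq_bigr => j _.
rewrite odd_sum andbA -(big_addb_swap nct_odd) (big_morph (andb^~ _) (id1 := false) (op1 := addb)) //.
  by apply: eq_bigr => i _; rewrite !oddM.
by move=> a b; rewrite andb_addl.
Qed.

Lemma odd_card_unfoldable k :
  odd #|[set y : {set 'I_k.+2 * 'I_k.+2} * 'I_k.+1 | `[< unfoldable y.1 y.2 >]]| =
  \big[addb/false]_(i < k./2.+1) (nct_odd i && (nct_odd (k - i.*2) && odd (k - i.*2))).
Proof.
rewrite card_unfoldable.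
rewrite -(big_addb_even (fun i j => nct_odd i && (nct_odd (k - j) && odd (k - j)))).
rewrite odd_sum; apply: eq_bigr => j _.
rewrite odd_sum andbA -(big_addb_swap nct_odd) (big_morph (andb^~ _) (id1 := false) (op1 := addb)) //.
  by apply: eq_bigr => i _; rewrite !oddM -andbA.
by move=> a b; rewrite andb_addl.
Qed.

(** At an even index, the rule for odd indices turns the recursion into the one at half the index.
    At an odd index, the rule for even indices makes the sum symmetric, and only its middle term
    remains. *)
Lemma nct_odd_double n :
  nct_odd n.*2 = nct_odd n /\ nct_odd n.*2.+1 = ~~ odd n && nct_odd n./2.
Proof.
elim/ltn_ind: n => -[_|n IH].
  by rewrite /= /nct_odd nct0; split=> //; rewrite -/(nct_odd 1) nct_oddS big_ord_recl big_ord0 /nct_odd nct0.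
have ev : nct_odd n.+1.*2 = nct_odd n.+1.
  rewrite doubleS nct_oddS /= uphalf_double.
  rewrite (eq_bigr (fun i : 'I_n.+1 => (fun j => ~~ odd j && (nct_odd j./2 && nct_odd (n - j))) (n - i))); last first.
    move=> [i ile] _ /=; have -> : n.*2.+1 - i.*2 = (n - i).*2.+1 by lia.
    rewrite (proj2 (IH (n - i) _)); last by lia.
    by rewrite subKn // andbCA andbC; case: (odd _) (nct_odd _) (nct_odd _) => [] [] [].
  rewrite (reindex_inj rev_ord_inj) /=.
  rewrite (eq_bigr (fun i : 'I_n.+1 => ~~ odd i && (nct_odd i./2 && nct_odd (n - i)))); last first.
    by move=> [i ile] _ /=; rewrite subSS subKn.
  by rewrite (big_addb_even (fun i j => nct_odd i && nct_odd (n - j))) nct_oddS.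
split=> //; rewrite nct_oddS doubleK.
rewrite -(big_addb_swap nct_odd n.+1); apply: eq_bigr => -[i ile] _ /=.
congr andb; have -> : n.+1.*2 - i.*2 = (n.+1 - i).*2 by lia.
(* The term [i = 0] involves [n.+1] itself, which is covered by [ev] and not by the induction
   hypothesis. *)
have [->|ipos] := posnP i; first by rewrite subn0 ev.
by rewrite (proj1 (IH (n.+1 - i) _)) //; lia.
Qed.

(** For even [k] all weights [k - i.*2] are even. For [k = 2 * n + 1] they are all odd, and the sum
    is the one that computes [nct_odd] at [2 * (n + 1)]. *)
Lemma odd_card_unfoldable_nct k :
  odd #|[set y : {set 'I_k.+2 * 'I_k.+2} * 'I_k.+1 | `[< unfoldable y.1 y.2 >]]| =
  odd k && nct_odd k.+1./2.
Proof.
rewrite odd_card_unfoldable.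
have [ok|ek] := boolP (odd k); last first.
  rewrite big1 // => i _; rewrite [odd (_ - _)](_ : _ = false) ?andbF //.
  have [h|h] := leqP i.*2 k; first by rewrite oddB // odd_double (negPf ek).
  by rewrite (_ : k - i.*2 = 0) //; lia.
have [n ke] : exists n, k = n.*2.+1.
  by exists k./2; have := odd_double_half k; rewrite ok; lia.
have -> : k./2 = n by rewrite ke /= uphalf_double.
have -> : k.+1./2 = n.+1 by rewrite ke /= doubleK.
rewrite andTb nct_oddS -(big_addb_even (fun i j => nct_odd i && nct_odd (n - j))).
rewrite [RHS](reindex_inj rev_ord_inj) /=; apply: eq_bigr => -[i ile] _ /=.
have -> : k - i.*2 = (n - i).*2.+1 by lia.
rewrite (proj2 (nct_odd_double _)) /= odd_double andbT subSS subKn //.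
by case: (odd _) (nct_odd _) (nct_odd _) => [] [] [].
Qed.

(** * Negligent numbers *)

Lemma nct_odd0 : nct_odd 0.
Proof. by rewrite /nct_odd nct0. Qed.

Lemma nct_odd_4v1 v : nct_odd (4 * v + 1) = nct_odd v.
Proof.
have -> : 4 * v + 1 = v.*2.*2.+1 by lia.
by rewrite (proj2 (nct_odd_double _)) odd_double doubleK.
Qed.

Lemma nct_odd_pow2 j v : nct_odd (2 ^ j * v) = nct_odd v.
Proof.
elim: j => [|j IH]; first by rewrite expn0 mul1n.
by rewrite expnS -mulnA mul2n (proj1 (nct_odd_double _)).
Qed.

(** In binary, a positive number without adjacent digits 1 ends with 01 followed by [j] zeros; [v]
    is what precedes. *)
Lemma nct_odd_pow2_4v1 w : 0 < w -> nct_odd w ->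
  exists j v, nct_odd v /\ w = 2 ^ j * (4 * v + 1).
Proof.
elim/ltn_ind: w => w IH w0 wo.
have := odd_double_half w; case: (boolP (odd w)) => ow ew.
  have := wo; rewrite -ew add1n (proj2 (nct_odd_double _)) => /andP[eh hh].
  exists 0, w./2./2; split=> //; rewrite expn0 mul1n.
  by have := odd_double_half w./2; rewrite (negPf eh); lia.
have h0 : 0 < w./2 by lia.
have hw : w./2 < w by lia.
have ho : nct_odd w./2 by rewrite -(proj1 (nct_odd_double _)) -[_.*2]add0n ew.
have [j [v [vo e]]] := IH _ hw h0 ho.
by exists j.+1, v; split=> //; rewrite expnS -mulnA -e; lia.
Qed.

Lemma negligent_double v : negligent v -> negligent (2 * v).
Proof.
case=> [->|[f [l [lm ->]]]]; first by left.
right; exists f, (fun i => (l i).+1); split; first by move=> i j /lm.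
by rewrite big_distrr; apply: eq_bigr => i _ /=; rewrite expnS mulnCA.
Qed.

Lemma negligent_4v1 v : negligent v -> negligent (4 * v + 1).
Proof.
case=> [->|[f [l [lm ->]]]].
  right; exists 0, (fun=> 0); split=> //.
  by rewrite big_ord_recl big_ord0.
right; exists f.+1, (fun i => if unlift ord0 i is Some j then l j else 0); split.
  move=> i j; case: (unliftP ord0 i) => [i'|] ->; case: (unliftP ord0 j) => [j'|] -> //=.
  by rewrite /bump /= !add1n ltnS; exact: lm.
rewrite [RHS]big_ord_recl unlift_none /= !expn0 muln1 addnC; congr (_ + _).
rewrite big_distrr; apply: eq_bigr => i _ /=; rewrite liftK mulnA -expnS.
by rewrite /bump leq0n add1n.
Qed.

(** The digits 1 of a negligent number are at the places [2 * i + l i], which increase by at least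
    2. Both directions proceed by removing the lowest digits. *)
Lemma negligentP v : negligent v <-> nct_odd v.
Proof.
split.
  case=> [->|[f]]; first exact: nct_odd0.
  elim: f v => [|f IH] v [l [lm ->]].
    by rewrite big_ord_recl big_ord0 addn0 expn0 mul1n -[2 ^ _]muln1 nct_odd_pow2 -[1]/(4 * 0 + 1) nct_odd_4v1 nct_odd0.
  (* Dividing by [2 ^ l ord0] and removing the digit 1 then at place 0 leaves 4 times a sum of the
     same shape, with exponents [l']. *)
  pose l' (i : 'I_f.+1) := l (lift ord0 i) - l ord0.
  have l0 (i : 'I_f.+1) : l ord0 <= l (lift ord0 i) by apply: lm.
  have -> : \sum_(i < f.+2) 4 ^ i * 2 ^ l i = 2 ^ l ord0 * (4 * (\sum_(i < f.+1) 4 ^ i * 2 ^ l' i) + 1).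
    rewrite big_ord_recl expn0 mul1n mulnDr muln1 addnC; congr (_ + _).
    rewrite mulnA big_distrr; apply: eq_bigr => i _ /=; rewrite /bump leq0n add1n expnS.
    rewrite -[l (lift _ _)](subnKC (l0 i)) expnD -/(l' i).
    by move: (4 ^ i) (2 ^ l ord0) (2 ^ l' i) => p q r; lia.
  rewrite nct_odd_pow2 nct_odd_4v1; apply: IH; exists l'; split=> // i j ij.
  by rewrite leq_sub2r // lm // !lift0.
elim/ltn_ind: v => v IH vo.
have [->|v0] := posnP v; first by left.
have [[|j] [u [uo e]]] := nct_odd_pow2_4v1 v0 vo.
  by rewrite e expn0 mul1n; apply/negligent_4v1/IH => //; lia.
rewrite e expnS -mulnA; apply: negligent_double; apply: IH.
  by rewrite e expnS -mulnA; have := expn_gt0 2 j; lia.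
by rewrite nct_odd_pow2 nct_odd_4v1.
Qed.

(** Oddness forces [m = 2 * x + 1] with [x = 2 * w], so that the number of points [4 * x + 2] is
    [8 * w + 2]. *)
Lemma odd_central_trees_iff N m : N.+1 = 2 * m -> 3 < N.+1 ->
  odd #|central_trees N m| <-> exists w, [/\ 0 < w, nct_odd w & N.+1 = 8 * w + 2].
Proof.
move=> Nm N3; rewrite odd_central_trees //.
have [om|em] := boolP (odd m); last first.
  rewrite dihedral_trees_even_half // cards0; split=> // -[w [_ _ e]].
  by move: em; rewrite (_ : m = (2 * w).*2.+1) ?odd_double //; lia.
have [k mk] : exists k, m = 2 * k.+1 + 1.
  by exists (m./2).-1; have := odd_double_half m; rewrite om; lia.
have NE : N = 4 * k.+1 + 1 by lia.
rewrite mk NE card_dihedral_trees odd_card_unfoldable_nct; split.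
  case/andP=> ok ho; exists (k.+1./2); split=> //; have := odd_double_half k; rewrite ok; lia.
move=> [w [w0 wo e]].
have -> : k = (w.-1).*2.+1 by lia.
by rewrite /= odd_double doubleK prednK.
Qed.

Import GRing.Theory Num.Theory.

Theorem mainTheorem1 :
  let f := nb_genus_one_lct in
  let dvd_half (n : nat) := rat_dvd (n%:R / 2%:R)%R ((f n)%:R)%R in
  let exceptional (n : nat) :=
    (exists v : nat, negligent v /\ n = 32 * v + 10) \/
    (exists v : nat, negligent v /\ n = 64 * v + 18) \/
    (exists k v : nat,
       1 <= k /\ negligent v /\ n = 64 * 2 ^ k * v + 16 * 2 ^ k + 2) in
  (forall n : nat, 3 < n -> n %| f n \/ dvd_half n) /\
  (forall n : nat, 3 < n -> (~ (n %| f n) /\ dvd_half n <-> exceptional n)) /\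
  (forall n : nat, 3 < n -> ~ exceptional n -> n %| f n).
Proof.
move=> f dvd_half exceptional.
(* For [w = 2 ^ j * (4 * v + 1)], the forms (i), (ii) and (iii) of [8 * w + 2] correspond to
   [j = 0], [j = 1] and [j = k + 1]. *)
have exP n : exceptional n <-> exists w, [/\ 0 < w, nct_odd w & n = 8 * w + 2].
  split.
    case=> [[v [/negligentP vo ->]]|[[v [/negligentP vo ->]]|[k [v [k1 [/negligentP vo ->]]]]]].
    - by exists (4 * v + 1); split; [lia | rewrite nct_odd_4v1 | lia].
    - exists (2 ^ 1 * (4 * v + 1)); split; [lia | by rewrite nct_odd_pow2 nct_odd_4v1 | lia].
    - exists (2 ^ k.+1 * (4 * v + 1)); split; first by have := expn_gt0 2 k.+1; lia.
        by rewrite nct_odd_pow2 nct_odd_4v1.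
      by rewrite expnS; lia.
  case=> w [w0 wo ->]; have [[|[|j]] [v [vo ->]]] := nct_odd_pow2_4v1 w0 wo.
  - by left; exists v; split; [exact/negligentP | rewrite expn0; lia].
  - by right; left; exists v; split; [exact/negligentP | rewrite expn1; lia].
  - right; right; exists j.+1, v; split=> //; split; first exact/negligentP.
    by rewrite [2 ^ j.+2]expnS; lia.
have oddP n : 3 < n -> odd n -> n %| f n.
  by case: n => // n _; exact: dvdn_card_odd.
have evenP n : 3 < n -> ~~ odd n -> dvd_half n /\ (n %| f n <-> ~ exceptional n).
  case: n => // N N3 eN; pose m := N.+1./2.
  have Nm : N.+1 = 2 * m by have := odd_double_half N.+1; rewrite (negPf eN) -/m; lia.
  have [a fa] := card_genus_one_trees_even Nm.
  have bP := odd_central_trees_iff Nm N3; rewrite exP -bP.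
  have fE : f N.+1 = m * (2 * a + #|central_trees N m|).
    by rewrite [LHS]fa {1}Nm mulnDr mulnA [m * 2]mulnC.
  split.
    rewrite /dvd_half; exists (Posz (2 * a + #|central_trees N m|)).
    rewrite fE -pmulrn natrM mulrC; congr (_ * _)%R.
    by rewrite Nm natrM mulrC mulKf.
  have m0 : 0 < m by lia.
  rewrite fE [X in X %| _]Nm mulnC dvdn_pmul2l // dvdn2 oddD oddM /=.
  by split; [move/negP | move=> h; apply/negP].
have exEven n : exceptional n -> ~~ odd n.
  by move=> /exP[w [_ _ ->]]; rewrite (_ : 8 * w + 2 = (4 * w + 1).*2) ?odd_double //; lia.
split; [|split].
- move=> n n3; have [on|en] := boolP (odd n); first by left; exact: oddP.
  by right; have [] := evenP n n3 en.
- move=> n n3; split.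
    move=> [nf _]; have [on|en] := boolP (odd n); first by case: nf; exact: oddP.
    have [_ h] := evenP n n3 en; apply: contrapT => nex; apply: nf; exact/h.
  move=> ex; have en := exEven n ex; have [hd h] := evenP n n3 en.
  by split=> // /h.
- move=> n n3 nex; have [on|en] := boolP (odd n); first exact: oddP.
  by have [_ h] := evenP n n3 en; apply/h.
Qed.
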